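(* Let $X=M+A=M+C+V$ be a process of class $(\Sigma^{g})$. The following hold: (1) If $C$ is a non-decreasing process, then $X^{+}$ is a local submartingale. (2) If $C$ is a decreasing (i.e. non-increasing) process, then $X^{-}$ is a local submartingale. (3) If $C$ has no negative jump and $\int_{0}^{t}1_{\{X_{s}\neq0\}}dC^{c}_{s}=0$ for all $t\ge 0$, then $X^{+}$ is a local submartingale. (4) If $C$ has no positive jump and $\int_{0}^{t}1_{\{X_{s}\neq0\}}dC^{c}_{s}=0$ for all $t\ge 0$, then $X^{-}$ is a local submartingale.
   Context: Fix a filtered probability space $(\Omega,\mathcal{F},(\mathcal{F}_{t})_{t\geq0},\mathbf{P})$ satisfying the usual conditions. $X_{t-}$ is the left limit of $X$ at $t>0$ and $X_{0-}=X_0$; $X^+=\max(X,0)$, $X^-=\max(-X,0)$. For a càdlàg finite variation process $C$, $C^c_t=C_t-\sum_{s\le t}\Delta C_s$ is its continuous part. Class $(\Sigma^{g})$: $X$ is of class $(\Sigma^{g})$ if it decomposes as $X=M+A$ with $M$ a càdlàg local martingale, $M_0=0$; $A$ an adapted càdlàg predictable process of finite variation with $A_{0-}=A_0=0$; and $\int_{0}^{t}1_{\{X_{s}X_{s-}\neq0\}}dA_{s}=0$ for all $t\geq0$. Writing $X=M+C+V$ means $A=C+V$ with $C,V$ càdlàg predictable of finite variation, $\int_{0}^{t}1_{\{X_{s}\neq0\}}dC_{s}=\int_{0}^{t}1_{\{X_{s-}\neq0\}}dV_{s}=0$ for all $t\ge0$. *)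

(* Defs.v *)
(* Time is [0, +oo[, represented by the non-negative elements of R: a process
   is a function X : R -> Omega -> R whose values at negative times are never
   used.  As usual under the usual conditions, path properties and identities
   between processes are required P-almost surely. *)
From HB Require Import structures.
From mathcomp Require Import all_boot all_order all_algebra.
From mathcomp Require Import all_classical all_reals all_analysis.

Set Implicit Arguments.
Unset Strict Implicit.
Unset Printing Implicit Defensive.

Import Order.TTheory GRing.Theory Num.Theory.
Import numFieldNormedType.Exports.

Local Open Scope classical_set_scope.
Local Open Scope ring_scope.

Section paths.
Context {R : realType}.
Implicit Types (f h : R -> R) (t : R).

Definition cadlag_path f : Prop :=
  (forall t, 0 <= t -> f s @[s --> t^'+] --> f t) /\
  (forall t, 0 < t -> cvg (f s @[s --> t^'-])).

(* f_{t-}, with the convention f_{0-} = f_0 *)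
Definition left_lim f t : R := if 0 < t then lim (f s @[s --> t^'-]) else f 0.

Definition jump f t : R := f t - left_lim f t.

Definition fv_path f : Prop :=
  cadlag_path f /\ forall t, 0 <= t -> bounded_variation 0 t f.

(* For a cadlag path of finite variation the jumps are absolutely summable on
   ]0, t], so both unordered sums are finite; there is no jump at 0. *)
Definition sum_jumps f t : R :=
  fine (\esum_(s in `]0, t]) (Num.max (jump f s) 0)%:E)
  - fine (\esum_(s in `]0, t]) (Num.max (- jump f s) 0)%:E).

Definition continuous_part f t : R := f t - sum_jumps f t.

(* Only used to make the functions below total; see jordan_decomposition. *)
Definition fv_or0 f : R -> R := if `[< fv_path f >] then f else cst 0.

(* Jordan decomposition of a cadlag path of finite variation, extended to R by
   its value at 0 on ]-oo, 0], so that the associated Stieltjes measures do not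
   charge ]-oo, 0]. *)
Definition pos_var f t : R := fine (pos_tv 0 (fv_or0 f) (Num.max t 0)).
Definition neg_var f t : R := fine (neg_tv 0 (fv_or0 f) (Num.max t 0)).

Lemma fv_path_fv_or0 f : fv_path (fv_or0 f).
Proof.
rewrite /fv_or0; case: asboolP => // _; split; first split.
- by move=> t _; exact: cvg_cst.
- by move=> t _; exact: is_cvg_cst.
- by move=> t _; exact: nondecreasing_bounded_variation.
Qed.

Lemma jordan_decomposition f t : fv_path f -> 0 <= t ->
  f t = pos_var f t - neg_var f t.
Proof.
move=> fvf t0; rewrite /pos_var /neg_var /fv_or0 asboolT// max_l//.
by apply: (bounded_variation_pos_neg_tvE (fvf.2 _ t0)); rewrite in_itv/= t0 lexx.
Qed.

Let neg_nd f : (forall t, 0 <= t -> bounded_variation 0 t f) ->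
  {homo (fun t => fine (neg_tv 0 f (Num.max t 0))) : x y / x <= y}.
Proof.
move=> bv x y xy.
have y0 : 0 <= Num.max y 0 by rewrite le_max lexx orbT.
have xy0 : Num.max x 0 <= Num.max y 0.
  by rewrite ge_max !le_max xy lexx orbT.
apply: (fine_neg_tv_nondecreasing (bv _ y0)) => //.
  by rewrite in_itv/= xy0 le_max lexx orbT.
by rewrite in_itv/= lexx y0.
Qed.

Let neg_rc f : (forall t, 0 <= t -> bounded_variation 0 t f) ->
  (forall t, 0 <= t -> f s @[s --> t^'+] --> f t) ->
  right_continuous (fun t => fine (neg_tv 0 f (Num.max t 0))).
Proof.
move=> bv rc x; have [x0|x0] : 0 <= x \/ x < 0.
    by case: (leP 0 x); [left | right].
2: {
  apply: (@cvg_trans _ ((fun=> fine (neg_tv 0 f (Num.max x 0))) @ x^'+));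
    last exact: cvg_cst.
  apply: near_eq_cvg; near=> s; rewrite /= [in LHS]max_r ?(ltW x0)//.
  have s0 : s <= 0 by near: s; exact: nbhs_right_le.
  by rewrite max_r. }
have x1 : x < x + 1 by rewrite ltrDl.
have bv1 : bounded_variation 0 (x + 1) f by apply: bv; rewrite addr_ge0.
have := neg_tv_right_continuous x0 x1 bv1 (rc _ x0).
rewrite -{2}(max_l x0); apply: cvg_trans.
apply: near_eq_cvg; near=> s; rewrite /= max_l//.
by rewrite (le_trans x0)//; near: s; exact: nbhs_right_ge.
Unshelve. all: by end_near. Qed.

Let fvN f : fv_path f ->
  (forall t, 0 <= t -> bounded_variation 0 t (\- f)) /\
  (forall t, 0 <= t -> (\- f) s @[s --> t^'+] --> (\- f) t).
Proof.
move=> [[rc _] bv]; split=> t t0; first exact/bounded_variationN/bv.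
apply: cvgN; exact: rc.
Qed.

Let pos_var_nd f : {homo pos_var f : x y / x <= y}.
Proof. by apply: neg_nd; case: (fvN (fv_path_fv_or0 f)). Qed.
Let pos_var_rc f : right_continuous (pos_var f).
Proof. by case: (fvN (fv_path_fv_or0 f)) => bv rc; exact: neg_rc. Qed.
Let neg_var_nd f : {homo neg_var f : x y / x <= y}.
Proof. by apply: neg_nd; case: (fv_path_fv_or0 f). Qed.
Let neg_var_rc f : right_continuous (neg_var f).
Proof. by case: (fv_path_fv_or0 f) => -[rc _] bv; exact: neg_rc. Qed.

HB.instance Definition _ f :=
  isCumulative.Build R _ R (pos_var f) (@pos_var_nd f) (@pos_var_rc f).
HB.instance Definition _ f :=
  isCumulative.Build R _ R (neg_var f) (@neg_var_nd f) (@neg_var_rc f).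

(* int_0^t h_s df_s, over ]0, t], for f cadlag of finite variation and h bounded
   Borel (so that both integrals are finite) *)
Definition stieltjes_int h f t : R :=
  Rintegral (lebesgue_stieltjes_measure (pos_var f)) `]0, t] h
  - Rintegral (lebesgue_stieltjes_measure (neg_var f)) `]0, t] h.

End paths.

Section processes.
Context {R : realType} {d : measure_display} {Omega : measurableType d}.
Variable P : probability Omega R.
Implicit Types (F : R -> set (set Omega)) (X : R -> Omega -> R).

Definition filtration F : Prop :=
  [/\ forall t, 0 <= t -> sigma_algebra setT (F t),
      forall t, 0 <= t -> F t `<=` measurable &
      forall s t, 0 <= s -> s <= t -> F s `<=` F t].

Definition usual_conditions F : Prop :=
  [/\ filtration F,
      forall t, 0 <= t -> \bigcap_(s in [set s | t < s]) F s = F t &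
      forall N, P.-negligible N -> F 0 N].

Definition measurable_wrt (G : set (set Omega)) (Y : Omega -> R) : Prop :=
  forall B : set R, measurable B -> G (Y @^-1` B).

Definition adapted F X : Prop := forall t, 0 <= t -> measurable_wrt (F t) (X t).

Definition predictable_sets F : set (set (R * Omega)) :=
  [set E | exists2 A, F 0 A & E = [set 0] `*` A] `|`
  [set E | exists s t A, [/\ 0 <= s, s < t, F s A & E = `]s, t] `*` A]].

(* measurable for the predictable sigma-algebra on [0, +oo[ x Omega *)
Definition predictable F X : Prop :=
  let D := `[0, +oo[%classic `*` [set: Omega] in
  forall B : set R, measurable B ->
    <<s D, predictable_sets F >> (D `&` [set z | B (X z.1 z.2)]).

Definition cadlag X : Prop := {ae P, forall w, cadlag_path (X ^~ w)}.

Definition finite_variation X : Prop := {ae P, forall w, fv_path (X ^~ w)}.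

(* Y is a version of E[Z | G]; Z is meant to be integrable *)
Definition is_cond_exp (G : set (set Omega)) (Z Y : Omega -> R) : Prop :=
  [/\ measurable_wrt G Y, P.-integrable setT (EFin \o Y) &
      forall A, G A ->
        (\int[P]_(w in A) (Y w)%:E = \int[P]_(w in A) (Z w)%:E)%E].

Definition integrable_process X : Prop :=
  forall t, 0 <= t -> P.-integrable setT (EFin \o X t).

Definition martingale F X : Prop :=
  [/\ adapted F X, integrable_process X &
      forall s t, 0 <= s -> s <= t -> is_cond_exp (F s) (X t) (X s)].

Definition submartingale F X : Prop :=
  [/\ adapted F X, integrable_process X &
      forall s t, 0 <= s -> s <= t ->
        exists2 Y, is_cond_exp (F s) (X t) Y & {ae P, forall w, X s w <= Y w}].

Definition stopping_time F (T : Omega -> \bar R) : Prop :=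
  (forall w, 0 <= T w)%E /\
  (forall t, 0 <= t -> F t [set w | (T w <= t%:E)%E]).

(* X^T 1_{T > 0}, so that localization is meaningful for any initial value *)
Definition stopped (T : Omega -> \bar R) X : R -> Omega -> R :=
  fun t w => if (0 < T w)%E then X (fine (Order.min t%:E (T w))) w else 0.

Definition localizing_sequence F (T : nat -> Omega -> \bar R) : Prop :=
  [/\ forall n, stopping_time F (T n),
      {ae P, forall w, nondecreasing_seq (T ^~ w)} &
      {ae P, forall w, T n w @[n --> \oo] --> +oo%E}].

Definition local_martingale F X : Prop :=
  [/\ adapted F X, cadlag X & exists2 T, localizing_sequence F T &
      forall n, martingale F (stopped (T n) X)].

Definition local_submartingale F X : Prop :=
  [/\ adapted F X, cadlag X & exists2 T, localizing_sequence F T &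
      forall n, submartingale F (stopped (T n) X)].

(* X = M + A is a decomposition witnessing that X is of class (Sigma^g) *)
Definition class_Sigma_g F X M A : Prop :=
  [/\ {ae P, forall w t, 0 <= t -> X t w = M t w + A t w},
      local_martingale F M /\ {ae P, forall w, M 0 w = 0},
      [/\ adapted F A, predictable F A & finite_variation A],
      {ae P, forall w, A 0 w = 0} &
      {ae P, forall w t, 0 <= t ->
         stieltjes_int (\1_[set s | X s w * left_lim (X ^~ w) s != 0])
           (A ^~ w) t = 0}].

(* A = C + V is the decomposition in the notation X = M + C + V *)
Definition CV_decomposition F X A C V : Prop :=
  [/\ {ae P, forall w t, 0 <= t -> A t w = C t w + V t w},
      predictable F C /\ finite_variation C,
      predictable F V /\ finite_variation V,
      {ae P, forall w t, 0 <= t ->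
         stieltjes_int (\1_[set s | X s w != 0]) (C ^~ w) t = 0} &
      {ae P, forall w t, 0 <= t ->
         stieltjes_int (\1_[set s | left_lim (X ^~ w) s != 0]) (V ^~ w) t = 0}].

Definition nondecreasing_process X : Prop :=
  {ae P, forall w s t, 0 <= s -> s <= t -> X s w <= X t w}.

Definition nonincreasing_process X : Prop :=
  {ae P, forall w s t, 0 <= s -> s <= t -> X t w <= X s w}.

Definition no_negative_jump X : Prop :=
  {ae P, forall w t, 0 <= t -> 0 <= jump (X ^~ w) t}.

Definition no_positive_jump X : Prop :=
  {ae P, forall w t, 0 <= t -> jump (X ^~ w) t <= 0}.

Definition pos_part X : R -> Omega -> R := fun t w => Num.max (X t w) 0.

Definition neg_part X : R -> Omega -> R := fun t w => Num.max (- X t w) 0.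

End processes.

(* Main.v *)
Require Import Defs.
From mathcomp Require Import all_boot all_order all_algebra.
From mathcomp Require Import all_classical all_reals all_analysis.
From mathcomp Require Import measurable_realfun ring lra.
Import Order.TTheory GRing.Theory Num.Theory.
Import numFieldNormedType.Exports.
Local Open Scope classical_set_scope.
Local Open Scope ring_scope.
Set Implicit Arguments.
Unset Strict Implicit.
Unset Printing Implicit Defensive.

(** The proof is a one-sided Tanaka formula obtained by discretization. Let f be
convex with slope g, a function with values in [-1, 1]. Along a grid
s = u_0 <= ... <= u_k = t the subgradient inequality gives

  f(X_t) - f(X_s) >= sum_i g(X_{u_i}) (M_{u_{i+1}} - M_{u_i})
                   + sum_i g(X_{u_i}) (A_{u_{i+1}} - A_{u_i}).

The first sum has expectation 0 on every event of F_s. When the mesh tends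
to 0 the second one tends to the integral of g(X_{u-}) dA_u over ]s, t]. Take
g continuous with g(0) = 0. The measure dV does not charge {X_- <> 0}, where
g(X_-) lives, so V contributes nothing. The measure dC does not charge
{X <> 0}, so C contributes only at the times where X_- <> 0 and X = 0; each of
these is the first zero of X after some rational time, so that they are
countably many and the contribution of C is a sum of terms
g(X_{u-}) Delta C_u. Each of the four hypotheses fixes the sign of Delta C, so
that these terms are nonnegative (riemann_liminf_ge0), whence
E[f(X_s); B] <= E[f(X_t); B] for B in F_s (tanaka_le). The functions f are
convex approximations, with a continuous slope vanishing at 0, of the positive
part (smooth_pos) or of the negative part.

This needs M to be a martingale, and A and its variation to be bounded. Since
A may have large jumps, stopping when |A| exceeds n does not make it bounded:
one has to stop strictly before. This is possible because A is predictable
(predictable_locally_bounded). The graph of the time S where |A| first exceeds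
n lies in the predictable set {|A| >= n}; for the measure P((S, .) in E), every
predictable set E is approximated from inside by sets with compact sections
(predictable_inner), and compactness allows one to announce the debut of such a
set by a stopping time that is rarely much earlier (kset_foretell). A
Borel-Cantelli argument turns these times into a localizing sequence. The
variation of A is controlled along the grids at the times where it has not yet
exceeded n on complete cells (variation_times); the at most two incomplete
cells are controlled by the bound on |A| (grid_variation).

Finally the martingale is stopped at a time that does not belong to the grid.
It is first stopped late, at the next grid time, which keeps the increments
orthogonal to the past, and converges in L^1 as the mesh tends to 0
(stop_late_L1). *)

(** * Expectations of real random variables *)

Section limits.
Context {R : realType}.

Lemma cvg_le_cst (u : nat -> R) l c : u n @[n --> \oo] --> l ->
  (forall n, u n <= c) -> l <= c.
Proof.
move=> h uc; rewrite -(cvg_lim _ h)//; apply: limr_le; first exact: cvgP h.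
exact: nearW.
Qed.

Lemma cvg_lipschitz1 {T : Type} {F : set_system T} {FF : Filter F}
    (g : R -> R) (f : T -> R) l :
  (forall x y, `|g x - g y| <= `|x - y|) ->
  f x @[x --> F] --> l -> g (f x) @[x --> F] --> g l.
Proof.
move=> lip /cvgrPdist_lt h; apply/cvgrPdist_lt => e e0.
by apply: filterS (h _ e0) => x; exact: le_lt_trans.
Qed.

Lemma min_lipschitz1 (K x y : R) : `|Num.min x K - Num.min y K| <= `|x - y|.
Proof.
have le1 a b : a <= b -> `|Num.min b K - Num.min a K| <= `|b - a|.
  move=> ab; rewrite !ger0_norm ?subr_ge0//; last first.
    by rewrite le_min !ge_min ab lexx orbT.
  by rewrite /Num.min; case: ltP => ?; case: ltP => ?; lra.
by have [/le1|/ltW/le1] := leP x y; rewrite 1?distrC [X in _ <= X]distrC.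
Qed.

End limits.

Section expectation.
Context {R : realType} {d : measure_display} {Omega : measurableType d}.
Variable P : probability Omega R.
Implicit Types (f g : Omega -> R) (B : set Omega).

Definition integ f := P.-integrable setT (EFin \o f).

Lemma integ_measurable f : integ f -> measurable_fun setT f.
Proof. by move=> /measurable_int /measurable_EFinP. Qed.

Lemma integ_le_ae f g : measurable_fun setT f -> integ g ->
  (\forall w \ae P, `|f w| <= g w) -> integ f.
Proof.
move=> mf /integrableP[mg goo] fg; apply/integrableP; split.
  exact/measurable_EFinP.
apply: le_lt_trans goo; apply: ae_ge0_le_integral => //=.
- by do 2 apply: measurableT_comp => //.
- by do 2 apply: measurableT_comp => //; exact/measurable_EFinP.
- apply: filterS fg => w fg _; rewrite lee_fin.
  by apply: le_trans fg _; rewrite ler_norm.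
Qed.

Lemma integ_cst c : integ (fun=> c).
Proof. exact: finite_measure_integrable_cst. Qed.

Lemma integ_bounded_ae f c : measurable_fun setT f ->
  (\forall w \ae P, `|f w| <= c) -> integ f.
Proof. by move=> mf; apply: (integ_le_ae mf (integ_cst c)). Qed.

Lemma integD f g : integ f -> integ g -> integ (fun w => f w + g w).
Proof. by move=> fi gi; have := integrableD measurableT fi gi. Qed.

Lemma integN f : integ f -> integ (fun w => - f w).
Proof. by move=> fi; have := integrableN fi. Qed.

Lemma integB f g : integ f -> integ g -> integ (fun w => f w - g w).
Proof. by move=> fi gi; apply: integD => //; exact: integN. Qed.

Lemma integZ c f : integ f -> integ (fun w => c * f w).
Proof. by move=> fi; have := integrableZl measurableT c fi. Qed.

Lemma integ_sum (n : nat) (h : nat -> Omega -> R) :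
  (forall i, (i < n)%N -> integ (h i)) -> integ (fun w => \sum_(i < n) h i w).
Proof.
elim: n => [_|n IH hi].
  by under eq_fun do rewrite big_ord0; exact: integ_cst.
under eq_fun do rewrite big_ord_recr/=.
by apply: integD; [apply: IH => i ni; apply: hi; exact: ltnW|exact: hi].
Qed.

Lemma integ_norm f : integ f -> integ (fun w => `|f w|).
Proof. by move=> fi; have := integrable_norm fi. Qed.

Lemma integM_bounded f g c : measurable_fun setT g ->
  (forall w, `|g w| <= c) -> integ f -> integ (fun w => g w * f w).
Proof.
move=> mg gc fi; apply: (@integ_le_ae _ (fun w => c * `|f w|)).
- by apply: measurable_funM => //; exact: integ_measurable.
- exact/integZ/integ_norm.
- by apply: aeW => w; rewrite normrM ler_wpM2r.
Qed.

Lemma integ_indic B f : measurable B -> integ f -> integ (fun w => \1_B w * f w).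
Proof.
move=> mB; apply: (@integM_bounded _ _ 1); first exact: measurable_indic.
by move=> w; rewrite indicE; case: (w \in B); rewrite ?normr1 ?normr0.
Qed.

Local Notation E f := (Rintegral P setT f).

Lemma E_D f g : integ f -> integ g -> E (fun w => f w + g w) = E f + E g.
Proof. by move=> fi gi; rewrite RintegralD. Qed.

Lemma E_B f g : integ f -> integ g -> E (fun w => f w - g w) = E f - E g.
Proof. by move=> fi gi; rewrite RintegralB. Qed.

Lemma E_Z c f : integ f -> E (fun w => c * f w) = c * E f.
Proof. by move=> fi; rewrite RintegralZl. Qed.

Lemma E_cst c : E (fun=> c) = c.
Proof.
rewrite Rintegral_cst//.
exact: etrans (congr1 (fun z => c * fine z) (probability_setT P)) (mulr1 c).
Qed.

Lemma E_le_ae f g : integ f -> integ g ->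
  (\forall w \ae P, f w <= g w) -> E f <= E g.
Proof.
move=> fi gi fg; rewrite -subr_ge0 -E_B// /Rintegral fine_ge0//.
have gf : integ (fun w => Num.max (g w - f w) 0).
  apply: (@integ_le_ae _ (fun w => `|g w - f w|)).
  - by apply: measurable_maxr => //; apply/integ_measurable/integB.
  - exact/integ_norm/integB.
  - apply: aeW => w; rewrite ger0_norm ?le_max ?lexx ?orbT//.
    by rewrite ge_max normr_ge0 ler_norm.
have -> : (\int[P]_w (g w - f w)%:E = \int[P]_w (Num.max (g w - f w) 0)%:E)%E.
  apply: ae_eq_integral => //.
  - exact/measurable_EFinP/integ_measurable/integB.
  - exact/measurable_EFinP/integ_measurable.
  - by apply: filterS fg => w fg _; rewrite max_l// subr_ge0.
by apply: integral_ge0 => w _; rewrite lee_fin le_max lexx orbT.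
Qed.

Lemma E_sum (n : nat) (h : nat -> Omega -> R) :
  (forall i, (i < n)%N -> integ (h i)) ->
  E (fun w => \sum_(i < n) h i w) = \sum_(i < n) E (h i).
Proof.
elim: n => [_|n IH hi].
  rewrite big_ord0 -[RHS]E_cst; congr (fine _); apply: eq_integral => w _.
  by rewrite big_ord0.
rewrite big_ord_recr/= -IH; last by move=> i ni; apply: hi; exact: ltnW.
rewrite -E_D; first by congr (fine _); apply: eq_integral => w _; rewrite big_ord_recr.
- by apply: integ_sum => i ni; apply: hi; exact: ltnW.
- exact: hi.
Qed.

Lemma E_norm f : integ f -> `|E f| <= E (fun w => `|f w|).
Proof. by move=> fi; apply: le_normr_Rintegral. Qed.

Lemma E_indic B f : measurable B -> E (fun w => \1_B w * f w) = \int[P]_(w in B) f w.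
Proof.
move=> mB; rewrite [RHS]Rintegral_mkcond; congr (fine _); apply: eq_integral => w _.
by rewrite /patch indicE; case: (w \in B); rewrite ?mul1r ?mul0r.
Qed.

Lemma EFin_Rintegral B f : measurable B -> integ f ->
  (\int[P]_(w in B) f w)%:E = (\int[P]_(w in B) (f w)%:E)%E.
Proof.
move=> mB fi; rewrite fineK//; apply: integrable_fin_num => //.
exact: (integrableS measurableT).
Qed.

Lemma E_dominated (f_ : nat -> Omega -> R) f g :
  (forall n, measurable_fun setT (f_ n)) -> measurable_fun setT f -> integ g ->
  (\forall w \ae P, forall n, `|f_ n w| <= g w) ->
  (\forall w \ae P, f_ n w @[n --> \oo] --> f w) ->
  integ f /\ E (f_ n) @[n --> \oo] --> E f.
Proof.
move=> mf_ mf gi fg ff.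
have [|||||fi _ cv] := @dominated_convergence _ _ _ P setT measurableT
  (fun n => EFin \o f_ n) (EFin \o f) (EFin \o g).
- by move=> n; exact/measurable_EFinP.
- exact/measurable_EFinP.
- apply: filterS ff => w h _.
  by apply/fine_cvgP; split=> //; exact: nearW.
- exact: gi.
- by apply: filterS fg => w h n _; rewrite lee_fin.
split=> //; apply: fine_cvg; rewrite EFin_Rintegral//; exact: cv.
Qed.

(** Fatou's lemma, in the form that passes integrability to an almost sure
limit. Truncation at a level K makes dominated convergence applicable, and
monotone convergence in K removes the truncation. *)
Lemma E_fatou (f_ : nat -> Omega -> R) f c :
  (forall n, integ (f_ n)) -> (forall n w, 0 <= f_ n w) ->
  (forall n, E (f_ n) <= c) -> measurable_fun setT f ->
  (\forall w \ae P, f_ n w @[n --> \oo] --> f w) ->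
  integ f /\ E f <= c.
Proof.
move=> fi f0 fc mf ff.
have mmin (g : Omega -> R) (K : R) : measurable_fun setT g ->
    measurable_fun setT (fun w => Num.min `|g w| K).
  by move=> mg; apply: measurable_minr => //; exact: measurableT_comp.
have min_cvg w (K : R) : f_ n w @[n --> \oo] --> f w ->
    Num.min `|f_ n w| K @[n --> \oo] --> Num.min `|f w| K.
  by move=> h; exact: (@cvg_lipschitz1 _ _ _ _ (Num.min^~ K) _ _ (min_lipschitz1 K) (cvg_norm h)).
have min_le g (K : nat) w : `|Num.min `|g w| K%:R| <= K%:R.
  by rewrite ger0_norm ?ge_min ?lexx ?orbT// le_min normr_ge0 ler0n.
have minc (K : nat) : E (fun w => Num.min `|f w| K%:R) <= c.
  have [|||||_ cv] := @E_dominated (fun n w => Num.min `|f_ n w| K%:R)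
     (fun w => Num.min `|f w| K%:R) (fun=> K%:R).
  - by move=> n; apply/mmin/integ_measurable.
  - exact: mmin.
  - exact: integ_cst.
  - by apply: aeW => w n; exact: min_le.
  - by apply: filterS ff => w; exact: min_cvg.
  apply: (cvg_le_cst cv) => n; apply: le_trans (fc n); apply: E_le_ae => //.
    apply: integ_bounded_ae; [exact/mmin/integ_measurable|].
    by apply: aeW => w; exact: min_le.
  by apply: aeW => w; rewrite ge_min ger0_norm ?lexx.
have mm (K : nat) : measurable_fun setT (fun w => (Num.min `|f w| K%:R)%:E).
  exact/measurable_EFinP/mmin.
have min0 (K : nat) w : setT w -> (0 <= (Num.min `|f w| K%:R)%:E)%E.
  by move=> _; rewrite lee_fin le_min normr_ge0 ler0n.
have min_nd w : setT w ->
    {homo (fun K : nat => (Num.min `|f w| K%:R)%:E) : m n / (m <= n)%N >-> (m <= n)%E}.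
  move=> _ m n mn; rewrite lee_fin le_min ge_min lexx/= ge_min.
  by rewrite ler_nat mn orbT.
have fle : (\int[P]_w `|(f w)%:E| <= c%:E)%E.
  have -> : (fun w => `|(f w)%:E|%E) = (fun w => limn (fun K : nat => (Num.min `|f w| K%:R)%:E)).
    apply/funext => w; apply/esym/cvg_lim => //.
    apply: cvg_near_cst; exists (Num.truncn `|f w|).+1 => // n /= nf.
    rewrite min_l//; apply: le_trans (ltW (truncnS_gt _)) _.
    by rewrite ler_nat.
  have cv := @cvg_monotone_convergence _ _ _ P setT measurableT _ mm min0 min_nd.
  rewrite -(cvg_lim _ cv)//; apply: lime_le; first exact: cvgP cv.
  apply: nearW => K; rewrite -EFin_Rintegral ?lee_fin//.
  by apply: integ_bounded_ae; [exact: mmin|apply: aeW => w; exact: min_le].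
have fi' : integ f.
  apply/integrableP; split; first exact/measurable_EFinP.
  by apply: le_lt_trans fle _; exact: ltry.
split=> //; apply: (@le_trans _ _ (E (fun w => `|f w|))).
  by apply: E_le_ae => //; [exact: integ_norm|apply: aeW => w; exact: ler_norm].
by rewrite -lee_fin EFin_Rintegral//; exact: integ_norm.
Qed.

End expectation.

(** * Random variables measurable for a sub-sigma-algebra; conditional expectation *)

Section sub_sigma_algebra.
Context {R : realType} {d : measure_display} {Omega : measurableType d}.
Variable P : probability Omega R.
Variable G : set (set Omega).
Hypothesis sG : sigma_algebra setT G.
Hypothesis GM : G `<=` measurable.
Implicit Types (Y Z : Omega -> R) (A B : set Omega).

Lemma sG_measurableE : G.-sigma.-measurable = G.
Proof. exact: measurable_g_measurableTypeE. Qed.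

Lemma mwrtP Y : measurable_wrt G Y <->
  measurable_fun setT (Y : g_sigma_algebraType G -> R).
Proof.
split=> [mY _ B mB|mY B mB].
  by rewrite setTI sG_measurableE; exact: mY.
by have := mY measurableT B mB; rewrite setTI sG_measurableE.
Qed.

Lemma sG0 : G set0. Proof. by case: sG. Qed.

Lemma sGC A : G A -> G (~` A).
Proof. by rewrite -setTD; case: sG => _ h _; exact: h. Qed.

Lemma sGT : G setT. Proof. by rewrite -setC0; exact/sGC/sG0. Qed.

Lemma sGI A B : G A -> G B -> G (A `&` B).
Proof. by rewrite -sG_measurableE; exact: measurableI. Qed.

Lemma sGU A B : G A -> G B -> G (A `|` B).
Proof. by rewrite -sG_measurableE; exact: measurableU. Qed.

Lemma sGD A B : G A -> G B -> G (A `\` B).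
Proof. by rewrite -sG_measurableE; exact: measurableD. Qed.

Lemma sG_bigcup (F : nat -> set Omega) :
  (forall n, G (F n)) -> G (\bigcup_n F n).
Proof. by case: sG => _ _; apply. Qed.

Lemma sG_bigcap (F : nat -> set Omega) :
  (forall n, G (F n)) -> G (\bigcap_n F n).
Proof. by rewrite -sG_measurableE; exact: bigcapT_measurable. Qed.

Lemma mwrt_measurable Y : measurable_wrt G Y -> measurable_fun setT Y.
Proof. by move=> mY _ B mB; rewrite setTI; exact/GM/mY. Qed.

Lemma mwrt_cst (c : R) : measurable_wrt G (fun=> c).
Proof. exact/mwrtP/measurable_cst. Qed.

Lemma mwrtD Y Z : measurable_wrt G Y -> measurable_wrt G Z ->
  measurable_wrt G (fun w => Y w + Z w).
Proof. by move=> /mwrtP mY /mwrtP mZ; exact/mwrtP/measurable_funD. Qed.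

Lemma mwrtB Y Z : measurable_wrt G Y -> measurable_wrt G Z ->
  measurable_wrt G (fun w => Y w - Z w).
Proof. by move=> /mwrtP mY /mwrtP mZ; exact/mwrtP/measurable_funB. Qed.

Lemma mwrtM Y Z : measurable_wrt G Y -> measurable_wrt G Z ->
  measurable_wrt G (fun w => Y w * Z w).
Proof. by move=> /mwrtP mY /mwrtP mZ; exact/mwrtP/measurable_funM. Qed.

Lemma mwrt_sum n (Y : nat -> Omega -> R) :
  (forall i, (i < n)%N -> measurable_wrt G (Y i)) ->
  measurable_wrt G (fun w => \sum_(i < n) Y i w).
Proof.
elim: n => [_|n IH mY].
  by under eq_fun do rewrite big_ord0; exact: mwrt_cst.
under eq_fun do rewrite big_ord_recr/=.
by apply: mwrtD; [apply: IH => i ni; exact/mY/ltnW|exact: mY].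
Qed.

Lemma mwrt_indic A : G A -> measurable_wrt G (\1_A : Omega -> R).
Proof.
move=> GA; apply/mwrtP/measurable_indic.
by rewrite sG_measurableE.
Qed.

Lemma mwrt_comp (g : R -> R) Y : measurable_fun setT g ->
  measurable_wrt G Y -> measurable_wrt G (fun w => g (Y w)).
Proof.
by move=> mg mY B mB; rewrite -[X in G X]/(Y @^-1` (g @^-1` B)); apply: mY;
  rewrite -[X in measurable X]setTI; exact: mg.
Qed.

Lemma mwrt_ge Y c : measurable_wrt G Y -> G [set w | c <= Y w].
Proof.
move=> mY; rewrite (_ : [set _ | _] = Y @^-1` `[c, +oo[).
  by apply: mY; exact: measurable_itv.
by apply/seteqP; split=> w; rewrite /= in_itv/= andbT.
Qed.

Lemma mwrt_gt Y c : measurable_wrt G Y -> G [set w | c < Y w].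
Proof.
move=> mY; rewrite (_ : [set _ | _] = Y @^-1` `]c, +oo[).
  by apply: mY; exact: measurable_itv.
by apply/seteqP; split=> w; rewrite /= in_itv/= andbT.
Qed.

Lemma mwrt_cvg (Y_ : nat -> Omega -> R) Y :
  (forall n, measurable_wrt G (Y_ n)) ->
  (forall w, Y_ n w @[n --> \oo] --> Y w) -> measurable_wrt G Y.
Proof.
move=> mY cv; apply/mwrtP.
apply: (@measurable_fun_cvg _ (g_sigma_algebraType G) R setT Y_ Y) => [n|w _].
  exact/mwrtP.
exact: cv.
Qed.

Hypothesis nullG : forall N, P.-negligible N -> G N.

(** The two preimages of a Borel set differ by a null set, which is an event of
G. *)
Lemma mwrt_ae_eq Y Z : measurable_wrt G Z ->
  (\forall w \ae P, Y w = Z w) -> measurable_wrt G Y.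
Proof.
move=> mZ YZ B mB.
have -> : Y @^-1` B = ((Z @^-1` B) `\` ~` [set w | Y w = Z w]) `|`
                     (Y @^-1` B `&` ~` [set w | Y w = Z w]).
  apply/seteqP; split=> w /=.
    move=> BY; have [e|ne] := pselect (Y w = Z w); [left|by right].
    by split; [rewrite -e|move=> /(_ e)].
  by move=> [[BZ /contrapT ->]|[]].
apply: sGU; first by apply: sGD; [exact: mZ|exact: nullG].
by apply: nullG; apply: negligibleS YZ => w [].
Qed.

(** The set where Y_ converges is an event of G; on multiplying by its indicator
the convergence becomes sure. *)
Lemma mwrt_cvg_ae (Y_ : nat -> Omega -> R) Y :
  (forall n, measurable_wrt G (Y_ n)) ->
  (\forall w \ae P, Y_ n w @[n --> \oo] --> Y w) -> measurable_wrt G Y.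
Proof.
move=> mY cv.
pose N := [set w | Y_ n w @[n --> \oo] --> Y w].
have GN : G N by rewrite -[N]setCK; exact/sGC/nullG.
apply: (@mwrt_ae_eq _ (fun w => \1_N w * Y w)); last first.
  apply: filterS cv => w h.
  by rewrite indicE mem_set ?mul1r.
apply: (@mwrt_cvg (fun n w => \1_N w * Y_ n w)) => [n|w].
  by apply: mwrtM => //; exact: mwrt_indic.
rewrite indicE; have [|_] := boolP (w \in N).
  by rewrite inE => h; apply: cvgMr.
rewrite mul0r; under eq_fun do rewrite mul0r; exact: cvg_cst.
Qed.

End sub_sigma_algebra.

(** The number of the levels 1, ..., n that are at most y is the integer part
of y. *)
Lemma staircase {R : realType} (n : nat) (y : R) : 0 <= y -> y <= n%:R ->
  `|y - \sum_(j < n) (j.+1%:R <= y)%R%:R| <= 1.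
Proof.
elim: n => [|n IH] y0 yn.
  by rewrite big_ord0 subr0 ger0_norm// (le_trans yn).
rewrite big_ord_recr/=; have [yn'|ny] := leP y n%:R.
  have -> : (n.+1%:R <= y) = false.
    by apply/negbTE; rewrite -ltNge (le_lt_trans yn')// ltr_nat.
  rewrite addr0.
  exact: IH.
have -> : \sum_(j < n) (j.+1%:R <= y)%R%:R = n%:R :> R.
  rewrite (eq_bigr (fun=> 1)) ?sumr_const ?card_ord// => j _.
  by rewrite (le_trans _ (ltW ny))// ler_nat.
have : n.+1%:R = n%:R + 1 :> R by rewrite natr1.
by case: (leP n.+1%:R y) => h /= e; rewrite ler_norml; lra.
Qed.

Section cond_exp.
Context {R : realType} {d : measure_display} {Omega : measurableType d}.
Variable P : probability Omega R.
Variable G : set (set Omega).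
Hypothesis sG : sigma_algebra setT G.
Hypothesis GM : G `<=` measurable.
Implicit Types (Y Z : Omega -> R).

Let idG : Omega -> g_sigma_algebraType G := idfun.

Let measurable_idG : measurable_fun setT idG.
Proof. by move=> _ B; rewrite setTI preimage_id sG_measurableE//; exact: GM. Qed.

(** Radon-Nikodym on G: the charge A |-> int_A Z and the measure P are pushed
forward along the identity map from Omega to Omega equipped with G. *)
Lemma cond_exp_exists Z : integ P Z -> exists Y, is_cond_exp P G Z Y.
Proof.
move=> iZ.
pose X : {RV P >-> g_sigma_algebraType G} := mfun_Sub (mem_set measurable_idG).
pose nu_ : {charge set _ -> \bar R} := pushforward (induced_charge iZ) X.
pose nu := nu_ measurable_idG.
have dom : nu `<< distribution P X.
  apply/null_content_dominatesP => A mA PA0.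
  apply: null_set_integral => //=; last exact: measurable_funTS (measurable_int _ iZ).
  by rewrite -[X in measurable X]setTI; exact: measurable_idG.
pose Y := Radon_Nikodym nu (distribution P X).
have Yfin w : Y w \is a fin_num by exact: Radon_Nikodym_fin_num.
have Yint : (distribution P X).-integrable setT Y.
  exact: Radon_Nikodym_integrable dom.
have Yint' : P.-integrable setT (Y \o X).
  apply/integrableP; split.
    apply: measurableT_comp => //; exact: measurable_int Yint.
  have := Yint => /integrableP[mY]; rewrite ge0_integral_distribution//.
  exact: measurableT_comp.
have YE A : G A -> (nu A = \int[P]_(w in A) Y w)%E.
  move=> GA; have mA : measurable (A : set (g_sigma_algebraType G)).
    by rewrite sG_measurableE.
  rewrite (Radon_Nikodym_integral dom mA) -/Y integral_pushforward//.
  - exact: measurable_int Yint.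
  - by apply: integrableS Yint' => //; exact: GM.
have fY : EFin \o (fine \o Y) = Y by apply/funext => w /=; rewrite fineK.
exists (fine \o Y); split.
- apply/mwrtP => //; apply/measurable_EFinP; rewrite fY.
  exact: measurable_int Yint.
- by rewrite fY.
- move=> A GA; rewrite -[RHS]/(nu A) YE//.
  by apply: eq_integral => w _ /=; rewrite fineK.
Qed.

(** On the event of G where the conditional expectation of Y is less than Z, the
hypothesis forces the integral of their difference to be nonpositive, so that
this event is null. *)
Lemma le_cond_exp Z Y : measurable_wrt G Z -> integ P Z -> integ P Y ->
  (forall A, G A -> \int[P]_(w in A) Z w <= \int[P]_(w in A) Y w) ->
  exists2 W, is_cond_exp P G Y W & \forall w \ae P, Z w <= W w.
Proof.
move=> mZ iZ iY le.
have [W [mW iW WE]] := cond_exp_exists iY; exists W => //.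
pose B := [set w | W w < Z w].
have GB : G B.
  rewrite (_ : B = [set w | 0 < Z w - W w]); first by apply: mwrt_gt => //; exact: mwrtB.
  by apply/seteqP; split => w /=; rewrite subr_gt0.
have mB : measurable B := GM GB.
have iD : integ P (fun w => \1_B w * (Z w - W w)) by exact/integ_indic/integB.
have D0 w : 0 <= \1_B w * (Z w - W w).
  rewrite indicE; have [|] := boolP (w \in B); last by rewrite mul0r.
  by rewrite inE mul1r subr_ge0 => /ltW.
have ED : Rintegral P setT (fun w => \1_B w * (Z w - W w)) <= 0.
  rewrite E_indic// RintegralB//; last 2 first.
  - exact: integrableS iZ.
  - exact: integrableS iW.
  rewrite subr_le0; apply: le_trans (le _ GB) _.
  by rewrite /Rintegral WE.
have : \forall w \ae P, setT w -> (EFin \o (fun w => \1_B w * (Z w - W w))) w = cst 0%E w.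
  apply/ae_eq_integral_abs => //; first exact: measurable_int iD.
  apply/eqP; rewrite eq_le integral_ge0 ?andbT//.
  rewrite -lee_fin EFin_Rintegral// in ED.
  apply: le_trans ED; apply: ge0_le_integral => //.
  - by apply: measurableT_comp => //; exact: measurable_int iD.
  - exact: measurable_int iD.
  - by move=> w _ /=; rewrite ger0_norm.
apply: filterS => w /(_ Logic.I) /= [h].
rewrite leNgt; apply/negP => WZ; move: h.
by rewrite indicE mem_set// mul1r => /eqP; rewrite subr_eq0 (gt_eqF WZ).
Qed.

(** After an affine change g takes its values in [0, 1]; it is then within 1/k of
the staircase k^-1 sum_j 1_{g >= j/k}, to which the hypothesis on events
applies. *)
Lemma orthogonal_bounded (D g : Omega -> R) c : integ P D ->
  (forall A, G A -> \int[P]_(w in A) D w = 0) ->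
  measurable_wrt G g -> (forall w, `|g w| <= c) ->
  Rintegral P setT (fun w => g w * D w) = 0.
Proof.
move=> iD D0 mg gc.
have [c0 {}gc] : 0 < `|c| + 1 /\ forall w, `|g w| <= `|c| + 1.
  split=> [|w]; first by rewrite ltr_wpDl.
  by apply: le_trans (gc w) _; rewrite (le_trans (ler_norm c))// lerDl.
move: (`|c| + 1 : R) c0 gc => {}c c0 gc.
(* the affine change to values in [0, 1] *)
pose h w := (g w + c) / (2 * c).
have mh : measurable_wrt G h.
  apply: mwrtM => //; last exact: mwrt_cst.
  by apply: mwrtD => //; exact: mwrt_cst.
have h01 w : 0 <= h w <= 1.
  have := gc w; rewrite ler_norml => /andP[gc1 gc2].
  rewrite /h divr_ge0/= ?ler_pdivrMr; lra.
have mhM : measurable_fun setT h by exact: mwrt_measurable mh.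
have ih : integ P (fun w => h w * D w).
  apply: (@integM_bounded _ _ _ _ _ _ 1) => // w.
  by have /andP[h0 h1] := h01 w; rewrite ger0_norm.
suff h0 : Rintegral P setT (fun w => h w * D w) = 0.
  transitivity (Rintegral P setT (fun w => (2 * c) * (h w * D w) - c * D w)).
    congr (fine _); apply: eq_integral => w _; congr EFin.
    by rewrite /h; field; rewrite gt_eqF.
  rewrite E_B ?E_Z//; try exact: integZ.
  by rewrite h0 (D0 setT (sGT sG)) !mulr0 subrr.
pose hn n w := n.+1%:R^-1 * \sum_(j < n.+1) \1_[set w | j.+1%:R / n.+1%:R <= h w] w : R.
have GA n j : G [set w | j.+1%:R / n.+1%:R <= h w].
  exact: mwrt_ge.
have ihnj n j : integ P (fun w => \1_[set w | j.+1%:R / n.+1%:R <= h w] w * D w).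
  by apply: integ_indic => //; exact/GM/GA.
have hnE n : (fun w => hn n w * D w) = (fun w => n.+1%:R^-1 *
    \sum_(j < n.+1) (\1_[set w | j.+1%:R / n.+1%:R <= h w] w * D w)).
  by apply/funext => w; rewrite /hn -mulrA mulr_suml.
have ihn n : integ P (fun w => hn n w * D w).
  rewrite hnE; apply: integZ; apply: (@integ_sum _ _ _ _ _
    (fun j w => \1_[set w | j.+1%:R / n.+1%:R <= h w] w * D w)) => j _.
  exact: ihnj.
have Ehn n : Rintegral P setT (fun w => hn n w * D w) = 0.
  rewrite hnE E_Z.
    rewrite (@E_sum _ _ _ _ _ (fun j w => \1_[set w | j.+1%:R / n.+1%:R <= h w] w * D w))//.
    by rewrite big1 ?mulr0// => j _; rewrite E_indic ?D0//; exact/GM/GA.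
  apply: (@integ_sum _ _ _ _ _
    (fun j w => \1_[set w | j.+1%:R / n.+1%:R <= h w] w * D w)) => j _.
  exact: ihnj.
have close n w : `|h w - hn n w| <= n.+1%:R^-1.
  have n0 : 0 < n.+1%:R :> R by rewrite ltr0n.
  have -> : hn n w = n.+1%:R^-1 * \sum_(j < n.+1) (j.+1%:R <= n.+1%:R * h w)%R%:R.
    congr (_ * _); apply: eq_bigr => j _; rewrite indicE; congr ((nat_of_bool _)%:R).
    apply/idP/idP; first by rewrite inE/= ler_pdivrMr// mulrC.
    by rewrite inE/= ler_pdivrMr// mulrC.
  have /andP[h0 h1] := h01 w.
  set S := \sum_(_ < _) _.
  have -> : h w - n.+1%:R^-1 * S = n.+1%:R^-1 * (n.+1%:R * h w - S).
    by rewrite mulrBr mulKf// gt_eqF.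
  rewrite normrM gtr0_norm ?invr_gt0// ler_piMr ?invr_ge0 ?ler0n//.
  by apply: staircase; [rewrite mulr_ge0|rewrite ler_piMr].
have bnd n : `|Rintegral P setT (fun w => h w * D w)| <=
    n.+1%:R^-1 * Rintegral P setT (fun w => `|D w|).
  have -> : Rintegral P setT (fun w => h w * D w) =
      Rintegral P setT (fun w => (h w - hn n w) * D w).
    under [RHS]eq_Rintegral do rewrite mulrBl.
    by rewrite E_B// Ehn subr0.
  have iB : integ P (fun w => (h w - hn n w) * D w).
    by under eq_fun do rewrite mulrBl; exact: integB.
  apply: le_trans (E_norm iB) _; rewrite -E_Z; last exact: integ_norm.
  apply: E_le_ae; [exact: integ_norm|exact/integZ/integ_norm|].
  by apply: aeW => w; rewrite normrM ler_wpM2r.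
apply/eqP; rewrite -normr_le0.
apply/ler_addgt0Pl => e e0; rewrite addr0.
set a := Rintegral P setT (fun w => `|D w|) in bnd *.
have a0 : 0 <= a by exact: Rintegral_ge0.
apply: le_trans (bnd (Num.truncn (a / e))) _.
rewrite mulrC ler_pdivrMr ?ltr0n// mulrC -ler_pdivrMr//.
exact/ltW/truncnS_gt.
Qed.

End cond_exp.

(** * Riemann-Stieltjes sums along a cadlag path *)

Section grid.
Context {R : realType}.
Implicit Types (s t r u : R) (m i K : nat).

(** The multiples of 1/(m+1) clamped to [s, t]. Lowering t only clamps them
further (grid_min), so that a path and the stopped path are sampled at
compatible times. *)
Definition grid s t m i : R := Num.min (Num.max (i%:R / m.+1%:R) s) t.

Lemma grid0 s t m : 0 <= s -> s <= t -> grid s t m 0 = s.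
Proof. by move=> s0 st; rewrite /grid mul0r max_r// min_l. Qed.

Lemma grid_end s t m K : s <= t -> t <= K%:R / m.+1%:R -> grid s t m K = t.
Proof. by move=> st tK; rewrite /grid min_r// le_max tK. Qed.

Lemma grid_homo s t m i j : (i <= j)%N -> grid s t m i <= grid s t m j.
Proof.
move=> ij; rewrite /grid le_min ge_min ge_max !le_max ler_pM2r ?invr_gt0//.
by rewrite ler_nat ij lexx !orbT ge_min lexx orbT.
Qed.

Lemma grid_ge s t m i : s <= t -> s <= grid s t m i.
Proof. by move=> st; rewrite /grid le_min le_max lexx orbT. Qed.

Lemma grid_le s t m i : grid s t m i <= t.
Proof. by rewrite /grid ge_min lexx orbT. Qed.

Lemma grid_min s t r m i : r <= t -> Num.min (grid s t m i) r = grid s r m i.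
Proof. by move=> rt; rewrite /grid -minA (min_r rt). Qed.

Lemma grid_mesh s t m i : grid s t m i.+1 <= grid s t m i + m.+1%:R^-1.
Proof.
have m0 : 0 < m.+1%:R^-1 :> R by rewrite invr_gt0.
rewrite /grid -natr1 mulrDl mul1r.
rewrite addr_minl addr_maxl le_min; apply/andP; split.
  rewrite ge_min ge_max !le_max lexx/=.
  by rewrite (_ : s <= s + _) ?orbT// lerDl ltW.
by rewrite ge_min lerDl (ltW m0) orbT.
Qed.

(** The cell of u ends at the first grid point that is not before u; the cells
being disjoint, all the other indicators vanish at u. *)
Lemma grid_cell s t m K u : 0 <= s -> s < u -> u <= t -> t <= K%:R / m.+1%:R ->
  exists2 i, (i < K)%N & [/\ grid s t m i < u, u <= grid s t m i.+1 &
    forall c : nat -> R,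
      \sum_(j < K) c j * \1_`]grid s t m j, grid s t m j.+1] u = c i].
Proof.
move=> s0 su ut tK; have st : s <= t by rewrite (le_trans (ltW su)).
have ex : exists i, u <= grid s t m i by exists K; rewrite grid_end.
case: (ex_minnP ex) => -[|i]; first by rewrite grid0// leNgt su.
move=> ui min_i; have iu : grid s t m i < u.
  by rewrite ltNge; apply/negP => /min_i; rewrite ltnn.
have iK : (i < K)%N by apply: min_i; rewrite grid_end.
exists i => //; split=> // c.
rewrite (bigD1 (Ordinal iK))//= big1 => [|j ji].
  by rewrite addr0 indicE mem_set ?mulr1//= in_itv/= iu ui.
rewrite indicE memNset ?mulr0//= in_itv/=; apply/negP.
move: ji; rewrite -val_eqE/= neq_ltn negb_and -leNgt -ltNge => /orP[ji|ij].
  by rewrite orbC (le_lt_trans _ iu)//; exact: grid_homo.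
by rewrite (le_trans ui)//; exact: grid_homo.
Qed.

End grid.

Lemma cvg_continuous {R : realType} {S : Type} {F : set_system S} {FF : Filter F}
    (h : R -> R) (f : S -> R) l : continuous h ->
  f x @[x --> F] --> l -> h (f x) @[x --> F] --> h l.
Proof. by move=> ch fl; exact: cvg_comp fl (ch l). Qed.

Lemma cvg_left_seq {R : realType} (x : R -> R) (u l : R) (v : nat -> R) :
  x s @[s --> u^'-] --> l -> (forall m, v m < u) ->
  (forall m, u - v m <= m.+1%:R^-1) -> x (v m) @[m --> \oo] --> l.
Proof.
move=> xl vu uv; move/cvg_at_leftP : xl; apply; split=> //.
apply/cvgrPdist_lt => e e0.
have [N _ Ne] := near_infty_natSinv_lt (PosNum e0).
exists N => // m /Ne/=; rewrite ger0_norm ?subr_ge0 ?ltW//.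
exact: le_lt_trans.
Qed.

Lemma cvg_right_seq {R : realType} (x : R -> R) (u : R) (v : nat -> R) :
  x s @[s --> u^'+] --> x u -> (forall m, u <= v m) ->
  (forall m, v m - u <= m.+1%:R^-1) -> x (v m) @[m --> \oo] --> x u.
Proof.
move=> /cvgrPdist_lt xu uv vu; apply/cvgrPdist_lt => e e0.
have [d /= d0 de] := xu _ e0.
have [N _ Ne] := near_infty_natSinv_lt (PosNum d0).
exists N => // m /Ne/= md; have [uvm|vum] := ltP u (v m); last first.
  have -> : v m = u by apply/eqP; rewrite eq_le uv vum.
  by rewrite subrr normr0.
apply: de => //=; rewrite distrC ger0_norm ?subr_ge0//.
exact: le_lt_trans md.
Qed.

Section pathwise.
Context {R : realType}.
Local Notation T := (measurableTypeR R).
Local Notation mu p := (lebesgue_stieltjes_measure p).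
Implicit Types (p q : cumulative R R) (h x c : R -> R) (s t r u : R).

Lemma mu_itvoc p a b : a <= b -> mu p `]a, b]%classic = (p b - p a)%:E.
Proof.
move=> ab; transitivity (wlength p `]a, b]%classic).
  rewrite /lebesgue_stieltjes_measure /measure_extension/=.
  by rewrite measurable_mu_extE//; exact: is_ocitv.
rewrite wlength_itv/=; case: ltP => // ba.
rewrite lee_fin in ba.
by rewrite (_ : b = a) ?subrr//; apply/eqP; rewrite eq_le ab ba.
Qed.

Lemma mu_itvoc_fin p a b : a <= b -> (mu p `]a, b]%classic < +oo)%E.
Proof. by move=> ab; rewrite mu_itvoc// ltry. Qed.

Lemma measurable_oc a b : measurable (`]a, b]%classic : set T).
Proof. exact: measurable_itv. Qed.

(** The step function whose Stieltjes integral is a Riemann sum with left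
endpoints. *)
Definition step_left h x s t K m : T -> R := fun u =>
  \sum_(i < K m) h (x (grid s t m i)) * \1_`]grid s t m i, grid s t m i.+1] u.

Lemma left_lim_cvg x u : cadlag_path x -> 0 < u ->
  x v @[v --> u^'-] --> left_lim x u.
Proof. by move=> [_ cx] u0; rewrite /left_lim u0; exact: cx. Qed.

Section step.
Variables (x h : R -> R) (s t : R) (K : nat -> nat).
Hypotheses (cx : cadlag_path x) (ch : continuous h) (s0 : 0 <= s) (st : s <= t).
Hypothesis tK : forall m, t <= (K m)%:R / m.+1%:R.

Lemma measurable_step_left m : measurable_fun setT (step_left h x s t K m).
Proof.
apply: (@measurable_sum _ T R setT _ _ (fun i : 'I_(K m) => (fun u =>
  h (x (grid s t m i)) * \1_`]grid s t m i, grid s t m i.+1] u) : T -> R)) => i.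
by apply: measurable_funM => //; apply: measurable_indic; exact: measurable_oc.
Qed.

Lemma step_left_cvg u : `]s, t]%classic u ->
  step_left h x s t K m u @[m --> \oo] --> h (left_lim x u).
Proof.
rewrite /= in_itv/= => /andP[su ut].
have /all_sig2[i iK iP] m := cid2 (grid_cell s0 su ut (tK m)).
have -> : (fun m => step_left h x s t K m u) =
    (fun m => h (x (grid s t m (i m)))).
  by apply/funext => m; have [_ _ /(_ (fun i => h (x (grid s t m i))))] := iP m.
apply: (cvg_continuous (h := h)) => //.
apply: cvg_left_seq (left_lim_cvg cx _) _ _; first exact: le_lt_trans su.
  by move=> m; have [] := iP m.
move=> m; have [_ ui _] := iP m; rewrite lerBlDl.
exact: le_trans ui (grid_mesh _ _ _ _).
Qed.

Lemma measurable_left_lim : measurable_fun (`]s, t]%classic : set T)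
  (fun u => h (left_lim x u)).
Proof.
apply: (@measurable_fun_cvg _ T R _ (step_left h x s t K)) => [m|u].
  by apply: measurable_funTS; exact: measurable_step_left.
exact: step_left_cvg.
Qed.

(** When the mesh tends to 0, the left endpoint of the cell of u tends to u from
the left, so that the step functions tend to h (left_lim x u); they are bounded
by c. *)
Lemma riemann_sum_cvg p (c : R) : (forall y, `|h y| <= c) -> (forall y, 0 <= h y) ->
  \sum_(i < K m) h (x (grid s t m i)) * (p (grid s t m i.+1) - p (grid s t m i))
    @[m --> \oo] --> Rintegral (mu p) `]s, t]%classic (fun u => h (left_lim x u)).
Proof.
move=> hc h0.
have mst := measurable_oc s t.
have ic : (mu p).-integrable `]s, t]%classic (EFin \o cst c).
  apply/integrableP; split; first by apply/measurable_EFinP; exact: measurable_cst.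
  rewrite (_ : (fun u => `|(EFin \o cst c) u|%E) = cst `|c|%:E)//.
  by rewrite integral_cst// [X in (_ * X)%E](mu_itvoc p st) -EFinM ltry.
have [|||||ih _ cv] := @dominated_convergence _ T R (mu p) `]s, t]%classic mst
  (fun m => EFin \o step_left h x s t K m)
  (fun u => (h (left_lim x u))%:E) (EFin \o cst c).
- move=> m; apply/measurable_EFinP; apply: measurable_funTS.
  exact: measurable_step_left.
- apply/measurable_EFinP; exact: measurable_left_lim.
- apply: aeW => u ust; apply/fine_cvgP; split; first exact: nearW.
  exact: step_left_cvg.
- exact: ic.
- apply: aeW => u m ust; rewrite lee_fin /step_left.
  have /andP[su ut] : s < u <= t by move: ust; rewrite /= in_itv.
  have [i _ [_ _ /(_ (fun i => h (x (grid s t m i)))) ->]] :=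
    grid_cell s0 su ut (tK m).
  exact: hc.
have fint : (\int[mu p]_(u in `]s, t]) (h (left_lim x u))%:E)%E \is a fin_num.
  exact: integrable_fin_num.
move: cv; rewrite -(fineK fint) => /fine_cvgP[_]; apply: cvg_trans.
apply: near_eq_cvg; apply: nearW => m /=.
rewrite /step_left; under eq_integral do rewrite -sumEFin.
rewrite (@ge0_integral_sum _ T R (mu p) _ mst _ (fun i : 'I_(K m) => (fun u =>
  (h (x (grid s t m i)) * \1_`]grid s t m i, grid s t m i.+1] u)%:E) : T -> \bar R));
  last 2 first.
- move=> i; apply/measurable_EFinP; apply: measurable_funM => //.
- by move=> i u _; rewrite lee_fin mulr_ge0.
have term (i : 'I_(K m)) : (\int[mu p]_(u in `]s, t])
      (h (x (grid s t m i)) * \1_`]grid s t m i, grid s t m i.+1] u)%:E =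
    (h (x (grid s t m i)) * (p (grid s t m i.+1) - p (grid s t m i)))%:E)%E.
  under eq_integral do rewrite EFinM.
  rewrite ge0_integralZl//; last 2 first.
  - apply/measurable_EFinP; exact: (measurable_indic (measurable_oc _ _)).
  - by rewrite lee_fin.
  rewrite (@integral_indic _ T R (mu p) _ mst _ (measurable_oc _ _)).
  rewrite setIidl; last first.
    move=> u; rewrite /= !in_itv/= => /andP[lu uu].
    by rewrite (le_lt_trans _ lu) ?grid_ge// (le_trans uu)// grid_le.
  rewrite EFinM; congr (_ * _)%E.
  by apply: mu_itvoc; exact: grid_homo.
rewrite [in RHS](_ : \sum_(i < K m) _ = fine (\sum_(i < K m) (h (x (grid s t m i)) *
  (p (grid s t m i.+1) - p (grid s t m i)))%:E)); last by rewrite sumEFin.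
by congr fine; apply: eq_bigr => i _; exact: term.
Qed.

End step.

(** By right-continuity x is the limit of its step functions with right
endpoints. *)
Lemma measurable_cadlag x s t : cadlag_path x -> 0 <= s -> s <= t ->
  measurable_fun (`]s, t]%classic : set T) x.
Proof.
move=> cx s0 st.
pose K m := ((Num.truncn t).+1 * m.+1)%N.
have tK m : t <= (K m)%:R / m.+1%:R.
  by rewrite natrM mulfK ?pnatr_eq0//; exact/ltW/truncnS_gt.
apply: (@measurable_fun_cvg _ T R _ (fun m u => \sum_(i < K m)
    x (grid s t m i.+1) * \1_`]grid s t m i, grid s t m i.+1] u)) => [m|u].
  apply: measurable_funTS.
  apply: (@measurable_sum _ T R setT _ _ (fun i : 'I_(K m) => (fun u =>
    x (grid s t m i.+1) * \1_`]grid s t m i, grid s t m i.+1] u) : T -> R)) => i.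
  by apply: measurable_funM => //; apply: measurable_indic; exact: measurable_oc.
rewrite /= in_itv/= => /andP[su ut].
have /all_sig2[i iK iP] m := cid2 (grid_cell s0 su ut (tK m)).
rewrite (_ : (fun m => \sum_(_ < _) _) = fun m => x (grid s t m (i m).+1)).
  apply: cvg_right_seq => [|m|m].
  - by apply: (proj1 cx); rewrite (le_trans s0 (ltW su)).
  - by have [] := iP m.
  - have [iu _ _] := iP m; rewrite lerBlDl (le_trans (grid_mesh _ _ _ _))//.
    by rewrite lerD2r ltW.
by apply/funext => m; have [_ _ /(_ (fun i => x (grid s t m i.+1)))] := iP m.
Qed.

(** The intervals ]a, b] generate the Borel sets; clamping their endpoints to
[0, t] writes the trace of ]a, b] on N as a difference of traces of intervals
]0, r], which the hypothesis compares. *)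
Lemma mu_eq_on p q (N : set T) t : 0 <= t ->
  measurable (`]0, t]%classic `&` N) ->
  (forall r, 0 <= r -> r <= t -> Rintegral (mu p) `]0, r] \1_N =
                                Rintegral (mu q) `]0, r] \1_N) ->
  forall B : set T, measurable B -> B `<=` `]0, t]%classic `&` N ->
  mu p B = mu q B.
Proof.
move=> t0; set N' := _ `&` N => mN' h B mB BN.
have e f r : 0 <= r -> r <= t ->
    mu f (N' `&` `]0, r]%classic) = (Rintegral (mu f) `]0, r] \1_N)%:E.
  move=> r0 rt; have mr := measurable_oc 0 r.
  have -> : Rintegral (mu f) `]0, r] \1_N = Rintegral (mu f) `]0, r] \1_N'.
    congr (fine _); apply: eq_integral => u; rewrite inE/= in_itv/= => /andP[u0 ur].
    rewrite !indicE; congr ((nat_of_bool _)%:R%:E); apply/idP/idP; rewrite !inE.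
      by split=> //=; rewrite in_itv/= u0 (le_trans ur).
    by case.
  rewrite /Rintegral (@integral_indic _ T R (mu f) _ mr _ mN') fineK//.
  rewrite ge0_fin_numE ?measure_ge0//.
  apply: (@le_lt_trans _ _ (mu f `]0, r]%classic)); last by rewrite mu_itvoc ?ltry.
  by apply: le_measure; rewrite ?inE//; exact: measurableI.
have e2 r : 0 <= r -> r <= t ->
    mu p (N' `&` `]0, r]%classic) = mu q (N' `&` `]0, r]%classic).
  by move=> r0 rt; rewrite !e// h.
rewrite -(setIidl BN) -/N'.
have setE a b : `]a, b]%classic `&` N' =
    (N' `&` `]0, Num.min (Num.max b 0) t]%classic) `\`
    (N' `&` `]0, Num.min (Num.max a 0) t]%classic).
  apply/seteqP; split=> u /=; rewrite !in_itv/= /N' /= !in_itv/=.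
    move=> [/andP[au ub] [/andP[u0 ut] Nu]]; split.
      by split=> //; rewrite u0 ?ut// ?le_min ?le_max ub ut.
    by move=> [_ /andP[_]]; rewrite le_min le_max => /andP[/orP[]]; lra.
  move=> [[[/andP[u0 ut] Nu] /andP[_ ub]] un]; split; last by rewrite u0.
  have [ua|au] := leP u a.
    by exfalso; apply: un; split=> //; rewrite u0 ?ut// ?le_min ?le_max ua ut.
  by move: ub; rewrite le_min le_max => /andP[/orP[]]; lra.
have mN'r r : measurable (N' `&` `]0, r]%classic : set T).
  by apply: measurableI => //; exact: measurable_oc.
have clamp a : 0 <= Num.min (Num.max a 0) t /\ Num.min (Num.max a 0) t <= t.
  by rewrite le_min le_max lexx orbT t0 ge_min lexx orbT.
have fin_mu (f : cumulative R R) (r : R) :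
    (mu f (N' `&` `]0%R, r]%classic) < +oo)%E.
  apply: (@le_lt_trans _ _ (mu f `]0, Num.max r 0]%classic)); last first.
    by rewrite mu_itvoc ?ltry// le_max lexx orbT.
  apply: le_measure; rewrite ?inE//.
  move=> u []; rewrite /= !in_itv/= => _ /andP[-> ur].
  by rewrite le_max ur.
apply: (@measure_unique _ R T R.-ocitv.-measurable
  (fun k => `]- k%:R, k%:R]%classic)
  (erefl _) (@ocitvI R) (fun k => is_ocitv _ _) _
  (mrestr (mu p) mN') (mrestr (mu q) mN') _ _ _ mB).
- apply/seteqP; split=> // u _; exists (Num.truncn `|u|).+1 => //=.
  have := truncnS_gt `|u|; rewrite ltr_norml in_itv/= => /andP[-> /ltW].
  by [].
- move=> _ [[a b] _ <-] /=.
  have mE f : mrestr (mu f) mN' `]a, b]%classic =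
    mu f ((N' `&` `]0%R, Num.min (Num.max b 0) t]%classic) `\`
          (N' `&` `]0%R, Num.min (Num.max a 0) t]%classic)) by rewrite -setE.
  rewrite !mE.
  have [a0 at'] := clamp a; have [b0 bt] := clamp b.
  have mD f := @measureD _ T R (mu f) _ _ (mN'r (Num.min (Num.max b 0) t))
    (mN'r (Num.min (Num.max a 0) t)) (fin_mu f _).
  rewrite [LHS]mD [RHS]mD; congr (_ - _)%E; first exact: e2.
  rewrite setIACA setIid.
  set m1 := Num.min (Num.max b 0) t; set m2 := Num.min (Num.max a 0) t.
  have -> : `]0%R, m1]%classic `&` `]0%R, m2]%classic = `]0%R, Num.min m1 m2]%classic.
    apply/seteqP; split=> u /=; rewrite !in_itv/= [u <= Num.min m1 m2]le_min.
      by move=> [/andP[-> ->] /andP[_ ->]].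
    by move=> /and3P[-> -> ->].
  apply: e2; first by rewrite le_min b0 a0.
  by rewrite ge_min bt.
- move=> k; pose I : set T := `]- k%:R, k%:R]%classic.
  suff : (mu p (I `&` N') < +oo)%E by [].
  apply: le_lt_trans (fin_mu p t); apply: le_measure; rewrite ?inE//=.
    by apply: measurableI => //; exact: measurable_oc.
  by move=> u [_ N'u]; split=> //; case: N'u.
Qed.

Lemma mu_set1_cvg p u (v : nat -> R) : (forall m, v m < u) ->
  {homo v : m n / (m <= n)%N >-> m <= n} ->
  v m @[m --> \oo] --> u ->
  p u - p (v m) @[m --> \oo] --> fine (mu p [set u]) /\
  mu p [set u] \is a fin_num.
Proof.
move=> vu vnd vcv.
have capE : \bigcap_m `]v m, u]%classic = [set u].
  apply/seteqP; split=> [w /= h|w /= ->]; last first.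
    by move=> m _ /=; rewrite in_itv/= vu lexx.
  apply/eqP; rewrite eq_le.
  have := h 0 Logic.I; rewrite /= in_itv/= => /andP[_ ->]/=.
  apply: (cvg_le_cst vcv) => m.
  by have := h m Logic.I; rewrite /= in_itv/= => /andP[/ltW].
have fin1 : mu p [set u] \is a fin_num.
  rewrite ge0_fin_numE ?measure_ge0//.
  apply: (@le_lt_trans _ _ (mu p `]v 0%N, u]%classic)); last first.
    by rewrite mu_itvoc ?ltry// ltW.
  apply: le_measure; rewrite ?inE.
  - exact: measurable_set1.
  - exact: measurable_oc.
  - by move=> w ->; rewrite /= in_itv/= vu lexx.
split=> //.
have : (mu p \o (fun m => `]v m, u]%classic)) m @[m --> \oo] -->
    mu p (\bigcap_m `]v m, u]%classic).
  apply: nonincreasing_cvg_mu.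
  - exact: mu_itvoc_fin (ltW (vu 0%N)).
  - by move=> m; exact: measurable_oc.
  - by rewrite capE; exact: measurable_set1.
  - move=> m n mn; apply/subsetPset => w; rewrite /= !in_itv/= => /andP[vw ->].
    by rewrite (le_lt_trans (vnd _ _ mn)).
rewrite capE -(fineK fin1) => /fine_cvgP[_]; apply: cvg_trans.
apply: near_eq_cvg; apply: nearW => m /=.
by rewrite [X in fine X](mu_itvoc p (ltW (vu m))).
Qed.

(** An atom is the limit of the increments over ]v, u] as v increases to u. *)
Lemma mu_set1_jump c p q u : cadlag_path c -> 0 < u ->
  (forall v, 0 <= v -> c v = p v - q v) ->
  [/\ mu p [set u] \is a fin_num, mu q [set u] \is a fin_num &
      fine (mu p [set u]) - fine (mu q [set u]) = jump c u].
Proof.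
move=> cc u0 cE.
pose v (m : nat) := u - u / m.+2%:R.
have vu m : v m < u by rewrite /v ltrBlDr ltrDl divr_gt0.
have v0 m : 0 <= v m.
  by rewrite subr_ge0 ler_pdivrMr// ler_peMr ?ler1n// ltW.
have vnd : {homo v : m n / (m <= n)%N >-> m <= n}.
  move=> m n mn; rewrite lerB// ler_pM2l// lef_pV2 ?posrE// ler_nat.
  by rewrite !ltnS.
have vcv : v m @[m --> \oo] --> u.
  rewrite -[X in _ --> X]subr0; apply: cvgB; first exact: cvg_cst.
  rewrite -(mulr0 u); apply: cvgMr.
  apply/cvgrPdist_lt => e e0; have [N _ Ne] := near_infty_natSinv_lt (PosNum e0).
  exists N => // m /Ne /=; rewrite sub0r normrN gtr0_norm ?invr_gt0//.
  by apply: le_lt_trans; rewrite lef_pV2 ?posrE// ler_nat.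
have [pcv pfin] := mu_set1_cvg p vu vnd vcv.
have [qcv qfin] := mu_set1_cvg q vu vnd vcv.
split=> //.
have c1 : c u - c (v m) @[m --> \oo] --> jump c u.
  apply: cvgB; first exact: cvg_cst.
  have /cvg_at_leftP := left_lim_cvg cc u0; apply; split=> //.
have c2 : c u - c (v m) @[m --> \oo] -->
    fine (mu p [set u]) - fine (mu q [set u]).
  rewrite (_ : (fun m => c u - c (v m)) =
    (fun m => (p u - p (v m)) - (q u - q (v m)))); first exact: cvgB.
  by apply/funext => m; rewrite !cE ?(ltW u0)//; ring.
exact: (cvg_unique (@norm_hausdorff _ _) c2 c1).
Qed.

(** Over a countable set the integral is the sum over the atoms. *)
Lemma countable_integral_le p q (D : set T) (f : T -> R) :
  countable D -> measurable_fun D f -> (forall u, 0 <= f u) ->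
  (forall u, D u -> f u != 0 -> (mu q [set u] <= mu p [set u])%E) ->
  (\int[mu q]_(u in D) (f u)%:E <= \int[mu p]_(u in D) (f u)%:E)%E.
Proof.
move=> /countable_injP[k kinj] mf f0 qp.
pose F n := D `&` [set u | k u = n].
have FE n : F n = set0 \/ exists2 u, D u & F n = [set u].
  have [->|/set0P[u [Du ku]]] := eqVneq (F n) set0; [by left|right].
  exists u => //; apply/seteqP; split=> [w [Dw kw]|w ->]; last by split.
  by apply: kinj; rewrite ?inE// ku.
have mF n : measurable (F n).
  have [->|[u _ ->]] := FE n; first exact: measurable0.
  exact: measurable_set1.
have DF : D = \bigcup_n F n.
  by apply/seteqP; split=> [u Du|u [n _ []]//]; exists (k u).
have tF : trivIset setT F.
  apply/trivIsetP => i j _ _ ij; apply/seteqP; split=> // u [[_ ui] [_ uj]].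
  by move: ij; rewrite -ui -uj eqxx.
have mfE : measurable_fun (\bigcup_n F n) (EFin \o f).
  by rewrite -DF; exact/measurable_EFinP.
have sumE m : (\int[mu m]_(u in D) (f u)%:E =
    \sum_(0 <= n <oo) \int[mu m]_(u in F n) (f u)%:E)%E.
  rewrite [X in integral _ X _]DF (@ge0_integral_bigcup _ T R _ _ (EFin \o f))//.
  by move=> u _; rewrite lee_fin.
rewrite !sumE; apply: lee_nneseries => [n _ _|n _].
  by apply: integral_ge0 => u _; rewrite lee_fin.
have [->|[u Du ->]] := FE n; first by rewrite !integral_set0.
have int1 m : (\int[mu m]_(w in [set u]) (f w)%:E = (f u)%:E * mu m [set u])%E.
  rewrite -(@integral_cst _ T R (mu m) _ (measurable_set1 u)).
  by apply: eq_integral => w; rewrite inE => ->.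
rewrite !int1; have [->|fu0] := eqVneq (f u) 0; first by rewrite !mul0e.
by apply: lee_wpmul2l; [rewrite lee_fin|exact: qp].
Qed.

(** As left_lim x u is nonzero, x does not vanish on [q, u[ for some rational q:
thus u is the first zero of x after q, and q determines u. *)
Lemma countable_jump_to0 x : cadlag_path x ->
  countable [set u | [/\ 0 < u, x u = 0 & left_lim x u != 0]].
Proof.
move=> cx; set D := [set u | _].
have exq u : D u -> exists q : rat, ratr q < u /\ forall v, ratr q <= v -> v < u -> x v != 0.
  move=> [u0 _ lu].
  have /cvgrPdist_lt/(_ `|left_lim x u|) := left_lim_cvg cx u0.
  rewrite normr_gt0 => /(_ lu)[d /= d0 dP].
  have udu : u - d < u by rewrite ltrBlDr ltrDl.
  have [q] := rat_in_itvoo udu; rewrite in_itv/= => /andP[uq qu].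
  exists q; split=> // v qv vu; apply/eqP => xv0.
  suff : `|left_lim x u - x v| < `|left_lim x u| by rewrite xv0 subr0 ltxx.
  by apply: dP => //=; rewrite ger0_norm ?subr_ge0 ?(ltW vu)//; lra.
have /choice[q qP] u : exists q : rat, D u ->
    ratr q < u /\ forall v, ratr q <= v -> v < u -> x v != 0.
  by have [/exq[q]|nDu] := pselect (D u); [exists q|exists 0].
apply/countable_injP; exists (pickle \o q) => u u'; rewrite !inE => Du Du'.
move=> /(pcan_inj pickleK) qq'.
have [qu qx] := qP _ Du; have [qu' qx'] := qP _ Du'.
have [uu'|u'u|//] := ltgtP u u'.
  have := qx' u; rewrite -qq' (ltW qu) => /(_ isT uu').
  by case: Du => _ ->; rewrite eqxx.
have := qx u'; rewrite qq' (ltW qu') => /(_ isT u'u).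
by case: Du' => _ ->; rewrite eqxx.
Qed.

Lemma measurable_comp_left_lim x h s t : cadlag_path x -> continuous h ->
  0 <= s -> s <= t ->
  measurable_fun (`]s, t]%classic : set T) (fun u => h (left_lim x u)).
Proof.
move=> cx ch s0 st.
apply: (@measurable_left_lim x h s t (fun m => ((Num.truncn t).+1 * m.+1)%N)) => // m.
by rewrite natrM mulfK ?pnatr_eq0//; exact/ltW/truncnS_gt.
Qed.

Section comparison.
Variables (x h : R -> R) (s t c : R) (p q : cumulative R R).
Hypotheses (cx : cadlag_path x) (ch : continuous h) (h00 : h 0 = 0).
Hypotheses (hc : forall y, `|h y| <= c) (h0 : forall y, 0 <= h y).
Hypotheses (s0 : 0 <= s) (st : s <= t).

Let f : T -> R := fun u => h (left_lim x u).

Let mf : measurable_fun (`]s, t]%classic : set T) f.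
Proof. exact: measurable_comp_left_lim. Qed.

Let f0 u : 0 <= f u. Proof. exact: h0. Qed.

Let int_fin m : (\int[mu m]_(u in `]s, t]) (f u)%:E)%E \is a fin_num.
Proof.
rewrite ge0_fin_numE; last by apply: integral_ge0 => u _; rewrite lee_fin.
apply: (@le_lt_trans _ _ (\int[mu m]_(u in `]s, t]) (cst c%:E) u)%E).
  apply: ge0_le_integral => //=.
  - by move=> u _; rewrite lee_fin.
  - exact/measurable_EFinP.
  - by move=> u _; rewrite lee_fin (le_trans (ler_norm _))//; exact: hc.
rewrite integral_cst; last exact: measurable_oc.
by rewrite [X in (_ * X)%E](mu_itvoc m st) -EFinM ltry.
Qed.

Let sub0 (N : set T) : `]s, t]%classic `&` N `<=` `]0, t]%classic `&` N.
Proof.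
move=> u []; rewrite /= !in_itv/= => /andP[su ->] Nu; split=> //.
by rewrite (le_lt_trans s0 su).
Qed.

(** The integrand vanishes where left_lim x does, and the two measures agree on
the complement of this set by mu_eq_on. *)
Lemma Rintegral_left_lim_eq :
  (forall r, 0 <= r ->
    Rintegral (mu p) `]0, r] \1_[set u | left_lim x u != 0] =
    Rintegral (mu q) `]0, r] \1_[set u | left_lim x u != 0]) ->
  Rintegral (mu p) `]s, t] f = Rintegral (mu q) `]s, t] f.
Proof.
move=> e; set N := [set u | _] in e.
have t0 : 0 <= t := le_trans s0 st.
have mN : measurable (`]0, t]%classic `&` N : set T).
  have NE : N = left_lim x @^-1` (~` [set 0]) by apply/seteqP; split=> u /eqP.
  rewrite NE; apply: (@measurable_comp_left_lim x idfun) => //.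
    by move=> y; exact: cvg_id.
  by apply: measurableC; exact: measurable_set1.
congr fine.
have NE m : (\int[mu m]_(u in `]s, t]) (f u)%:E =
    \int[mu m]_(u in `]s, t] `&` N) (f u)%:E)%E.
  rewrite integral_mkcondr; apply: eq_integral => u _; rewrite patchE.
  case: ifPn => //; rewrite notin_setE /f /N /= => /negP; rewrite negbK => /eqP ->.
  by rewrite h00.
rewrite !NE; apply: eq_measure_integral => B mB BE.
apply: (mu_eq_on t0 mN _ mB).
  by move=> r r0 _; exact: e.
by move=> u /BE/sub0.
Qed.

(** Where the integrand is nonzero, either x is nonzero, and there the two measures
agree, or x jumps to 0, which happens at countably many times: there the atoms
decide. *)
Lemma Rintegral_left_lim_le :
  (forall r, 0 <= r -> Rintegral (mu p) `]0, r] \1_[set u | x u != 0] =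
                       Rintegral (mu q) `]0, r] \1_[set u | x u != 0]) ->
  (forall u, 0 < u -> f u != 0 -> (mu q [set u] <= mu p [set u])%E) ->
  Rintegral (mu q) `]s, t] f <= Rintegral (mu p) `]s, t] f.
Proof.
move=> e j; set N := [set u | _] in e.
have t0 : 0 <= t := le_trans s0 st.
have mN : measurable (`]0, t]%classic `&` N : set T).
  have NE : N = x @^-1` (~` [set 0]) by apply/seteqP; split=> u /eqP.
  rewrite NE; apply: measurable_cadlag => //.
  by apply: measurableC; exact: measurable_set1.
pose D : set T := [set u | [/\ 0 < u, x u = 0 & left_lim x u != 0]].
have cD : countable D := countable_jump_to0 cx.
have cD' : countable (`]s, t]%classic `&` D).
  by apply: sub_countable cD; exact: subset_card_le.
have mD' : measurable (`]s, t]%classic `&` D : set T).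
  by apply: countable_measurable cD' => u; exact: measurable_set1.
have mN' : measurable (`]s, t]%classic `&` N : set T).
  rewrite (_ : _ `&` _ = `]s, t]%classic `&` (`]0, t]%classic `&` N)).
    by apply: measurableI => //; exact: measurable_oc.
  by apply/seteqP; split=> [u Nu|u [su [_ Nu]]]//; split; [case: Nu|exact: sub0].
have dis : [disjoint `]s, t]%classic `&` N & `]s, t]%classic `&` D].
  apply/disj_setPS => u [[_ Nu] [_ [_ xu _]]].
  by move: Nu; rewrite /N/= xu eqxx.
have split_int m : (\int[mu m]_(u in `]s, t]) (f u)%:E =
    \int[mu m]_(u in `]s, t] `&` N) (f u)%:E +
    \int[mu m]_(u in `]s, t] `&` D) (f u)%:E)%E.
  rewrite -ge0_integral_setU//; last 2 first.
  - apply/measurable_EFinP; rewrite -setIUr.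
    apply: measurable_funS mf; first exact: measurable_oc.
    exact: subIsetl.
  - by move=> u _; rewrite lee_fin.
  rewrite -setIUr integral_mkcondr; apply: eq_integral => u.
  rewrite inE/= in_itv/= => /andP[su _]; rewrite patchE.
  case: ifPn => //; rewrite notin_setE /= => nu.
  suff -> : f u = 0 by [].
  rewrite /f; have [->//|lu] := eqVneq (left_lim x u) 0.
  exfalso; apply: nu; have [xu|xu] := eqVneq (x u) 0; last by left.
  by right; split=> //; exact: le_lt_trans su.
apply: fine_le; [exact: int_fin|exact: int_fin|rewrite !split_int].
apply: leeD.
  rewrite le_eqVlt; apply/orP; left; apply/eqP.
  apply: eq_measure_integral => B mB BE; apply/esym.
  apply: (mu_eq_on t0 mN _ mB).
    by move=> r r0 _; exact: e.
  by move=> u /BE/sub0.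
apply: countable_integral_le => //.
- apply: measurable_funS mf; first exact: measurable_oc.
  exact: subIsetl.
- by move=> u [_ [u0 _ _]] fu; exact: j.
Qed.

End comparison.

End pathwise.

(** * The sign of the limiting drift *)

Section riemann_liminf.
Context {R : realType}.
Local Notation T := (measurableTypeR R).
Local Notation mu p := (lebesgue_stieltjes_measure p).
Implicit Types (h : R -> R) (r u : R).
Variables (x c v : R -> R) (s t b : R) (K : nat -> nat).
Hypotheses (cx : cadlag_path x) (fc : fv_path c) (fv : fv_path v).
Hypotheses (s0 : 0 <= s) (st : s <= t).
Hypothesis tK : forall m, t <= (K m)%:R / m.+1%:R.
Hypothesis c0 : forall r, 0 <= r -> stieltjes_int (\1_[set u | x u != 0]) c r = 0.
Hypothesis v0 : forall r, 0 <= r ->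
  stieltjes_int (\1_[set u | left_lim x u != 0]) v r = 0.

Let gsum (a h : R -> R) m := \sum_(i < K m) h (x (grid s t m i)) *
  (a (grid s t m i.+1) - a (grid s t m i)).

Let lim_sum (h f : R -> R) :=
  Rintegral (mu (pos_var f)) `]s, t]%classic (fun u => h (left_lim x u)) -
  Rintegral (mu (neg_var f)) `]s, t]%classic (fun u => h (left_lim x u)).

Let gsum_cvg h f : fv_path f -> continuous h -> (forall y, `|h y| <= b) ->
  (forall y, 0 <= h y) -> gsum f h m @[m --> \oo] --> lim_sum h f.
Proof.
move=> ff ch hb h0; rewrite (_ : gsum f h = fun m =>
    \sum_(i < K m) h (x (grid s t m i)) *
      (pos_var f (grid s t m i.+1) - pos_var f (grid s t m i)) -
    \sum_(i < K m) h (x (grid s t m i)) *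
      (neg_var f (grid s t m i.+1) - neg_var f (grid s t m i))).
  apply: cvgB.
    exact: (@riemann_sum_cvg _ x h s t K cx ch s0 st tK (pos_var f) b hb h0).
  exact: (@riemann_sum_cvg _ x h s t K cx ch s0 st tK (neg_var f) b hb h0).
apply/funext => m; rewrite /gsum -sumrB; apply: eq_bigr => i _.
have g0 j : 0 <= grid s t m j by rewrite (le_trans s0)// grid_ge.
by rewrite !(jordan_decomposition ff (g0 _)); ring.
Qed.

(** The sum tends to the integral of g (left_lim x) against d(c + v) over
]s, t]. The measure dv does not charge the set where left_lim x is nonzero, and
dc acts only through its atoms at the times where x jumps to 0, with the sign
of g (left_lim x) * jump c. The minimum with 0 keeps the one-sided information
in a form to which dominated convergence applies. *)
Lemma riemann_liminf_ge0 (g : R -> R) : continuous g -> g 0 = 0 ->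
  (forall y, `|g y| <= b) -> (forall y, 0 <= g y) \/ (forall y, g y <= 0) ->
  (forall u, 0 < u -> 0 <= g (left_lim x u) * jump c u) ->
  Num.min (\sum_(i < K m) g (x (grid s t m i)) *
    ((c (grid s t m i.+1) + v (grid s t m i.+1)) -
     (c (grid s t m i) + v (grid s t m i)))) 0 @[m --> \oo] --> (0 : R).
Proof.
move=> cg g00 gb gsgn gj.
(* e is the sign of g, so that h = e * g is nonnegative. *)
pose e : R := if `[< forall y, 0 <= g y >] then 1 else -1.
have ee : e * e = 1.
  by rewrite /e; case: asboolP => _; rewrite ?mulr1// mulrNN mulr1.
pose h y := e * g y.
have h0 y : 0 <= h y.
  rewrite /h /e; case: asboolP => [gpos|gneg]; first by rewrite mul1r.
  by case: gsgn => // gsgn; rewrite mulN1r oppr_ge0.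
have hb y : `|h y| <= b.
  rewrite /h normrM (_ : `|e| = 1) ?mul1r//.
  by rewrite /e; case: asboolP => _; rewrite ?normrN normr1.
have ch : continuous h by move=> y; apply: cvgMr; exact: cg.
have h00 : h 0 = 0 by rewrite /h g00 mulr0.
have gE y : g y = e * h y by rewrite /h mulrA ee mul1r.
(* dv does not charge the set where g (left_lim x) lives *)
have Lv : lim_sum h v = 0.
  have hyp r : 0 <= r ->
      Rintegral (mu (pos_var v)) `]0, r] \1_[set u | left_lim x u != 0] =
      Rintegral (mu (neg_var v)) `]0, r] \1_[set u | left_lim x u != 0].
    by move=> r0; apply/eqP; rewrite -subr_eq0; apply/eqP; exact: v0.
  have e1 := @Rintegral_left_lim_eq _ x h s t (pos_var v) (neg_var v) cx h00 s0 st hyp.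
  by apply/eqP; rewrite /lim_sum subr_eq0; apply/eqP; exact: e1.
(* only the atoms of dc at jumps of x to 0 count *)
have Lc : 0 <= e * lim_sum h c.
  have hyp r : 0 <= r ->
      Rintegral (mu (pos_var c)) `]0, r] \1_[set u | x u != 0] =
      Rintegral (mu (neg_var c)) `]0, r] \1_[set u | x u != 0].
    by move=> r0; apply/eqP; rewrite -subr_eq0; apply/eqP; exact: c0.
  have atoms u : 0 < u -> h (left_lim x u) != 0 ->
      [/\ mu (pos_var c) [set u] \is a fin_num, mu (neg_var c) [set u] \is a fin_num
      & 0 <= e * (fine (mu (pos_var c) [set u]) - fine (mu (neg_var c) [set u]))].
    move=> u0 hu.
    have [? ? ->] := mu_set1_jump (proj1 fc) u0 (fun w w0 => jordan_decomposition fc w0).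
    split=> //; have := gj u u0; rewrite gE mulrAC pmulr_lge0//.
    by rewrite lt_neqAle eq_sym hu h0.
  have hyp' r (r0 : 0 <= r) := esym (hyp r r0).
  have lepos := @Rintegral_left_lim_le _ x h s t b (pos_var c) (neg_var c)
    cx ch h00 hb h0 s0 st hyp.
  have leneg := @Rintegral_left_lim_le _ x h s t b (neg_var c) (pos_var c)
    cx ch h00 hb h0 s0 st hyp'.
  rewrite /lim_sum; move: atoms; rewrite /e; case: asboolP => _ atoms.
    rewrite mul1r subr_ge0; apply: lepos => u u0 hu.
    have [pf qf] := atoms u u0 hu.
    by rewrite mul1r subr_ge0 => pq; rewrite -(fineK pf) -(fineK qf) lee_fin.
  rewrite mulN1r opprB subr_ge0; apply: leneg => u u0 hu.
  have [pf qf] := atoms u u0 hu.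
  by rewrite mulN1r opprB subr_ge0 => pq; rewrite -(fineK pf) -(fineK qf) lee_fin.
have cv : e * gsum c h m + e * gsum v h m @[m --> \oo] --> e * lim_sum h c + e * lim_sum h v.
  by apply: cvgD; apply: cvgMr; exact: gsum_cvg.
rewrite Lv mulr0 addr0 in cv.
rewrite (_ : (fun m => Num.min _ _) =
    (fun m => Num.min (e * gsum c h m + e * gsum v h m) 0)); last first.
  apply/funext => m; congr Num.min.
  rewrite /gsum !mulr_sumr -big_split/=; apply: eq_bigr => i _.
  by rewrite gE; ring.
rewrite -[X in _ --> X](min_r Lc).
exact: (@cvg_lipschitz1 _ _ _ _ (Num.min^~ 0) _ _ (min_lipschitz1 0) cv).
Qed.

End riemann_liminf.

(** * Stopping along grids and stopped martingales *)

Section discrete_stopping.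
Context {R : realType}.
Implicit Types (x a : R -> R) (tau : R).

(** The increments that start before tau telescope up to the first u J that is not
before tau. *)
Lemma telescope_before (u : nat -> R) tau K x :
  {homo u : i j / (i <= j)%N >-> i <= j} -> tau <= u K ->
  exists J, [/\ (J <= K)%N, tau <= u J,
    forall i, (i < J)%N -> u i < tau &
    forall y : R -> R, \sum_(i < K) (u i < tau)%R%:R * (y (u i.+1) - y (u i)) =
           y (u J) - y (u 0)].
Proof.
move=> hu tK.
have ex : exists i, tau <= u i by exists K.
case: (ex_minnP ex) => J tJ Jmin; exists J; split=> //.
- exact: Jmin.
- by move=> i iJ; rewrite ltNge; apply/negP => /Jmin; rewrite leqNgt iJ.
move=> y.
have lem k : \sum_(i < k) (u i < tau)%R%:R * (y (u i.+1) - y (u i)) =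
    y (u (minn k J)) - y (u 0).
  elim: k => [|k IH]; first by rewrite big_ord0 min0n subrr.
  rewrite big_ord_recr/= IH; have [kJ|Jk] := ltnP k J.
    have -> : u k < tau.
      by rewrite ltNge; apply/negP => /Jmin; rewrite leqNgt kJ.
    rewrite (minn_idPl kJ) mul1r; ring.
  have -> : (u k < tau) = false.
    by apply/negbTE; rewrite -leNgt (le_trans tJ)// hu.
  by rewrite mul0r addr0 (minn_idPr (leqW Jk)).
by rewrite lem (minn_idPr _)// Jmin.
Qed.

Lemma grid_stop s t tau m K : 0 <= s -> s <= tau -> tau <= t ->
  t <= K%:R / m.+1%:R ->
  exists2 rho, [/\ tau <= rho, rho <= t & rho - tau <= m.+1%:R^-1] &
    forall x, x s + \sum_(i < K) (grid s t m i < tau)%R%:R *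
      (x (grid s t m i.+1) - x (grid s t m i)) = x rho.
Proof.
move=> s0 st tt tK.
have st' : s <= t := le_trans st tt.
have tuK : tau <= grid s t m K by rewrite grid_end.
have [J [JK tJ Jlt sumE]] := telescope_before idfun (fun i j => @grid_homo _ s t m i j) tuK.
exists (grid s t m J).
  split=> //; first exact: grid_le.
  case: J JK tJ Jlt sumE => [|J] JK tJ Jlt sumE.
    by rewrite grid0// (le_trans _ (_ : 0 <= _))// subr_le0.
  rewrite lerBlDl (le_trans (grid_mesh _ _ _ _))// lerD2r.
  exact/ltW/Jlt.
by move=> x; rewrite sumE grid0// subrKC.
Qed.

Lemma subgradient_lipschitz (f g : R -> R) y z :
  (forall y z, g y * (z - y) <= f z - f y) -> (forall y, `|g y| <= 1) ->
  `|f y - f z| <= `|y - z|.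
Proof.
move=> fg g1.
have le v w : f v - f w <= `|v - w|.
  rewrite -opprB lerNl; apply: le_trans (fg v w).
  rewrite lerNl; apply: le_trans (ler_norm _) _.
  by rewrite normrN normrM distrC ler_piMl.
by rewrite ler_norml le andbT lerNl opprB [`|_ - _|]distrC le.
Qed.

(** At each step this is the subgradient inequality at x (u i). The path n is
stopped late, at the first u i that is not before tau, so that whole increments
of n appear; the path a is stopped at tau itself. *)
Lemma tanaka_discrete (f g n a x : R -> R) (u : nat -> R) tau k :
  (forall y z, g y * (z - y) <= f z - f y) ->
  {homo u : i j / (i <= j)%N >-> i <= j} -> u 0 <= tau ->
  (forall v, u 0 <= v -> v <= tau -> x v = n v + a v) ->
  \sum_(i < k) (u i < tau)%R%:R * (g (x (u i)) * (n (u i.+1) - n (u i))) +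
  \sum_(i < k) (u i < tau)%R%:R *
    (g (x (u i)) * (a (Num.min (u i.+1) tau) - a (u i))) <=
  f (n (u 0) + \sum_(i < k) (u i < tau)%R%:R * (n (u i.+1) - n (u i)) +
     a (Num.min (u k) tau)) - f (x (u 0)).
Proof.
move=> fg hu u0 xE; elim: k => [|k IH].
  by rewrite !big_ord0 !addr0 min_l// xE// subrr.
rewrite !big_ord_recr/=; have [ut|tu] := ltP (u k) tau; last first.
  rewrite !mul0r !addr0; apply: le_trans IH _.
  by rewrite !min_r// (le_trans tu)// hu.
have telk : \sum_(i < k) (u i < tau)%R%:R * (n (u i.+1) - n (u i)) = n (u k) - n (u 0).
  have : forall j, (j <= k)%N ->
      \sum_(i < j) (u i < tau)%R%:R * (n (u i.+1) - n (u i)) = n (u j) - n (u 0).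
    elim=> [|j IHj] jk; first by rewrite big_ord0 subrr.
    rewrite big_ord_recr/= IHj ?(ltnW jk)//.
    have -> : u j < tau by apply: le_lt_trans ut; apply: hu; exact: ltnW.
    by rewrite mul1r; ring.
  exact.
rewrite telk in IH *; rewrite (min_l (ltW ut)) in IH.
have xk : x (u k) = n (u k) + a (u k) by rewrite xE ?(ltW ut)//; exact: hu.
rewrite !mul1r.
set n0 := n (u 0); set nk := n (u k); set nk1 := n (u k.+1).
set ak := a (u k); set ak1 := a (Num.min _ _).
have := fg (x (u k)) (n0 + (nk - n0 + (nk1 - nk)) + ak1).
have e1 : n0 + (nk - n0) + ak = x (u k) by rewrite xk -/nk -/ak; ring.
have e2 : n0 + (nk - n0 + (nk1 - nk)) + ak1 - x (u k) = (nk1 - nk) + (ak1 - ak).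
  by rewrite xk -/nk -/ak; ring.
rewrite e1 in IH; rewrite e2 mulrDr; lra.
Qed.

End discrete_stopping.

Section truncation.
Context {R : realType}.
Implicit Types K x y : R.

(** A convex function that measures how far x is outside [-K, K]: convexity makes
its expectation increase along a martingale, and it tends to 0 as K tends to
infinity. It serves to prove uniform integrability. *)
Definition excess K x : R := Num.max (`|x| - K) 0.

Definition excess_slope K x : R :=
  if K < x then 1 else if x < - K then -1 else 0.

Lemma excess_convex K x y : 0 <= K ->
  excess_slope K x * (y - x) <= excess K y - excess K x.
Proof.
move=> K0; rewrite /excess_slope /excess.
have ey1 : y - K <= Num.max (`|y| - K) 0.
  by rewrite le_max lerD2r ler_norm.
have ey2 : - y - K <= Num.max (`|y| - K) 0.
  by rewrite le_max lerD2r -normrN ler_norm.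
have ey3 : 0 <= Num.max (`|y| - K) 0 by rewrite le_max lexx orbT.
case: ltP => [Kx|xK].
  have -> : `|x| = x by rewrite ger0_norm; lra.
  by rewrite (@max_l _ _ (x - K)); lra.
case: ltP => [xK'|xK'].
  have -> : `|x| = - x by rewrite ler0_norm; lra.
  by rewrite (@max_l _ _ (- x - K)); lra.
rewrite (@max_r _ _ (`|x| - K)) ?mul0r ?subr0//.
by rewrite subr_le0 ler_norml xK' xK.
Qed.

Lemma excess_slope_bounded K x : `|excess_slope K x| <= 1.
Proof.
by rewrite /excess_slope; case: ifP => _; [|case: ifP => _];
  rewrite ?normr1 ?normrN ?normr1 ?normr0 ?ler01.
Qed.

Lemma measurable_excess_slope K : measurable_fun setT (excess_slope K).
Proof.
apply: measurable_fun_ifT => //; first exact: measurable_fun_ltr.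
by apply: measurable_fun_ifT => //; exact: measurable_fun_ltr.
Qed.

Lemma excess_ge0 K x : 0 <= excess K x.
Proof. by rewrite /excess le_max lexx orbT. Qed.

Lemma excess_le K x : 0 <= K -> `|excess K x| <= `|x|.
Proof.
move=> K0; rewrite ger0_norm ?excess_ge0// /excess ge_max normr_ge0 andbT.
by rewrite gerBl.
Qed.

Lemma excess_lipschitz K x y : 0 <= K -> `|excess K x - excess K y| <= `|x - y|.
Proof.
move=> K0; apply: (@subgradient_lipschitz _ _ (excess_slope K)).
  by move=> *; exact: excess_convex.
exact: excess_slope_bounded.
Qed.

Lemma measurable_excess K : measurable_fun setT (excess K).
Proof. by apply: measurable_maxr => //; apply: measurable_funB. Qed.

Definition clip K x : R := - Num.min (- Num.min x K) K.

Lemma clip_lipschitz K x y : `|clip K x - clip K y| <= `|x - y|.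
Proof.
rewrite /clip -opprD normrN.
apply: le_trans (min_lipschitz1 _ _ _) _.
by rewrite -opprD normrN; exact: min_lipschitz1.
Qed.

Lemma clip_bounded K x : 0 <= K -> `|clip K x| <= K.
Proof.
move=> K0; rewrite /clip /Num.min ler_norml.
have [xK|Kx] := ltP x K; [have [?|?] := ltP (- x) K|have [?|?] := ltP (- K) K];
  lra.
Qed.

Lemma clip_excess K x : 0 <= K -> `|x - clip K x| <= excess K x.
Proof.
move=> K0; rewrite /excess le_max /clip /Num.min.
have [xK|Kx] := ltP x K; [have [?|?] := ltP (- x) K|have [?|?] := ltP (- K) K].
- by rewrite opprK subrr normr0 lexx orbT.
- by rewrite opprK -normrN (ler0_norm (_ : x <= 0)) ?ger0_norm; lra.
- by rewrite opprK (@ger0_norm _ x) ?ger0_norm; lra.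
- by rewrite opprK (@ger0_norm _ x) ?ger0_norm; lra.
Qed.

Lemma measurable_clip K : measurable_fun setT (clip K).
Proof.
apply: measurable_funN; apply: measurable_minr => //.
by apply: measurable_funN; exact: measurable_minr.
Qed.

End truncation.

Section filtered.
Context {R : realType} {d : measure_display} {Omega : measurableType d}.
Variable P : probability Omega R.
Variable F : R -> set (set Omega).
Hypothesis hF : usual_conditions P F.
Implicit Types (X A N : R -> Omega -> R) (T : Omega -> \bar R) (s t u : R).

Lemma F_sigma t : 0 <= t -> sigma_algebra setT (F t).
Proof. by case: hF => -[h _ _] _ _; exact: h. Qed.

Lemma F_meas t : 0 <= t -> F t `<=` measurable.
Proof. by case: hF => -[_ h _] _ _; exact: h. Qed.

Lemma F_mono s t : 0 <= s -> s <= t -> F s `<=` F t.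
Proof. by case: hF => -[_ _ h] _ _; exact: h. Qed.

Lemma F_null t B : 0 <= t -> P.-negligible B -> F t B.
Proof. by move=> t0 /(let: And3 _ _ h := hF in h _); exact: F_mono. Qed.

Lemma mwrt_mono s t (Y : Omega -> R) : 0 <= s -> s <= t ->
  measurable_wrt (F s) Y -> measurable_wrt (F t) Y.
Proof. by move=> s0 st mY B mB; apply: (F_mono s0 st); exact: mY. Qed.

(** The real number min(t, T): the minimum with t is finite, and fine only
changes its type. *)
Definition tmin t T w : R := fine (Order.min t%:E (T w)).

Lemma tmin_le t T w : (0 <= T w)%E -> tmin t T w <= t.
Proof.
rewrite /tmin; case: (T w) => [r| |]//= r0.
  by rewrite -EFin_min/= ge_min lexx.
by rewrite min_l ?leey.
Qed.

Lemma tmin_ge0 t T w : 0 <= t -> (0 <= T w)%E -> 0 <= tmin t T w.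
Proof.
rewrite /tmin => t0 T0; apply: fine_ge0.
by rewrite le_min T0 lee_fin t0.
Qed.

Lemma le_tmin s t T w : (0 <= T w)%E ->
  (s <= tmin t T w) = (s <= t) && (s%:E <= T w)%E.
Proof.
rewrite /tmin; case: (T w) => [r| |]//= r0.
  by rewrite -EFin_min/= le_min lee_fin.
by rewrite min_l ?leey//= ?leey ?andbT.
Qed.

Lemma lt_tmin s t T w : (0 <= T w)%E ->
  (s < tmin t T w) = (s < t) && (s%:E < T w)%E.
Proof.
rewrite /tmin; case: (T w) => [r| |]//= r0.
  by rewrite -EFin_min/= lt_min lte_fin.
by rewrite min_l ?leey//= ltry andbT.
Qed.

Lemma tmin_leT t T w : (0 <= T w)%E -> ((tmin t T w)%:E <= T w)%E.
Proof.
by move=> T0; have := lexx (tmin t T w); rewrite {1}le_tmin// => /andP[].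
Qed.

Lemma tmin_min u t T w : u <= t -> (0 <= T w)%E ->
  Num.min u (tmin t T w) = tmin u T w.
Proof.
rewrite /tmin => ut; case: (T w) => [r| |]//= r0.
  by rewrite -!EFin_min/= minA (min_l ut).
by rewrite !min_l ?leey.
Qed.

Lemma stopping_lt t T : stopping_time F T -> 0 <= t -> F t [set w | (t%:E < T w)%E].
Proof.
move=> [_ sT] t0; rewrite (_ : [set _ | _] = ~` [set w | (T w <= t%:E)%E]).
  by apply: sGC; [exact: F_sigma|exact: sT].
by apply/seteqP; split=> w /=; rewrite ltNge => /negP.
Qed.

(** Enough cells of length 1/(m+1) to reach t. *)
Definition gsize t m : nat := ((Num.truncn t).+1 * m.+1)%N.

Lemma gsize_end t m : t <= (gsize t m)%:R / m.+1%:R.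
Proof. by rewrite natrM mulfK ?pnatr_eq0//; exact/ltW/truncnS_gt. Qed.

Definition before T s t m i : Omega -> R := \1_[set w | ((grid s t m i)%:E < T w)%E].

(** An increment of the clamped grid that starts at t vanishes; otherwise its left
end is before T if and only if it is before min(t, T). *)
Lemma before_incr T s t m i w (y : R -> R) : (0 <= T w)%E ->
  before T s t m i w * (y (grid s t m i.+1) - y (grid s t m i)) =
  (grid s t m i < tmin t T w)%R%:R * (y (grid s t m i.+1) - y (grid s t m i)).
Proof.
move=> T0; rewrite lt_tmin// /before indicE.
have [ut|] := ltP (grid s t m i) t; last first.
  move=> tu; have ue : grid s t m i = t by apply/eqP; rewrite eq_le tu grid_le.
  have -> : grid s t m i.+1 = t.
    by apply/eqP; rewrite eq_le grid_le -{1}ue grid_homo.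
  by rewrite ue subrr !mulr0.
by congr (_ * _); congr ((nat_of_bool _)%:R); rewrite mem_setE.
Qed.

(** Stopped at the first grid time that is not before min(t, T), the process is a
finite sum of variables known at time t; right-continuity gives the limit as
the mesh tends to 0. *)
Lemma adapted_stopped X T t : adapted F X -> stopping_time F T -> 0 <= t ->
  (\forall w \ae P, forall u, 0 <= u -> X v w @[v --> u^'+] --> X u w) ->
  measurable_wrt (F t) (fun w => X (tmin t T w) w).
Proof.
move=> aX sT t0 rc; have sF := F_sigma t0.
apply: (@mwrt_cvg_ae _ _ _ P (F t) sF _ (fun m w => X 0 w + \sum_(i < gsize t m)
  before T 0 t m i w * (X (grid 0 t m i.+1) w - X (grid 0 t m i) w))).
- by move=> B; exact: F_null.
- move=> m; have g0 i : 0 <= grid 0 t m i by exact: grid_ge.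
  have Xg i : measurable_wrt (F t) (X (grid 0 t m i)).
    by apply: (mwrt_mono (g0 i) (grid_le _ _ _ _)); exact: aX.
  apply: mwrtD => //; first by apply: (mwrt_mono (lexx 0) t0); exact: aX.
  apply: (@mwrt_sum _ _ _ _ sF _ (fun i w => before T 0 t m i w *
    (X (grid 0 t m i.+1) w - X (grid 0 t m i) w))) => i _.
  apply: mwrtM => //; last exact: mwrtB.
  apply: mwrt_indic => //.
  by apply: (F_mono (g0 i) (grid_le _ _ _ _)); exact: stopping_lt.
- apply: filterS rc => w rc.
  have T0 : (0 <= T w)%E by case: sT.
  have tt := tmin_le t T0.
  have tau0 : 0 <= tmin t T w by exact: tmin_ge0.
  have /all_sig2[rho rhoP rhoE] m := cid2 (grid_stop (lexx 0) tau0 tt (gsize_end t m)).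
  rewrite (_ : (fun m => _) = fun m => X (rho m) w); last first.
    apply/funext => m; rewrite -(rhoE m (X ^~ w)); congr (_ + _).
    by apply: eq_bigr => i _; exact: (@before_incr T 0 t m i w (X ^~ w) T0).
  apply: (@cvg_right_seq _ (X ^~ w) (tmin t T w) rho) => [|m|m].
  - exact: rc.
  - by case: (rhoP m).
  - by case: (rhoP m).
Qed.

Section martingale_stopping.
Variables (N : R -> Omega -> R) (T : Omega -> \bar R).
Hypothesis mN : martingale P F N.
Hypothesis rcN : \forall w \ae P, forall u, 0 <= u -> N v w @[v --> u^'+] --> N u w.
Hypothesis sT : stopping_time F T.

Let T0 w : (0 <= T w)%E. Proof. by case: sT. Qed.

Lemma martingale_integ t : 0 <= t -> integ P (N t).
Proof. by case: mN => _ h _; exact: h. Qed.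

Lemma martingale_incr s t B : 0 <= s -> s <= t -> F s B ->
  \int[P]_(w in B) (N t w - N s w) = 0.
Proof.
move=> s0 st FB; have t0 := le_trans s0 st.
have mB := F_meas s0 FB.
rewrite RintegralB//; try exact: integrableS (martingale_integ _).
case: mN => _ _ /(_ s t s0 st)[_ _ /(_ B FB) e].
by rewrite /Rintegral e subrr.
Qed.

Lemma martingale_transform s t (g : Omega -> R) c : 0 <= s -> s <= t ->
  measurable_wrt (F s) g -> (forall w, `|g w| <= c) ->
  Rintegral P setT (fun w => g w * (N t w - N s w)) = 0.
Proof.
move=> s0 st mg gc; have t0 := le_trans s0 st.
apply: (orthogonal_bounded (F_sigma s0) (F_meas s0) _ _ mg gc).
  by apply: integB; exact: martingale_integ.
by move=> A FA; exact: martingale_incr.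
Qed.

Variables (s t : R).
Hypotheses (s0 : 0 <= s) (st : s <= t).
Let t0 : 0 <= t := le_trans s0 st.
Let G := [set w | (s%:E < T w)%E].
Let FG : F s G. Proof. exact: stopping_lt. Qed.
Let mG : measurable G := F_meas s0 FG.

Let u m i := grid s t m i.
Let u0 m i : 0 <= u m i. Proof. by rewrite (le_trans s0)// grid_ge. Qed.
Let ut m i : u m i <= t. Proof. exact: grid_le. Qed.
Let us m i : s <= u m i. Proof. exact: grid_ge. Qed.
Let uS m i : u m i <= u m i.+1. Proof. exact: grid_homo. Qed.

(** The value of N at the first grid time of [s, t] that is not before min(t, T). *)
Definition stop_late m w : R :=
  N s w + \sum_(i < gsize t m) before T s t m i w * (N (u m i.+1) w - N (u m i) w).

Let tau w := tmin t T w.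

(** The last equation describes the path of N after the grid time rho: only the
increments that start after T remain. *)
Lemma stop_lateE w : G w -> exists2 rho : nat -> R,
  forall m, [/\ tau w <= rho m, rho m <= t & rho m - tau w <= m.+1%:R^-1] &
  forall m, stop_late m w = N (rho m) w /\ forall h : R -> R,
    h (N t w) - h (N (rho m) w) = \sum_(i < gsize t m)
      (1 - before T s t m i w) * (h (N (u m i.+1) w) - h (N (u m i) w)).
Proof.
move=> Gw; have st' : s <= tau w by rewrite le_tmin// st ltW.
have tt : tau w <= t by exact: tmin_le.
have /all_sig2[rho rhoP rhoE] m := cid2 (grid_stop s0 st' tt (gsize_end t m)).
exists rho => // m; split.
  rewrite -(rhoE m (N ^~ w)) /stop_late; congr (_ + _).
  by apply: eq_bigr => i _; exact: (@before_incr T s t m i w (N ^~ w) (T0 w)).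
move=> h; rewrite -(rhoE m (fun v => h (N v w))).
rewrite [RHS](eq_bigr (fun i : 'I__ => (h (N (u m i.+1) w) - h (N (u m i) w)) -
  (u m i < tau w)%R%:R * (h (N (u m i.+1) w) - h (N (u m i) w)))); last first.
  move=> i _; rewrite mulrBl mul1r; congr (_ - _).
  exact: (@before_incr T s t m i w (fun v => h (N v w)) (T0 w)).
rewrite sumrB opprD addrA; congr (_ - _).
rewrite -(big_mkord xpredT (fun i => h (N (u m i.+1) w) - h (N (u m i) w))).
by rewrite telescope_sumr// /u grid0// grid_end//; exact: gsize_end.
Qed.

Lemma stop_late_integ m : integ P (stop_late m).
Proof.
apply: integD; first exact: martingale_integ.
apply: (@integ_sum _ _ _ _ _ (fun i w => before T s t m i w *
  (N (u m i.+1) w - N (u m i) w))) => i _.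
apply: integ_indic; last by apply: integB; exact: martingale_integ.
by apply: (F_meas (u0 m i)); exact: stopping_lt.
Qed.

Lemma stop_late_cvg : \forall w \ae P, G w -> stop_late m w @[m --> \oo] --> N (tau w) w.
Proof.
apply: filterS rcN => w rc Gw.
have [rho rhoP rhoE] := stop_lateE Gw.
rewrite (_ : (fun m => _) = fun m => N (rho m) w); last first.
  by apply/funext => m; case: (rhoE m).
have tau0 : 0 <= tau w by exact: tmin_ge0.
apply: (@cvg_right_seq _ (N ^~ w) (tau w) rho) => [|m|m].
- exact: rc.
- by case: (rhoP m).
- by case: (rhoP m).
Qed.

Let integ_excess K (Y : Omega -> R) : 0 <= K -> integ P Y ->
  integ P (fun w => excess K (Y w)).
Proof.
move=> K0 iY; apply: (integ_le_ae _ (integ_norm iY)).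
  exact: (measurableT_comp (measurable_excess K) (integ_measurable iY)).
by apply: aeW => w; exact: excess_le.
Qed.

(** From the grid time where N is stopped up to t, the convex function of the
martingale increases in expectation. The right-hand side does not involve m:
this is the uniform integrability behind stop_late_L1. *)
Let stop_late_excess K m : 0 <= K ->
  Rintegral P setT (fun w => \1_G w * excess K (stop_late m w)) <=
  Rintegral P setT (fun w => excess K (N t w)).
Proof.
move=> K0.
(* the slope of the excess on the cells after T: a bounded variable known at
   the left end of the cell *)
pose g i w := \1_G w * (1 - before T s t m i w) * excess_slope K (N (u m i) w).
have mg i : measurable_wrt (F (u m i)) (g i).
  have sF := F_sigma (u0 m i).
  apply: mwrtM => //; first apply: mwrtM => //.
  - by apply: mwrt_indic => //; exact: (F_mono s0 (us m i)).
  - apply: mwrtB => //; first exact: mwrt_cst.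
    by apply: mwrt_indic => //; exact: stopping_lt.
  - apply: mwrt_comp; first exact: measurable_excess_slope.
    by case: mN => aN _ _; exact: aN.
have gb i w : `|g i w| <= 1.
  rewrite /g !normrM; apply: mulr_ile1; rewrite ?mulr_ge0 ?excess_slope_bounded//.
  apply: mulr_ile1 => //; first by rewrite indicE; case: (w \in G); rewrite ?normr1 ?normr0.
  rewrite /before indicE; case: (w \in _); first by rewrite subrr normr0.
  by rewrite subr0 normr1.
pose S w := \sum_(i < gsize t m) g i w * (N (u m i.+1) w - N (u m i) w).
have ig i : integ P (fun w => g i w * (N (u m i.+1) w - N (u m i) w)).
  apply: (integM_bounded (c := 1)) => //.
    exact: (mwrt_measurable (F_meas (u0 m i)) (mg i)).
  by apply: integB; exact: martingale_integ.
have iS : integ P S by apply: (@integ_sum _ _ _ _ _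
  (fun i w => g i w * (N (u m i.+1) w - N (u m i) w))) => i _; exact: ig.
have ES : Rintegral P setT S = 0.
  rewrite (@E_sum _ _ _ _ _ (fun i w => g i w * (N (u m i.+1) w - N (u m i) w)))//.
  by rewrite big1// => i _; exact: martingale_transform (gb i).
have ie : integ P (fun w => \1_G w * excess K (stop_late m w)).
  by apply: integ_indic => //; apply: integ_excess => //; exact: stop_late_integ.
rewrite -[leLHS]addr0 -ES -E_D//; apply: E_le_ae; first exact: integD.
  by apply: integ_excess => //; exact: martingale_integ.
apply: aeW => w; rewrite /S /g indicE.
have [|_] := boolP (w \in G); last first.
  rewrite mul0r add0r big1 ?le_max ?lexx ?orbT// => i _.
  by rewrite !mul0r.
rewrite inE => Gw; rewrite mul1r; have [rho _ rhoE] := stop_lateE Gw.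
have [-> /(_ (excess K)) e] := rhoE m.
rewrite -lerBrDl e; apply: ler_sum => i _; rewrite mul1r -mulrA.
apply: ler_wpM2l; last exact: excess_convex.
by rewrite subr_ge0 /before indicE; case: (w \in _).
Qed.

Let excess_cvg0 : Rintegral P setT (fun w => excess K%:R (N t w)) @[K --> \oo] --> (0 : R).
Proof.
have iN := martingale_integ t0.
have [|||||_ cv] := @E_dominated _ _ _ P (fun K w => excess K%:R (N t w))
    (fun=> 0) (fun w => `|N t w|).
- by move=> K; exact: integ_measurable (integ_excess _ iN).
- exact: measurable_cst.
- exact: integ_norm.
- by apply: aeW => w K; exact: excess_le.
- apply: aeW => w; apply: cvg_near_cst.
  exists (Num.truncn `|N t w|).+1 => // K /= NK; rewrite /excess max_r// subr_le0.
  by apply: le_trans (ltW (truncnS_gt _)) _; rewrite ler_nat.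
by rewrite E_cst in cv.
Qed.

(** The variables clipped to [-K, K] converge in L^1 by dominated convergence. What
exceeds K has an expectation that is at most that of the excess of N t, for the
approximations as well as for the limit, and the latter tends to 0 as K tends
to infinity. *)
Lemma stop_late_L1 : integ P (fun w => \1_G w * N (tau w) w) /\
  Rintegral P setT (fun w => \1_G w * `|stop_late m w - N (tau w) w|)
    @[m --> \oo] --> (0 : R).
Proof.
have mNt : measurable_fun setT (fun w => N (tau w) w).
  apply: (mwrt_measurable (F_meas t0)); apply: adapted_stopped => //.
  by case: mN.
have fatouK K : 0 <= K -> integ P (fun w => \1_G w * excess K (N (tau w) w)) /\
    Rintegral P setT (fun w => \1_G w * excess K (N (tau w) w)) <=
    Rintegral P setT (fun w => excess K (N t w)).
  move=> K0; apply: (E_fatou (f_ := fun m w => \1_G w * excess K (stop_late m w))).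
  - move=> m; apply: integ_indic => //; apply: integ_excess => //.
    exact: stop_late_integ.
  - by move=> m w; rewrite mulr_ge0// /excess le_max lexx orbT.
  - by move=> m; exact: stop_late_excess.
  - apply: measurable_funM; first exact: measurable_indic.
    exact: measurableT_comp (measurable_excess K) mNt.
  - apply: filterS stop_late_cvg => w h.
    rewrite indicE; have [|_] := boolP (w \in G); last first.
      by under eq_fun do rewrite mul0r; rewrite mul0r; exact: cvg_cst.
    rewrite inE => /h h'; rewrite mul1r; under eq_fun do rewrite mul1r.
    exact: (@cvg_lipschitz1 _ _ _ _ (excess K) _ _ (fun x y => excess_lipschitz x y K0) h').
have iGY m : integ P (fun w => \1_G w * stop_late m w).
  by apply: integ_indic => //; exact: stop_late_integ.
have iGN : integ P (fun w => \1_G w * N (tau w) w).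
  (* the excess over the level 0 is the absolute value *)
  have [i0 _] := fatouK 0 (lexx 0); apply: (integ_le_ae _ i0).
    by apply: measurable_funM => //; exact: measurable_indic.
  apply: aeW => w; rewrite normrM indicE /excess subr0 max_l//.
  by case: (w \in G); rewrite ?normr1 ?normr0.
split=> //.
have iD m : integ P (fun w => \1_G w * `|stop_late m w - N (tau w) w|).
  have := integ_norm (integB (iGY m) iGN).
  rewrite (_ : (fun w => `|_ - _|) = (fun w => \1_G w * `|stop_late m w - N (tau w) w|))//.
  apply/funext => w; rewrite -mulrBr normrM indicE.
  by case: (w \in G); rewrite ?normr1 ?normr0.
have clip_cvg (K : nat) : Rintegral P setT (fun w =>
    \1_G w * `|clip K%:R (stop_late m w) - clip K%:R (N (tau w) w)|) @[m --> \oo] --> (0 : R).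
  have K0 : 0 <= K%:R :> R by exact: ler0n.
  have mclip (Y : Omega -> R) : measurable_fun setT Y ->
      measurable_fun setT (fun w => clip K%:R (Y w)).
    by move=> mY; exact: (measurableT_comp (measurable_clip _) mY).
  have [|||||_ cv] := @E_dominated _ _ _ P (fun m w =>
      \1_G w * `|clip K%:R (stop_late m w) - clip K%:R (N (tau w) w)|)
      (fun=> 0) (fun=> K%:R + K%:R).
  - move=> m; apply: measurable_funM; first exact: measurable_indic.
    apply: measurableT_comp => //; apply: measurable_funB; apply: mclip => //.
    exact: integ_measurable (stop_late_integ m).
  - exact: measurable_cst.
  - exact: integ_cst.
  - apply: aeW => w m; rewrite normrM normr_id indicE.
    apply: (@le_trans _ _ `|clip K%:R (stop_late m w) - clip K%:R (N (tau w) w)|).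
      by case: (w \in G); rewrite ?normr1 ?normr0 ?mul1r ?mul0r.
    by apply: le_trans (ler_normB _ _) _; rewrite lerD// clip_bounded.
  - apply: filterS stop_late_cvg => w h; rewrite indicE.
    have [|_] := boolP (w \in G); last first.
      by under eq_fun do rewrite mul0r; exact: cvg_cst.
    rewrite inE => /h h'; under eq_fun do rewrite mul1r.
    have /cvgrPdist_lt hc : clip K%:R (stop_late m w) @[m --> \oo] -->
        clip K%:R (N (tau w) w).
      exact: (@cvg_lipschitz1 _ _ _ _ (clip K%:R) _ _ (clip_lipschitz K%:R) h').
    apply/cvgr0Pnorm_lt => e e0.
    by apply: filterS (hc e e0) => m; rewrite normr_id distrC.
  by rewrite E_cst in cv.
apply/cvgr0Pnorm_lt => e e0.
have e3 : 0 < e / 3%:R by rewrite divr_gt0.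
have /cvgr0Pnorm_lt/(_ _ e3)[K _ /(_ K (leqnn K))/=] := excess_cvg0.
rewrite ger0_norm; last by apply: Rintegral_ge0 => w _; exact: excess_ge0.
move=> hK; have /cvgr0Pnorm_lt/(_ _ e3) := clip_cvg K; apply: filterS => m hm.
have K0 : 0 <= K%:R :> R by exact: ler0n.
have iC : integ P (fun w => \1_G w *
    `|clip K%:R (stop_late m w) - clip K%:R (N (tau w) w)|).
  apply: (integ_le_ae _ (iD m)).
    apply: measurable_funM; first exact: measurable_indic.
    apply: measurableT_comp => //; apply: measurable_funB.
      exact: (measurableT_comp (measurable_clip _) (integ_measurable (stop_late_integ m))).
    exact: (measurableT_comp (measurable_clip _) mNt).
  apply: aeW => w; rewrite normrM normr_id ger0_norm ?ler_wpM2l//.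
  exact: clip_lipschitz.
have [iE EE] := fatouK K%:R K0.
have iEY : integ P (fun w => \1_G w * excess K%:R (stop_late m w)).
  by apply: integ_indic => //; apply: integ_excess => //; exact: stop_late_integ.
rewrite ger0_norm; last by apply: Rintegral_ge0 => w _; rewrite mulr_ge0.
apply: (@le_lt_trans _ _ (Rintegral P setT (fun w =>
    \1_G w * excess K%:R (stop_late m w) + \1_G w * excess K%:R (N (tau w) w) +
    \1_G w * `|clip K%:R (stop_late m w) - clip K%:R (N (tau w) w)|))).
  apply: E_le_ae => //; first by apply: integD => //; exact: integD.
  apply: aeW => w; rewrite -!mulrDr ler_wpM2l//.
  have := clip_excess (stop_late m w) K0; have := clip_excess (N (tau w) w) K0.
  set a := stop_late m w; set b := N _ _; set a' := clip _ a; set b' := clip _ b.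
  move=> h1 h2.
  have -> : a - b = (a - a') - (b - b') + (a' - b') by ring.
  apply: le_trans (ler_normD _ _) _; rewrite lerD2r.
  by apply: le_trans (ler_normB _ _) _; rewrite lerD.
rewrite !E_D//; last exact: integD.
have := stop_late_excess m K0.
move: hm; rewrite ger0_norm; last by apply: Rintegral_ge0 => w _; rewrite mulr_ge0.
lra.
Qed.

End martingale_stopping.

End filtered.

(** * The Tanaka inequality in expectation *)

Section tanaka_expectation.
Context {R : realType} {d : measure_display} {Omega : measurableType d}.
Variable P : probability Omega R.
Variable F : R -> set (set Omega).
Hypothesis hF : usual_conditions P F.
Variables (N A X : R -> Omega -> R) (T : Omega -> \bar R).
Hypothesis mN : martingale P F N.
Hypothesis rcN : \forall w \ae P, forall u, 0 <= u -> N v w @[v --> u^'+] --> N u w.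
Hypothesis aA : adapted F A.
Hypothesis rcA : \forall w \ae P, forall u, 0 <= u -> A v w @[v --> u^'+] --> A u w.
Hypothesis aX : adapted F X.
Hypothesis sT : stopping_time F T.
Hypothesis XE : \forall w \ae P,
  forall u, 0 <= u -> (u%:E <= T w)%E -> X u w = N u w + A u w.
Variables (f g : R -> R).
Hypothesis fg : forall y z, g y * (z - y) <= f z - f y.
Hypothesis g1 : forall y, `|g y| <= 1.
Hypothesis mg : measurable_fun setT g.
Variables (s t c : R).
Hypotheses (s0 : 0 <= s) (st : s <= t).
Let t0 : 0 <= t := le_trans s0 st.
Let tau w := tmin t T w.

Definition drift_sum m w : R := \sum_(i < gsize t m)
  g (X (grid s (tmin t T w) m i) w) *
  (A (grid s (tmin t T w) m i.+1) w - A (grid s (tmin t T w) m i) w).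

Hypothesis A_bounded : \forall w \ae P,
  forall u, 0 <= u -> (u%:E <= T w)%E -> `|A u w| <= c.
Hypothesis drift_bounded : \forall w \ae P, (s%:E < T w)%E ->
  forall m, `|drift_sum m w| <= c.
Hypothesis drift_liminf : \forall w \ae P, (s%:E < T w)%E ->
  Num.min (drift_sum m w) 0 @[m --> \oo] --> (0 : R).

Let G := [set w | (s%:E < T w)%E].
Let T0 w : (0 <= T w)%E. Proof. by case: sT. Qed.
Let FG : F s G. Proof. exact: (stopping_lt hF). Qed.
Let u m i := grid s t m i.
Let u0 m i : 0 <= u m i. Proof. by rewrite (le_trans s0)// grid_ge. Qed.
Let us m i : s <= u m i. Proof. exact: grid_ge. Qed.
Let ut m i : u m i <= t. Proof. exact: grid_le. Qed.

(** The drift sum written with the event that the left end of the cell is before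
T, which is known at the left end. *)
Let drift m w : R := \sum_(i < gsize t m) before T s t m i w *
  (g (X (u m i) w) * (A (tmin (u m i.+1) T w) w - A (u m i) w)).

Let drift_sum_tau m w : G w -> \sum_(i < gsize t m) (u m i < tau w)%R%:R *
  (g (X (u m i) w) * (A (Num.min (u m i.+1) (tau w)) w - A (u m i) w)) =
  drift_sum m w.
Proof.
move=> Gw; apply: eq_bigr => i _.
have tt : tau w <= t by exact: tmin_le.
rewrite -!(grid_min s m _ tt) -/(u m i) -/(u m i.+1).
have [ui|iu] := ltP (u m i) (tau w); first by rewrite mul1r.
by rewrite mul0r (min_r (le_trans iu (grid_homo _ _ _ (leqnSn i)))) subrr mulr0.
Qed.

Let driftE m w : G w -> drift m w = drift_sum m w.
Proof.
move=> Gw; rewrite -drift_sum_tau//; apply: eq_bigr => i _.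
rewrite (tmin_min (ut m i.+1) (T0 w)) /tau lt_tmin// /before indicE.
have [uit|] := ltP (u m i) t.
  by congr (_ * _); congr ((nat_of_bool _)%:R); rewrite mem_setE.
move=> tu; have ue : u m i = t by apply/eqP; rewrite eq_le tu ut.
have ue1 : u m i.+1 = t.
  by apply/eqP; rewrite eq_le ut -{1}ue; exact: grid_homo.
rewrite mul0r; case: (boolP (_ \in _)); last by rewrite mul0r.
rewrite inE/= -/(u m i) ue ue1 mul1r => tT.
have -> : tmin t T w = t.
  by apply/eqP; rewrite eq_le tmin_le// le_tmin// lexx ltW.
by rewrite subrr mulr0.
Qed.

Let mstop (Z : R -> Omega -> R) r : adapted F Z ->
  (\forall w \ae P, forall u, 0 <= u -> Z v w @[v --> u^'+] --> Z u w) -> 0 <= r ->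
  measurable_fun setT (fun w => Z (tmin r T w) w).
Proof.
move=> aZ rcZ r0; apply: (mwrt_measurable (F_meas hF r0)).
exact: (adapted_stopped hF).
Qed.

Let mZ (Z : R -> Omega -> R) r : adapted F Z -> 0 <= r -> measurable_fun setT (Z r).
Proof. by move=> aZ r0; apply: (mwrt_measurable (F_meas hF r0)); exact: aZ. Qed.

Let measurable_drift m : measurable_fun setT (drift m).
Proof.
apply: (@measurable_sum _ Omega R setT _ _ (fun i : 'I_(gsize t m) => fun w =>
  before T s t m i w *
  (g (X (u m i) w) * (A (tmin (u m i.+1) T w) w - A (u m i) w)))) => i.
apply: measurable_funM.
  by apply: measurable_indic; apply: (F_meas hF (u0 m i)); exact: (stopping_lt hF).
apply: measurable_funM; first exact: (measurableT_comp mg (mZ aX (u0 m i))).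
by apply: measurable_funB; [exact: mstop|exact: mZ].
Qed.

Let f_lip y z : `|f y - f z| <= `|y - z|.
Proof. exact: (subgradient_lipschitz y z fg g1). Qed.

Let mf : measurable_fun setT f.
Proof.
apply: continuous_measurable_fun => y.
exact: (@cvg_lipschitz1 R R (nbhs y) _ f id y f_lip cvg_id).
Qed.

Let integ_f (B : set Omega) (Z : Omega -> R) : measurable B ->
  measurable_fun setT Z -> integ P (fun w => \1_B w * Z w) ->
  integ P (fun w => \1_B w * f (Z w)).
Proof.
move=> mB mZ' iZ; apply: (integ_le_ae _ (integD (integ_cst P `|f 0|) (integ_norm iZ))).
  by apply: measurable_funM; [exact: measurable_indic|exact: (measurableT_comp mf)].
apply: aeW => w; rewrite indicE; case: (w \in B); last first.
  by rewrite !mul0r normr0 addr0.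
rewrite !mul1r; have := f_lip (Z w) 0; rewrite subr0 => h.
by rewrite -[f (Z w)](subrK (f 0)) addrC (le_trans (ler_normD _ _))// lerD.
Qed.

Variable B : set Omega.
Hypotheses (FB : F s B) (BG : B `<=` G).
Let mB : measurable B := F_meas hF s0 FB.

Let integ_restr (Z : Omega -> R) : integ P (fun w => \1_G w * Z w) ->
  integ P (fun w => \1_B w * Z w).
Proof.
move=> iZ; rewrite (_ : (fun w => _) = fun w => \1_B w * (\1_G w * Z w)).
  exact: integ_indic.
apply/funext => w; rewrite !indicE; have [|] := boolP (w \in B); last by rewrite !mul0r.
by rewrite inE => /BG Gw; rewrite mem_set// !mul1r.
Qed.

Let integ_A_tau : integ P (fun w => \1_B w * A (tau w) w).
Proof.
apply: (integ_bounded_ae (c := `|c|)).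
  by apply: measurable_funM; [exact: measurable_indic|exact: mstop].
apply: filterS A_bounded => w h; rewrite indicE.
case: (w \in B); last by rewrite mul0r normr0.
rewrite mul1r (le_trans _ (ler_norm _))//; apply: h; first exact: tmin_ge0.
exact: tmin_leT.
Qed.

Let integ_X_s : integ P (fun w => \1_B w * X s w).
Proof.
have iN : integ P (fun w => \1_B w * N s w).
  by apply: integ_indic => //; exact: (martingale_integ mN).
apply: (integ_le_ae _ (integD (integ_norm iN) (integ_cst P `|c|))).
  by apply: measurable_funM; [exact: measurable_indic|exact: mZ].
apply: filterS2 XE A_bounded => w xe h; rewrite indicE.
have [|] := boolP (w \in B); last by rewrite !mul0r normr0 add0r.
rewrite inE => /BG /ltW sTw; rewrite !mul1r xe// (le_trans (ler_normD _ _))//.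
by rewrite lerD// (le_trans _ (ler_norm _))// h.
Qed.

Let integ_N_tau : integ P (fun w => \1_B w * N (tau w) w).
Proof. by apply: integ_restr; have [] := stop_late_L1 hF mN rcN sT s0 st. Qed.

Let X_tau : \forall w \ae P, X (tau w) w = N (tau w) w + A (tau w) w.
Proof.
by apply: filterS XE => w; apply; [exact: tmin_ge0|exact: tmin_leT].
Qed.

Let measurable_X_tau : measurable_fun setT (fun w => X (tau w) w).
Proof.
apply: (mwrt_measurable (F_meas hF t0)).
apply: (@mwrt_ae_eq _ _ _ P _ (F_sigma hF t0) (fun B => F_null hF t0) _
  (fun w => N (tau w) w + A (tau w) w)) => //.
apply: mwrtD; first exact: (F_sigma hF t0).
  by apply: (adapted_stopped hF) => //; case: mN.
exact: (adapted_stopped hF).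
Qed.

Lemma integ_X_tau : integ P (fun w => \1_B w * X (tmin t T w) w).
Proof.
apply: (integ_le_ae _ (integD (integ_norm integ_N_tau) (integ_norm integ_A_tau))).
  by apply: measurable_funM; [exact: measurable_indic|exact: measurable_X_tau].
by apply: filterS X_tau => w ->; rewrite mulrDr ler_normD.
Qed.

(** The discrete Tanaka inequality is integrated over B. The martingale sum has
expectation 0; the drift is asymptotically nonnegative; and stopping N late
instead of at min(t, T) costs an L^1 error that tends to 0, since f is
1-Lipschitz. *)
Lemma tanaka_le :
  Rintegral P setT (fun w => \1_B w * f (X s w)) <=
  Rintegral P setT (fun w => \1_B w * f (X (tmin t T w) w)).
Proof.
pose Y m := stop_late N T s t m.
have [iGN L1] := stop_late_L1 hF mN rcN sT s0 st.
have iGD m : integ P (fun w => \1_G w * `|Y m w - N (tau w) w|).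
  have iGY : integ P (fun w => \1_G w * Y m w).
    by apply: integ_indic; [exact: (F_meas hF s0 FG)|exact: (stop_late_integ hF mN sT)].
  have := integ_norm (integB iGY iGN).
  rewrite (_ : (fun w => `|_ - _|) = (fun w => \1_G w * `|Y m w - N (tau w) w|))//.
  apply/funext => w; rewrite -mulrBr normrM indicE.
  by case: (w \in G); rewrite ?normr1 ?normr0.
pose gi m i w := \1_B w * before T s t m i w * g (X (u m i) w).
pose S m w := \sum_(i < gsize t m) gi m i w * (N (u m i.+1) w - N (u m i) w).
have mgi m i : measurable_wrt (F (u m i)) (gi m i).
  have sF := F_sigma hF (u0 m i).
  apply: mwrtM => //; first apply: mwrtM => //.
  - by apply: mwrt_indic => //; exact: (F_mono hF s0 (us m i)).
  - by apply: mwrt_indic => //; exact: (stopping_lt hF).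
  - by apply: mwrt_comp => //; exact: aX.
have gib m i w : `|gi m i w| <= 1.
  rewrite /gi !normrM; apply: mulr_ile1; rewrite ?mulr_ge0//.
  apply: mulr_ile1 => //; first by rewrite indicE; case: (w \in B); rewrite ?normr1 ?normr0.
  by rewrite /before indicE; case: (w \in _); rewrite ?normr1 ?normr0.
have igi m i : integ P (fun w => gi m i w * (N (u m i.+1) w - N (u m i) w)).
  apply: (integM_bounded (c := 1)) => //.
    exact: (mwrt_measurable (F_meas hF (u0 m i)) (mgi m i)).
  by apply: integB; exact: (martingale_integ mN).
have iS m : integ P (S m) by apply: (@integ_sum _ _ _ _ _
  (fun i w => gi m i w * (N (u m i.+1) w - N (u m i) w))) => i _; exact: igi.
have ES m : Rintegral P setT (S m) = 0.
  rewrite (@E_sum _ _ _ _ _ (fun i w => gi m i w * (N (u m i.+1) w - N (u m i) w)))//.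
  rewrite big1// => i _.
  by apply: (martingale_transform hF mN (u0 m i) _ (mgi m i) (gib m i)); exact: grid_homo.
have mdrift m : measurable_fun setT (fun w => \1_B w * Num.min (drift m w) 0).
  by apply: measurable_funM; [exact: measurable_indic|exact: measurable_minr].
have drift_le : \forall w \ae P, forall m, `|\1_B w * Num.min (drift m w) 0| <= `|c|.
  apply: filterS drift_bounded => w h m; rewrite indicE.
  have [|_] := boolP (w \in B); last by rewrite mul0r normr0.
  rewrite inE => /BG Gw; rewrite mul1r driftE// (le_trans _ (ler_norm c))//.
  apply: le_trans (h Gw m).
  have := @min_lipschitz1 R 0 (drift_sum m w) 0.
  by rewrite minxx !subr0.
have idr m : integ P (fun w => \1_B w * Num.min (drift m w) 0).
  by apply: (integ_bounded_ae (mdrift m)); apply: filterS drift_le => w; exact.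
have Edr : Rintegral P setT (fun w => \1_B w * Num.min (drift m w) 0)
    @[m --> \oo] --> (0 : R).
  have [|||||_ cv] := @E_dominated _ _ _ P (fun m w => \1_B w * Num.min (drift m w) 0)
    (fun=> 0) (fun=> `|c|).
  - exact: mdrift.
  - exact: measurable_cst.
  - exact: integ_cst.
  - exact: drift_le.
  - apply: filterS drift_liminf => w h; rewrite indicE.
    have [|_] := boolP (w \in B); last first.
      by under eq_fun do rewrite mul0r; exact: cvg_cst.
    rewrite inE => /BG Gw; under eq_fun do rewrite mul1r driftE//.
    exact: h.
  by rewrite E_cst in cv.
have iXs : integ P (fun w => \1_B w * f (X s w)).
  by apply: integ_f => //; exact: mZ.
have iXt : integ P (fun w => \1_B w * f (X (tau w) w)).
  by apply: integ_f => //; exact: integ_X_tau.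
have step m : Rintegral P setT (fun w => \1_B w * f (X s w)) +
    Rintegral P setT (fun w => \1_B w * Num.min (drift m w) 0) <=
    Rintegral P setT (fun w => \1_B w * f (X (tau w) w)) +
    Rintegral P setT (fun w => \1_G w * `|Y m w - N (tau w) w|).
  rewrite -[leLHS]addr0 -[X in _ + X <= _](ES m) -!E_D//; last exact: integD.
  apply: E_le_ae; [by apply: integD => //; exact: integD|exact: integD|].
  apply: filterS2 XE X_tau => w xe xt; rewrite /S /gi !indicE.
  have [|_] := boolP (w \in B); last first.
    rewrite !mul0r !add0r big1 ?mulr_ge0// => i _.
    by rewrite !mul0r.
  rewrite inE => /BG Gw; rewrite (mem_set Gw) !mul1r xt.
  have su : u m 0 = s by rewrite /u grid0.
  have stau : s <= tau w by rewrite le_tmin// st ltW.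
  have tt : tau w <= t by exact: tmin_le.
  have xe' v : u m 0 <= v -> v <= tau w -> X v w = N v w + A v w.
    rewrite su => sv vt; apply: xe; first exact: le_trans s0 sv.
    by apply: le_trans (tmin_leT t (T0 w)); rewrite lee_fin.
  have su' : u m 0 <= tau w by rewrite su.
  have uend : u m (gsize t m) = t := grid_end st (gsize_end t m).
  have := @tanaka_discrete R f g (N ^~ w) (A ^~ w) (X ^~ w) (u m) (tau w) (gsize t m)
    fg (fun i j => @grid_homo _ s t m i j) su' xe'.
  rewrite drift_sum_tau// -driftE// su uend (min_r tt).
  have -> : N s w + \sum_(i < gsize t m) (u m i < tau w)%R%:R *
      (N (u m i.+1) w - N (u m i) w) = Y m w.
    congr (_ + _); apply: eq_bigr => i _.
    by rewrite -(@before_incr _ _ _ T s t m i w (N ^~ w) (T0 w)).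
  have -> : \sum_(i < gsize t m) (u m i < tau w)%R%:R *
      (g (X (u m i) w) * (N (u m i.+1) w - N (u m i) w)) =
    \sum_(i < gsize t m) (nat_of_bool true)%:R * before T s t m i w *
      g (X (u m i) w) * (N (u m i.+1) w - N (u m i) w).
    apply: eq_bigr => i _; rewrite mul1r -mulrA mulrBr.
    by rewrite -(@before_incr _ _ _ T s t m i w (fun v => g (X (u m i) w) * N v w) (T0 w)).
  have := f_lip (Y m w + A (tau w) w) (N (tau w) w + A (tau w) w).
  rewrite opprD addrACA subrr addr0 ler_norml => /andP[_].
  have : Num.min (drift m w) 0 <= drift m w by rewrite ge_min lexx.
  lra.
apply/ler_addgt0Pl => e e0.
have e2 : 0 < e / 2%:R by rewrite divr_gt0.
have /cvgr0Pnorm_lt/(_ _ e2)[n1 _ h1] := L1.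
have /cvgr0Pnorm_lt/(_ _ e2)[n2 _ h2] := Edr.
have := step (maxn n1 n2).
have /= := h1 (maxn n1 n2) (leq_maxl _ _); rewrite ltr_norml => /andP[_].
have /= := h2 (maxn n1 n2) (leq_maxr _ _); rewrite ltr_norml => /andP[+ _].
rewrite -/G -/tau; lra.
Qed.

End tanaka_expectation.

(** * Stopping times, and the compact sets that they can announce *)

Section stopping_times.
Context {R : realType} {d : measure_display} {Omega : measurableType d}.
Variable P : probability Omega R.
Variable F : R -> set (set Omega).
Hypothesis hF : usual_conditions P F.
Implicit Types (T : Omega -> \bar R).

Definition time_on (a : R) (B : set Omega) : Omega -> \bar R :=
  fun w => if w \in B then a%:E else +oo%E.

Lemma stopping_time_on a B : 0 <= a -> F a B -> stopping_time F (time_on a B).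
Proof.
move=> a0 FB; split=> [w|t t0]; rewrite /time_on.
  by case: ifP => _; rewrite ?lee_fin ?leey.
have [at'|ta] := leP a t.
  rewrite (_ : [set _ | _] = B); first exact: (F_mono hF a0 at').
  apply/seteqP; split=> w /=; last by move=> Bw; rewrite mem_set// lee_fin.
  by case: (boolP (w \in B)) => [|_]; [rewrite inE|rewrite leye_eq].
rewrite (_ : [set _ | _] = set0); first exact: sG0 (F_sigma hF t0).
apply/seteqP; split=> w //=.
by case: (w \in B); [rewrite lee_fin leNgt ta|rewrite leye_eq].
Qed.

Lemma stopping_pinfty : stopping_time F (fun=> +oo%E).
Proof.
split=> [w|t t0]; first by rewrite leey.
rewrite (_ : [set _ | _] = set0); first exact: sG0 (F_sigma hF t0).
by apply/seteqP; split.
Qed.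

Lemma stopping_min T1 T2 : stopping_time F T1 -> stopping_time F T2 ->
  stopping_time F (fun w => Order.min (T1 w) (T2 w)).
Proof.
move=> [p1 s1] [p2 s2]; split=> [w|t t0]; first by rewrite le_min p1 p2.
rewrite (_ : [set _ | _] =
    [set w | (T1 w <= t%:E)%E] `|` [set w | (T2 w <= t%:E)%E]).
  by apply: sGU; [exact: (F_sigma hF t0)|exact: s1|exact: s2].
by apply/seteqP; split=> w /=; rewrite ge_min => /orP.
Qed.

(** The infimum is at most t if and only if, for each e > 0, some T_n is at most
t + e: this is an event of F_(t + e) for all e > 0, hence of F_t by
right-continuity of the filtration. *)
Lemma stopping_inf (T_ : nat -> Omega -> \bar R) :
  (forall n, stopping_time F (T_ n)) ->
  stopping_time F (fun w => ereal_inf (range (T_ ^~ w))).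
Proof.
move=> sT; split=> [w|t t0].
  by apply: le_ereal_inf_tmp => _ [n _ <-]; case: (sT n).
case: hF => _ rcF _; rewrite -rcF// => s /= ts.
have e0 (k : nat) : 0 < (s - t) / k.+1%:R by rewrite divr_gt0// subr_gt0.
have s0 : 0 <= s by rewrite (le_trans t0)// ltW.
rewrite (_ : [set _ | _] = \bigcap_k \bigcup_n
    [set w | (T_ n w <= (t + (s - t) / k.+1%:R)%:E)%E]).
  apply: sG_bigcap => [|k]; first exact: (F_sigma hF s0).
  apply: sG_bigcup => [|n]; first exact: (F_sigma hF s0).
  have r0 : 0 <= t + (s - t) / k.+1%:R by rewrite addr_ge0// ltW.
  apply: (F_mono hF r0); last by have [_ h] := sT n; exact: h.
  rewrite -lerBrDl ler_pdivrMr// ler_peMr ?ler1n//.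
  by rewrite subr_ge0 ltW.
apply/seteqP; split=> w /=.
  move=> Tt k _; have : (ereal_inf (range (T_ ^~ w)) < (t + (s - t) / k.+1%:R)%:E)%E.
    by apply: le_lt_trans Tt _; rewrite lte_fin ltrDl.
  by move=> /ereal_inf_lt[_ [n _ <-]] /ltW; exists n.
move=> h; apply/lee_addgt0Pr => e epos.
have [n _ Tn] := h (Num.truncn ((s - t) / e)) I.
apply: (le_trans (ereal_inf_lbound _)); first by exists n.
apply: (le_trans Tn); rewrite -EFinD lee_fin lerD2l ler_pdivrMr// mulrC.
by rewrite -ler_pdivrMr// ltW// truncnS_gt.
Qed.

End stopping_times.

Lemma compact_nested {R : realType} (K : nat -> set R) (x : nat -> R) (a b : R) :
  (forall j, closed (K j)) -> (forall i j, (i <= j)%N -> K j `<=` K i) ->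
  (forall j, K j (x j)) -> (forall j, a <= x j <= b) ->
  exists2 p, a <= p <= b & forall j, K j p.
Proof.
move=> cK dK Kx xb.
have [|p [pab cl]] := @segment_compact R a b (x @ \oo) _.
  by exists 0%N => // j _ /=; rewrite in_itv/= xb.
exists p; first by move: pab; rewrite /= in_itv.
move=> j; apply: cK => B nB; apply: cl => //.
by exists j => // i /= ji; exact: dK ji _ (Kx i).
Qed.

Section compact_paving.
Context {R : realType} {d : measure_display} {Omega : measurableType d}.
Variable P : probability Omega R.
Variable F : R -> set (set Omega).
Hypothesis hF : usual_conditions P F.
Implicit Types (K L E : set (R * Omega)).

(** Finite unions of rectangles [a, b] x B where the event B is known strictly
before a: the sections are compact, and the debut can be announced by a
stopping time. *)
Inductive simple : set (R * Omega) -> Prop :=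
| simple0 : simple set0
| simple_add r a b B K : 0 <= r -> r < a -> a <= b -> F r B ->
    simple K -> simple ((`[a, b]%classic `*` B) `|` K).

Lemma simple_rect r a b B : 0 <= r -> r < a -> a <= b -> F r B ->
  simple (`[a, b]%classic `*` B).
Proof.
by move=> r0 ra ab FB; rewrite -[_ `*` _]setU0; apply: simple_add FB simple0.
Qed.

Lemma simpleU K L : simple K -> simple L -> simple (K `|` L).
Proof.
move=> + sL; elim=> [|r a b B K' r0 ra ab FB _ IH]; first by rewrite set0U.
by rewrite -setUA; exact: simple_add FB IH.
Qed.

Lemma simpleI K L : simple K -> simple L -> simple (K `&` L).
Proof.
move=> + sL; elim=> [|r a b B K' r0 ra ab FB _ IH].
  by rewrite set0I; exact: simple0.
rewrite setIUl; apply: simpleU => // {IH}.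
elim: sL => [|r' a' b' B' L' r'0 ra' ab' FB' _ IH].
  by rewrite setI0; exact: simple0.
rewrite setIUr; apply: simpleU => // {IH}.
rewrite -setXI (_ : _ `&` _ = `[Num.max a a', Num.min b b']%classic); last first.
  apply/seteqP; split=> u /=; rewrite !in_itv/= ge_max le_min.
    by move=> [/andP[-> ->] /andP[-> ->]].
  by move=> /andP[/andP[-> ->] /andP[-> ->]].
have [ab1|ba1] := leP (Num.max a a') (Num.min b b'); last first.
  rewrite set_itv_ge ?bnd_simp -?ltNge// set0X; exact: simple0.
have m0 : 0 <= Num.max r r' by rewrite le_max r0.
apply: (@simple_rect (Num.max r r')) => //.
- by rewrite gt_max !lt_max ra ra' orbT.
- apply: sGI; first exact: (F_sigma hF m0).
    by apply: (F_mono hF r0 _ FB); rewrite le_max lexx.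
  by apply: (F_mono hF r'0 _ FB'); rewrite le_max lexx orbT.
Qed.

Lemma simple_closed K w : simple K -> closed [set u | K (u, w)].
Proof.
elim=> [|r a b B K' r0 ra ab FB _ IH]; first exact: closed0.
change (closed ([set u | (`[a, b]%classic `*` B) (u, w)] `|`
  [set u | K' (u, w)])).
apply: closedU => //; have [Bw|nBw] := pselect (B w).
  rewrite (_ : mkset _ = `[a, b]%classic); first exact: itv_closed.
  by apply/seteqP; split=> u //= [].
rewrite (_ : mkset _ = set0); first exact: closed0.
by apply/seteqP; split=> u //= [].
Qed.

(** On B the rectangle [a, b] x B is announced by the time max(r, a - 1), which is
both before a and at distance at most 1 from it. *)
Lemma simple_foretell K : simple K -> exists T, [/\ stopping_time F T,
  (forall u w, K (u, w) -> (T w < u%:E)%E) &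
  (forall w, (T w < +oo)%E -> exists2 u, K (u, w) & (u%:E <= T w + 1%:E)%E)].
Proof.
elim=> [|r a b B K' r0 ra ab FB _ [T [sT KT TK]]].
  by exists (fun=> +oo%E); split=> //; exact: stopping_pinfty hF.
pose r' := Num.max r (a - 1).
have r'a : r' < a by rewrite gt_max ra ltrBlDr ltrDl/=.
have FB' : F r' B by apply: (F_mono hF r0 _ FB); rewrite le_max lexx.
have r'0 : 0 <= r' by rewrite le_max r0.
exists (fun w => Order.min (time_on r' B w) (T w)); split.
- by apply: (stopping_min hF) => //; exact: (stopping_time_on hF).
- move=> u w /= [[/= uab Bw]|Ku]; rewrite gt_min.
    rewrite /time_on mem_set// lte_fin.
    by move: uab; rewrite in_itv/= => /andP[au _]; rewrite (lt_le_trans r'a).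
  by rewrite (KT u w Ku) orbT.
- move=> w; rewrite /time_on; have [|_] := boolP (w \in B); last first.
    rewrite min_r ?leey// => /TK[u Ku uT]; exists u => //; by right.
  rewrite inE => Bw _; have [r'T|Tr'] := leP r'%:E (T w).
    exists a; first by left; split=> //=; rewrite in_itv/= lexx.
    by rewrite -EFinD lee_fin -lerBlDr le_max lexx orbT.
  have [|u Ku uT] := TK w; first exact: lt_trans Tr' (ltry _).
  by exists u => //; right.
Qed.

(** The compact paving with which predictable sets are approximated from
inside. *)
Definition kset K := exists2 L : nat -> set (R * Omega),
  (forall j, simple (L j)) & K = \bigcap_j L j.

Lemma kset_simple K : simple K -> kset K.
Proof. by move=> sK; exists (fun=> K) => //; rewrite bigcap_const//; exists 0%N. Qed.

Lemma kset_bigcap (K : nat -> set (R * Omega)) :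
  (forall i, kset (K i)) -> kset (\bigcap_i K i).
Proof.
move=> kK; have /all_sig2[L sL KE] i := cid2 (kK i).
(* enumeration of the simple sets of all the K i *)
exists (fun j => if unpickle j is Some (i, k) then L i k
                 else L 0%N 0%N) => [j|].
  by case: unpickle => [[i k]|].
apply/seteqP; split=> z /= h.
  move=> j _; case: unpickle => [[i k]|]; last first.
    by have := h 0%N I; rewrite KE; apply.
  by have := h i I; rewrite KE; apply.
move=> i _; rewrite KE => k _.
by have := h (pickle (i, k)) I; rewrite pickleK.
Qed.

(** A point outside the first intersection misses some K' i, hence belongs to
every L' k. *)
Lemma ksetU K L : kset K -> kset L -> kset (K `|` L).
Proof.
move=> [K' sK ->] [L' sL ->].
exists (fun j => if unpickle j is Some (i, k) then K' i `|` L' k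
                 else K' 0%N `|` L' 0%N) => [j|].
  by case: unpickle => [[i k]|]; exact: simpleU.
apply/seteqP; split=> z /= h.
  move=> j _; case: h => h; case: unpickle => [[i k]|].
  - by left; exact: h.
  - by left; exact: h.
  - by right; exact: h.
  - by right; exact: h.
have [h'|nh] := pselect ((\bigcap_j K' j) z); [by left|right => k _].
have [i nKi] : exists i, ~ K' i z.
  by apply/existsNP => h'; apply: nh => i _; exact: h'.
by have := h (pickle (i, k)) I; rewrite pickleK => -[].
Qed.

Lemma kset_decreasing K : kset K -> exists L : nat -> set (R * Omega),
  [/\ forall j, simple (L j), forall i j, (i <= j)%N -> L j `<=` L i &
      K = \bigcap_j L j].
Proof.
move=> [L sL ->].
exists (fun j => \bigcap_(i in [set i | (i <= j)%N]) L i); split.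
- elim=> [|j IH].
    rewrite (_ : mkset _ = [set 0%N]) ?bigcap_set1//.
    by apply/seteqP; split=> i //=; [rewrite leqn0 => /eqP|move=> ->].
  rewrite (_ : mkset _ = j.+1 |` [set i | (i <= j)%N]) ?bigcap_setU1.
    exact: simpleI.
  apply/seteqP; split=> i /=; first rewrite leq_eqVlt.
    by move=> /orP[/eqP ->|]; [left|right].
  by move=> [->//|/leq_trans]; apply.
- move=> i j ij z h k /= ki; apply: h => /=; exact: leq_trans ki ij.
- apply/seteqP; split=> z h; first by move=> j _ i _; exact: h.
  by move=> j _; apply: (h j I) => /=.
Qed.

End compact_paving.

(** * Inner regularity of predictable sets *)

Section inner_regularity.
Context {R : realType} {d : measure_display} {Omega : measurableType d}.
Variable P : probability Omega R.
Variable F : R -> set (set Omega).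
Hypothesis hF : usual_conditions P F.
Variable s : Omega -> R.
Hypothesis ms : measurable_fun setT s.
Hypothesis s0 : {ae P, forall w, s w != 0}.
Implicit Types (K L E : set (R * Omega)).

(** E |-> P (event_at E) is the image of P by w |-> (s w, w), a measure carried by
the graph of s. *)
Definition event_at E : set Omega := [set w | E (s w, w)].

Let D : set (R * Omega) := `[0, +oo[%classic `*` [set: Omega].

Lemma event_rect (I : set R) B : measurable I -> measurable B ->
  measurable (event_at (I `*` B)).
Proof.
move=> mI mB; rewrite (_ : event_at _ = (s @^-1` I) `&` B).
  by apply: measurableI => //; rewrite -[_ @^-1` _]setTI; exact: ms.
by apply/seteqP; split.
Qed.

Lemma event_simple K : simple F K -> measurable (event_at K).
Proof.
elim=> [|r a b B K' r0 ra ab FB _ IH]; first exact: measurable0.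
apply: measurableU => //; apply: event_rect => //; exact: (F_meas hF r0 FB).
Qed.

Lemma event_kset K : kset F K -> measurable (event_at K).
Proof.
move=> [L sL ->]; rewrite (_ : event_at _ = \bigcap_j event_at (L j)).
  by apply: bigcapT_measurable => j; exact: event_simple.
by apply/seteqP; split.
Qed.

Definition inner_regular E := forall e : R, 0 < e -> exists K,
  [/\ kset F K, K `<=` E & (P (event_at E `\` event_at K) <= e%:E)%E].

Lemma inner_kset K : kset F K -> inner_regular K.
Proof.
move=> kK e e0; exists K; split=> //.
by rewrite setDv measure0 lee_fin ltW.
Qed.

Lemma inner0 : inner_regular set0.
Proof. by apply/inner_kset/kset_simple/simple0. Qed.

Lemma innerU E E' : measurable (event_at E) -> measurable (event_at E') ->
  inner_regular E -> inner_regular E' -> inner_regular (E `|` E').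
Proof.
move=> mE mE' iE iE' e e0; have e2 : 0 < e / 2 by rewrite divr_gt0.
have [K [kK KE PK]] := iE _ e2; have [K' [kK' KE' PK']] := iE' _ e2.
exists (K `|` K'); split; [exact: ksetU|exact: setUSS|].
have m1 : measurable (event_at E `\` event_at K).
  by apply: measurableD => //; exact: event_kset.
have m2 : measurable (event_at E' `\` event_at K').
  by apply: measurableD => //; exact: event_kset.
have -> : e%:E = ((e / 2)%:E + (e / 2)%:E)%E by rewrite -EFinD -splitr.
apply: (@le_trans _ _ (P ((event_at E `\` event_at K) `|`
    (event_at E' `\` event_at K')))); last first.
  by apply: (le_trans (measureU2 _ _ _)) => //; exact: leeD.
apply: le_measure; rewrite ?inE; [|exact: measurableU|].
  apply: measurableD; first exact: measurableU.
  by apply: measurableU; exact: event_kset.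
move=> w [[Ew|Ew] /not_orP[nK nK']]; by [left|right].
Qed.

Lemma inner_finite (E : nat -> set (R * Omega)) n :
  (forall i, measurable (event_at (E i))) -> (forall i, inner_regular (E i)) ->
  measurable (event_at (\bigcup_(i < n) E i)) /\ inner_regular (\bigcup_(i < n) E i).
Proof.
move=> mE iE; elim: n => [|n [m i]].
  rewrite II0 bigcup_set0; split; [exact: measurable0|exact: inner0].
rewrite IIS bigcup_setU bigcup_set1; split; last exact: innerU.
by change (measurable (event_at (\bigcup_(i < n) E i) `|` event_at (E n)));
  exact: measurableU.
Qed.

(** Finite unions of the E_ i exhaust E up to a set of small probability. *)
Lemma inner_cvg E (E_ : nat -> set (R * Omega)) : measurable (event_at E) ->
  (forall i, measurable (event_at (E_ i))) -> (forall i, inner_regular (E_ i)) ->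
  (forall i, E_ i `<=` E) ->
  (forall w, s w != 0 -> event_at E w -> exists i, event_at (E_ i) w) ->
  inner_regular E.
Proof.
move=> mE mE_ iE_ sE cE e e0; have e2 : 0 < e / 2 by rewrite divr_gt0.
pose U n := \bigcup_(i < n) E_ i.
have [mU iU] : (forall n, measurable (event_at (U n))) /\ forall n, inner_regular (U n).
  by split=> n; have [] := inner_finite n mE_ iE_.
(* G n decreases to a null event *)
pose G n := event_at E `\` event_at (U n).
have mG n : measurable (G n) by exact: measurableD.
have mGG : measurable (\bigcap_n G n) by exact: bigcapT_measurable.
have cG : P (G n) @[n --> \oo] --> P (\bigcap_n G n).
  apply: nonincreasing_cvg_mu => //.
    by rewrite (le_lt_trans (probability_le1 _ _))// ltry.
  move=> i j ij; apply/subsetPset => w [Ew nU]; split=> // -[k /= ki Ekw].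
  by apply: nU; exists k => //=; exact: leq_trans ki ij.
have G0 : P (\bigcap_n G n) = 0%E.
  apply: measure_negligible => //; apply: negligibleS s0 => w h /= s0w.
  have [Ew _] := h 0%N I; have [i Ei] := cE w s0w Ew.
  by have [_] := h i.+1 I; apply; exists i => //=.
have [n Pn] : exists n, (P (G n) <= (e / 2)%:E)%E.
  have [n _ h] : \forall n \near \oo, (P (G n) < (e / 2)%:E)%E.
    have h : nbhs (P (\bigcap_n G n)) [set y | (y < (e / 2)%:E)%E].
      by rewrite G0; apply: open_ereal_lt'; rewrite lte_fin.
    exact: (cG _ h).
  by exists n; apply/ltW/h => /=.
have [K [kK KU PK]] := iU n _ e2.
exists K; split=> //; first by move=> z /KU[i _]; exact: sE.
have -> : e%:E = ((e / 2)%:E + (e / 2)%:E)%E by rewrite -EFinD -splitr.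
have mK := event_kset kK.
apply: (@le_trans _ _ (P (G n `|` (event_at (U n) `\` event_at K)))); last first.
  apply: (le_trans (measureU2 _ _ _)) => //; last exact: leeD.
  exact: measurableD.
apply: le_measure; rewrite ?inE; [exact: measurableD| |].
  by apply: measurableU => //; exact: measurableD.
move=> w [Ew nK]; have [Uw|nU] := pselect (event_at (U n) w); by [right|left].
Qed.

(** The errors e / 2^(i+1) of the factors add up to at most e. *)
Lemma inner_bigcap (E : nat -> set (R * Omega)) :
  (forall i, measurable (event_at (E i))) -> (forall i, inner_regular (E i)) ->
  inner_regular (\bigcap_i E i).
Proof.
move=> mE iE e e0.
have e2 i : 0 < e / (2 ^ i.+1)%:R by rewrite divr_gt0// ltr0n expn_gt0.
have /choice[K KP] i := iE i _ (e2 i).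
exists (\bigcap_i K i); split.
- by apply: kset_bigcap => i; have [] := KP i.
- by move=> z h i _; have [_ + _] := KP i; apply; exact: h.
have mK i : measurable (event_at (K i)) by have [kK _ _] := KP i; exact: event_kset.
apply: (@le_trans _ _ (\sum_(0 <= i <oo)
    P (event_at (E i) `\` event_at (K i)))%E).
  apply: measure_sigma_subadditive.
  - by move=> i; exact: measurableD.
  - by apply: measurableD; apply: bigcapT_measurable.
  move=> w [/= Ew /existsNP[i /not_implyP[_ nK]]]; exists i => //.
  by split=> //; exact: Ew.
apply: le_trans (epsilon_trick0 predT (ltW e0)).
by apply: lee_nneseries => i //= _; have [] := KP i.
Qed.

(** The rectangles [a + (b-a)/(k+1), b] x B are simple, since B is known at time a,
and they increase to ]a, b] x B. *)
Lemma inner_oc a b B : 0 <= a -> F a B -> inner_regular (`]a, b]%classic `*` B).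
Proof.
move=> a0 FB; have mB := F_meas hF a0 FB; have [ab|ba] := ltP a b; last first.
  rewrite set_itv_ge ?bnd_simp -?leNgt// set0X; exact: inner0.
have e0 (k : nat) : 0 < (b - a) / k.+1%:R by rewrite divr_gt0// subr_gt0.
apply: (@inner_cvg _ (fun k => `[a + (b - a) / k.+1%:R, b]%classic `*` B)).
- exact: event_rect.
- by move=> k; exact: event_rect.
- move=> k; apply/inner_kset/kset_simple; apply: (@simple_rect _ _ _ _ a) => //.
    by rewrite ltrDl.
  rewrite -lerBrDl ler_pdivrMr// ler_peMr ?ler1n//.
  by rewrite subr_ge0 ltW.
- move=> k [u w] [/= + Bw]; rewrite !in_itv/= => /andP[ku ub]; split=> //=.
  by rewrite ub (lt_le_trans _ ku)// ltrDl.
- move=> w _ [/= + Bw]; rewrite in_itv/= => /andP[asw sb].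
  exists (Num.truncn ((b - a) / (s w - a))); split=> //=.
  rewrite in_itv/= sb andbT -lerBrDl ler_pdivrMr// mulrC.
  by rewrite -ler_pdivrMr ?subr_gt0// ltW// truncnS_gt.
Qed.

Lemma inner_oy a : 0 <= a -> inner_regular (`]a, +oo[%classic `*` setT).
Proof.
move=> a0; apply: (@inner_cvg _ (fun k => `]a, k%:R]%classic `*` setT)).
- exact: event_rect.
- by move=> k; exact: event_rect.
- by move=> k; apply: inner_oc => //; exact: (sGT (F_sigma hF a0)).
- by move=> k [u w] [/= + _]; rewrite !in_itv/= => /andP[-> _].
- move=> w _ [/= + _]; rewrite in_itv/= andbT => asw.
  exists (Num.truncn (s w)).+1; split=> //=.
  by rewrite in_itv/= asw ltW// truncnS_gt.
Qed.

(** The sets that are inner regular together with their complement form a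
sigma-algebra. It contains the generators ]a, b] x B by inner_oc, and {0} x A
because s almost surely avoids 0. *)
Lemma predictable_inner E : <<s D, predictable_sets F>> E ->
  measurable (event_at E) /\ inner_regular E.
Proof.
pose Q E := [/\ E `<=` D, measurable (event_at E), inner_regular E & inner_regular (D `\` E)].
have mD : measurable (event_at D) by exact: event_rect.
have l0 : (0 : R) <= 0 by [].
have FT t : 0 <= t -> F t setT by move=> t0; exact: (sGT (F_sigma hF t0)).
suff QE : <<s D, predictable_sets F>> `<=` Q by move=> /QE[].
apply: smallest_sub; first split.
- split=> //; first exact: measurable0.
    exact: inner0.
  rewrite setD0; apply: (@inner_cvg _ (fun=> `]0, +oo[%classic `*` setT)) => //.
  + by move=> _; exact: event_rect.
  + by move=> _; exact: inner_oy.
  + by move=> _ [u w] [/= + _]; rewrite in_itv/= andbT => u0; split=> //=;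
      rewrite in_itv/= andbT ltW.
  + move=> w sw [/= + _]; rewrite in_itv/= andbT => sw0; exists 0%N; split=> //=.
    by rewrite in_itv/= andbT lt_neqAle eq_sym sw.
- move=> E' [ED mE iE iDE]; split=> //.
  + exact: measurableD.
  + by rewrite setDD setIidr.
- move=> E_ QE_; have mE_ i : measurable (event_at (E_ i)) by case: (QE_ i).
  have m : measurable (event_at (\bigcup_k E_ k)) by exact: bigcupT_measurable.
  split=> //.
  + by move=> z [i _]; case: (QE_ i) => + _ _ _; apply.
  + apply: (@inner_cvg _ E_) => //.
    * by move=> i; case: (QE_ i).
    * by move=> i; exact: bigcup_sup.
    * by move=> w _ [i _ Ei]; exists i.
  + rewrite (_ : D `\` _ = \bigcap_i (D `\` E_ i)).
      apply: (@inner_bigcap (fun i => D `\` E_ i)) => i; first exact: (measurableD mD (mE_ i)).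
      by case: (QE_ i).
    apply/seteqP; split=> z; first by move=> [Dz nE] i _; split=> // Ei; apply: nE; exists i.
    by move=> h; split; [have [] := h 0%N I|move=> [i _]; have [] := h i I].
move=> E' [[A FA ->]|[a [b [A [a0 ab FA ->]]]]].
- have mA := F_meas hF l0 FA; split.
  + by move=> [u w] [/= -> _]; split=> //=; rewrite in_itv/= lexx.
  + exact: event_rect.
  + apply: (@inner_cvg _ (fun=> set0)) => //.
    * exact: event_rect.
    * by move=> _; exact: measurable0.
    * by move=> _; exact: inner0.
    * by move=> w + [/= /eqP sw]; rewrite sw.
  + apply: (@inner_cvg _ (fun=> `]0, +oo[%classic `*` setT)) => //.
    * by apply: measurableD => //; exact: event_rect.
    * by move=> _; exact: event_rect.
    * by move=> _; exact: inner_oy.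
    * move=> _ [u w] [/= + _]; rewrite in_itv/= andbT => u0; split=> /=.
        by split=> //=; rewrite in_itv/= andbT ltW.
      by move=> [/= u0' _]; move: u0; rewrite u0' ltxx.
    * move=> w sw [[/= + _] _]; rewrite in_itv/= andbT => sw0; exists 0%N; split=> //=.
      by rewrite in_itv/= andbT lt_neqAle eq_sym sw.
- have mA := F_meas hF a0 FA; have b0 : 0 <= b by rewrite (le_trans a0)// ltW.
  split.
  + by move=> [u w] [/= + _]; rewrite !in_itv/= => /andP[au _]; split=> //=;
      rewrite in_itv/= andbT (le_trans a0)// ltW.
  + exact: event_rect.
  + exact: inner_oc.
  + apply: (@inner_cvg _ (fun i => if i is i'.+1 then
      if i' is _.+1 then `]b, +oo[%classic `*` setT
      else `]0, a]%classic `*` setT else `]a, b]%classic `*` ~` A)) => //.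
    * by apply: measurableD => //; exact: event_rect.
    * by move=> [|[|i]]; apply: event_rect => //; exact: measurableC.
    * move=> [|[|i]]; [apply: inner_oc => //|exact: inner_oc (FT _ _)|exact: inner_oy].
      exact: (sGC (F_sigma hF a0)).
    * move=> [|[|i]] [u w] [/=]; rewrite in_itv/=.
      - move=> /andP[au ub] nA; split; last by move=> [].
        by split=> //=; rewrite in_itv/= andbT (le_trans a0)// ltW.
      - move=> /andP[u0 ua] _; split; first by split=> //=; rewrite in_itv/= andbT ltW.
        by move=> [/=]; rewrite in_itv/= ltNge ua.
      - move=> /andP[bu _] _; split.
          by split=> //=; rewrite in_itv/= andbT (le_trans b0)// ltW.
        by move=> [/=]; rewrite in_itv/= (leNgt u) bu andbF.
    * move=> w sw [[/= + _] nE]; rewrite in_itv/= andbT => sw0.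
      have [sa|as'] := leP (s w) a.
        by exists 1%N; split=> //=; rewrite in_itv/= sa andbT lt_neqAle eq_sym sw.
      have [sb|bs] := leP (s w) b; last first.
        by exists 2%N; split=> //=; rewrite in_itv/= bs.
      exists 0%N; split=> /=; first by rewrite in_itv/= as' sb.
      by move=> Aw; apply: nE; split=> //=; rewrite in_itv/= as' sb.
Qed.

End inner_regularity.

(** * Announcing a time whose graph lies in a predictable set *)

Section foretelling.
Context {R : realType} {d : measure_display} {Omega : measurableType d}.
Variable P : probability Omega R.
Variable F : R -> set (set Omega).
Hypothesis hF : usual_conditions P F.
Implicit Types (T : Omega -> \bar R) (K L E : set (R * Omega)).

Lemma stopping_measurable T : stopping_time F T -> measurable_fun setT T.
Proof.
move=> [T0 sT].
apply: (measurability _ (ErealGenOInfty.measurableE R)) => _ [_ [r ->] <-].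
rewrite setTI (_ : _ @^-1` _ = ~` [set w | (T w <= r%:E)%E]); last first.
  apply/seteqP; split=> w /=; rewrite in_itv/= andbT; first by rewrite leNgt => ->.
  by move/negP; rewrite -ltNge.
apply: measurableC; have [r0|r0] := leP 0 r; first exact: (F_meas hF r0 (sT _ r0)).
suff -> : [set w | (T w <= r%:E)%E] = set0 by exact: measurable0.
apply/seteqP; split=> w //= Tr.
by have := le_trans (T0 w) Tr; rewrite lee_fin leNgt r0.
Qed.

Lemma stopping_lt_measurable T (Z : Omega -> R) : stopping_time F T ->
  measurable_fun setT Z -> measurable [set w | (T w < (Z w)%:E)%E].
Proof.
move=> /stopping_measurable mT mZ; rewrite -[mkset _]setTI.
apply: emeasurable_fun_lt => //; exact/measurable_EFinP.
Qed.

Lemma simple_before_measurable L (Z : Omega -> R) : simple F L ->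
  measurable_fun setT Z -> measurable [set w | exists2 u, L (u, w) & u <= Z w].
Proof.
move=> sL mZ; elim: sL => [|r a b B K' r0 ra ab FB _ IH].
  rewrite (_ : mkset _ = set0)//; apply/seteqP; split=> w //= -[u []].
rewrite (_ : mkset _ = (B `&` [set w | a <= Z w]) `|`
    [set w | exists2 u, K' (u, w) & u <= Z w]).
  apply: measurableU => //; apply: measurableI; first exact: (F_meas hF r0 FB).
  by rewrite -[mkset _]setTI; exact: measurable_fun_le.
apply/seteqP; split=> w /=.
  move=> [u [[/= + Bw]|Ku] uZ]; last by right; exists u.
  by rewrite in_itv/= => /andP[au _]; left; split=> //; exact: le_trans au uZ.
move=> [[Bw aZ]|[u Ku uZ]]; last by exists u => //; right.
by exists a => //; left; split=> //=; rewrite in_itv/= lexx.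
Qed.

Lemma simple_ge0 L u w : simple F L -> L (u, w) -> 0 <= u.
Proof.
elim=> // r a b B K' r0 ra ab FB _ IH [[/= + _]|//].
by rewrite in_itv/= => /andP[au _]; rewrite (le_trans r0)// (le_trans (ltW ra)).
Qed.

(** K is the intersection of decreasing simple sets L_j. By compactness of the
sections, if every L_j meets [0, Z] then so does K, which is almost surely
excluded. Hence some L_j meets [0, Z] with probability at most e, and the time
that announces it is before Z - 1 with probability at most e. *)
Lemma kset_foretell K (Z : Omega -> R) e : kset F K -> measurable_fun setT Z ->
  {ae P, forall w u, K (u, w) -> Z w < u} -> 0 < e ->
  exists T, [/\ stopping_time F T, forall u w, K (u, w) -> (T w < u%:E)%E &
    (P [set w | (T w < (Z w - 1)%:E)%E] <= e%:E)%E].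
Proof.
move=> kK mZ + e0; have [L [sL dL ->]] := kset_decreasing hF kK; move=> KZ.
(* G j decreases to a null event *)
pose G j := [set w | exists2 u, L j (u, w) & u <= Z w].
have mG j : measurable (G j) by exact: simple_before_measurable.
have cG : P (G j) @[j --> \oo] --> P (\bigcap_j G j).
  apply: nonincreasing_cvg_mu => //.
  - by rewrite (le_lt_trans (probability_le1 _ _))// ltry.
  - exact: bigcapT_measurable.
  - by move=> i j ij; apply/subsetPset => w [u Lu uZ]; exists u => //; exact: dL Lu.
have G0 : P (\bigcap_j G j) = 0%E.
  apply: measure_negligible; first exact: bigcapT_measurable.
  apply: negligibleS KZ => w Gw /= KZ.
  have /all_sig2[x xL xZ] j := cid2 (Gw j I).
  have [|i j ij u|j|p /andP[_ pZ] pL] :=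
      @compact_nested R (fun j => [set u | L j (u, w)]) x 0 (Z w) _ _ xL.
  - by move=> j; exact: (simple_closed (sL j)).
  - exact: dL.
  - by rewrite xZ (simple_ge0 (sL j) (xL j)).
  by have := KZ p (fun j _ => pL j); rewrite ltNge pZ.
have [n Pn] : exists n, (P (G n) <= e%:E)%E.
  have [n _ h] : \forall n \near \oo, (P (G n) < e%:E)%E.
    have h : nbhs (P (\bigcap_n G n)) [set y | (y < e%:E)%E].
      by rewrite G0; apply: open_ereal_lt'; rewrite lte_fin.
    exact: (cG _ h).
  by exists n; apply/ltW/h => /=.
have [T [sT LT TL]] := simple_foretell hF (sL n).
exists T; split=> //; first by move=> u w /(_ n I) /LT.
apply: le_trans Pn; apply: le_measure; rewrite ?inE//.
  apply: stopping_lt_measurable => //; exact: measurable_funB.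
move=> w /= TZ; have [|u Lu uT] := TL w; first exact: lt_trans TZ (ltry _).
exists u => //; rewrite -lee_fin (le_trans uT)//.
move: TZ; case: (T w) => [t| |] TZ //; last by rewrite leNye.
by move: TZ; rewrite -EFinD lee_fin lte_fin => tZ; lra.
Qed.

(** Compact subsets K_n fill the event that the graph of s meets E, up to a
probability 1/(n+1). The infimum of times announcing the K_n is therefore almost
surely before s on this event, and falls before Z - 1 with probability at most
the sum of the e / 2^(n+1). *)
Lemma foretell (s Z : Omega -> R) E e : measurable_fun setT s ->
  {ae P, forall w, s w != 0} ->
  <<s `[0, +oo[%classic `*` setT, predictable_sets F>> E -> measurable_fun setT Z ->
  {ae P, forall w u, E (u, w) -> Z w < u} -> 0 < e ->
  exists T, [/\ stopping_time F T,
    {ae P, forall w, E (s w, w) -> (T w < (s w)%:E)%E} &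
    (P [set w | (T w < (Z w - 1)%:E)%E] <= e%:E)%E].
Proof.
move=> ms s0 pE mZ EZ e0.
have [mE iE] := predictable_inner hF ms s0 pE.
have e2 i : 0 < e / (2 ^ i.+1)%:R by rewrite divr_gt0// ltr0n expn_gt0.
have n0 (n : nat) : 0 < (n.+1%:R : R)^-1 by rewrite invr_gt0.
have /choice[K KP] n := iE _ (n0 n).
have mK n : measurable (event_at s (K n)).
  by have [kK _ _] := KP n; exact: (event_kset hF).
have kT n : exists T, [/\ stopping_time F T,
    forall u w, K n (u, w) -> (T w < u%:E)%E &
    (P [set w | (T w < (Z w - 1)%:E)%E] <= (e / (2 ^ n.+1)%:R)%:E)%E].
  have [kK KE _] := KP n; apply: kset_foretell => //.
  by apply: filterS EZ => w EZ u /KE; exact: EZ.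
have /choice[T_ TP] := kT.
exists (fun w => ereal_inf (range (T_ ^~ w))); split.
- by apply: (stopping_inf hF) => n; have [] := TP n.
- exists (\bigcap_n (event_at s E `\` event_at s (K n))); split.
  + by apply: bigcapT_measurable => n; exact: measurableD.
  + apply/eqP; rewrite -measure_le0; apply/lee_addgt0Pr => r r0; rewrite add0e.
    apply: (@le_trans _ _ (Num.truncn r^-1).+1%:R^-1%:E).
      have [_ _ h] := KP (Num.truncn r^-1); apply: le_trans h.
      apply: le_measure; rewrite ?inE; last exact: bigcap_inf.
        by apply: bigcapT_measurable => n; exact: measurableD.
      exact: measurableD.
    by rewrite lee_fin invf_ple ?posrE// ltW// truncnS_gt.
  move=> w /= /not_implyP[Ew nT] n _; split=> // Kw; apply: nT.
  apply: (@le_lt_trans _ _ (T_ n w)); first by apply: ereal_inf_lbound; exists n.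
  by have [_ h _] := TP n; exact: h.
- have mT n : measurable [set w | (T_ n w < (Z w - 1)%:E)%E].
    apply: stopping_lt_measurable; first by have [] := TP n.
    exact: measurable_funB.
  apply: (@le_trans _ _ (\sum_(0 <= n <oo) P [set w | (T_ n w < (Z w - 1)%:E)%E])%E).
    apply: measure_sigma_subadditive => //.
      apply: stopping_lt_measurable; last exact: measurable_funB.
      by apply: (stopping_inf hF) => n; have [] := TP n.
    by move=> w /= /ereal_inf_lt[_ [n _ <-]]; exists n.
  apply: le_trans (epsilon_trick0 predT (ltW e0)).
  by apply: lee_nneseries => i //= _; have [] := TP i.
Qed.

End foretelling.

(** * Predictable processes of finite variation are locally bounded *)

Section fv_paths.
Context {R : realType}.
Implicit Types (f : R -> R).

Lemma at_right_ex (Q : R -> Prop) (t : R) : (\forall u \near t^'+, Q u) ->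
  exists2 e, 0 < e & forall u, t < u < t + e -> Q u.
Proof.
move=> /nbhs_ballP[e /= e0 h]; exists e => // u /andP[tu ue]; apply: h => //.
by rewrite /ball/= distrC ger0_norm ?subr_ge0 ?ltW// ltrBlDl.
Qed.

Lemma pos_var_le f x y : x <= y -> pos_var f x <= pos_var f y.
Proof. by apply: (cumulative_is_nondecreasing (pos_var f)). Qed.

Lemma neg_var_le f x y : x <= y -> neg_var f x <= neg_var f y.
Proof. by apply: (cumulative_is_nondecreasing (neg_var f)). Qed.

(** Both parts of the Jordan decomposition are monotone, hence bounded on
[0, c]. *)
Lemma fv_bounded f c : fv_path f -> 0 <= c ->
  exists K : R, forall u, 0 <= u -> u <= c -> `|f u| <= K.
Proof.
move=> fvf c0; exists (`|pos_var f 0| + `|pos_var f c| + `|neg_var f 0| + `|neg_var f c|).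
move=> u u0 uc; rewrite (jordan_decomposition fvf u0).
have p1 := pos_var_le f u0.
have p2 := pos_var_le f uc.
have n1 := neg_var_le f u0.
have n2 := neg_var_le f uc.
have h1 := ler_norm (pos_var f c); have h2 := lerNnormlW (lexx `|pos_var f 0|).
have h3 := ler_norm (neg_var f c); have h4 := lerNnormlW (lexx `|neg_var f 0|).
have g1 := normr_ge0 (pos_var f c); have g2 := normr_ge0 (pos_var f 0).
have g3 := normr_ge0 (neg_var f c); have g4 := normr_ge0 (neg_var f 0).
by rewrite ler_norml; apply/andP; split; lra.
Qed.

(** Each increment is bounded by the sum of the increments of both parts of the
Jordan decomposition, which telescopes. *)
Lemma fv_variation f c : fv_path f -> 0 <= c ->
  exists K : R, forall n (u : nat -> R), (forall i, 0 <= u i) ->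
    (forall i, (i < n)%N -> u i <= u i.+1) -> u n <= c ->
    \sum_(i < n) `|f (u i.+1) - f (u i)| <= K.
Proof.
move=> fvf c0; exists (pos_var f c - pos_var f 0 + (neg_var f c - neg_var f 0)).
move=> n u u0 uu uc.
apply: (@le_trans _ _ (\sum_(i < n) ((pos_var f (u i.+1) + neg_var f (u i.+1))
   - (pos_var f (u i) + neg_var f (u i))))).
  apply: ler_sum => i _.
  rewrite (jordan_decomposition fvf (u0 i)) (jordan_decomposition fvf (u0 i.+1)).
  have p := pos_var_le f (uu i (ltn_ord i)); have q := neg_var_le f (uu i (ltn_ord i)).
  by rewrite ler_norml; apply/andP; split; lra.
rewrite -(big_mkord xpredT (fun i => (pos_var f (u i.+1) + neg_var f (u i.+1))
   - (pos_var f (u i) + neg_var f (u i)))) telescope_sumr//.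
have p1 := pos_var_le f uc; have p2 := pos_var_le f (u0 0%N).
have n1 := neg_var_le f uc; have n2 := neg_var_le f (u0 0%N).
lra.
Qed.

Definition pos_rat (k : nat) : R := if unpickle k is Some q then `|ratr q| else 0.

Lemma pos_rat_ge0 k : 0 <= pos_rat k.
Proof. by rewrite /pos_rat; case: unpickle. Qed.

Lemma pos_rat_dense (a b : R) : 0 <= a -> a < b -> exists k, a < pos_rat k < b.
Proof.
move=> a0 /rat_in_itvoo[q]; rewrite in_itv/= => /andP[aq qb].
by exists (pickle q); rewrite /pos_rat pickleK ger0_norm ?aq// (le_trans a0)// ltW.
Qed.

End fv_paths.

Section first_time.
Context {R : realType} {d : measure_display} {Omega : measurableType d}.
Variable P : probability Omega R.
Variable F : R -> set (set Omega).
Hypothesis hF : usual_conditions P F.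
Variables (q : nat -> R) (B : nat -> set Omega).

(** A debut along countably many dates, so that it is a stopping time by
stopping_inf. *)
Definition first_time w : \bar R := ereal_inf (range (fun k => time_on (q k) (B k) w)).

Lemma stopping_first_time : (forall k, 0 <= q k) -> (forall k, F (q k) (B k)) ->
  stopping_time F first_time.
Proof. by move=> q0 FB; apply: (stopping_inf hF) => k; exact: (stopping_time_on hF). Qed.

Lemma first_time_le w k : B k w -> (first_time w <= (q k)%:E)%E.
Proof. by move=> Bk; apply: ereal_inf_lbound; exists k => //; rewrite /time_on mem_set. Qed.

Lemma first_time_lt w r : (first_time w < r%:E)%E -> exists2 k, q k < r & B k w.
Proof.
move=> /ereal_inf_lt[_ [k _ <-]]; rewrite /time_on.
by case: ifPn; [rewrite inE lte_fin; exists k|rewrite ltNge leey].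
Qed.

End first_time.

Section locally_bounded.
Context {R : realType} {d : measure_display} {Omega : measurableType d}.
Variable P : probability Omega R.
Variable F : R -> set (set Omega).
Hypothesis hF : usual_conditions P F.
Variable A : R -> Omega -> R.
Hypothesis aA : adapted F A.
Hypothesis pA : predictable F A.
Hypothesis fA : finite_variation P A.
Hypothesis A0 : {ae P, forall w, A 0 w = 0}.

Definition exceed (n : nat) : Omega -> \bar R :=
  first_time pos_rat (fun k => [set w | n%:R < `|A (pos_rat k) w|]).

Lemma stopping_exceed n : stopping_time F (exceed n).
Proof.
apply: (stopping_first_time hF) => k; first exact: pos_rat_ge0.
have h := mwrt_comp (@normr_measurable R setT) (aA (pos_rat_ge0 (R := R) k)).
exact: (mwrt_gt n%:R h).
Qed.

(** By right-continuity |A| still exceeds n at rational times shortly after t. *)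
Lemma exceed_le n w t : cadlag_path (A ^~ w) -> 0 <= t -> n%:R < `|A t w| ->
  (exceed n w <= t%:E)%E.
Proof.
move=> [rc _] t0 nA.
have h : \forall u \near t^'+, n%:R < `|A u w|.
  have c : `|A u w| @[u --> t^'+] --> `|A t w| by apply: cvg_norm; exact: rc.
  exact: cvgr_gt c _ nA.
have [e e0 he] := at_right_ex h.
apply/lee_addgt0Pr => e' e'0.
have [|k /andP[tk ke]] := @pos_rat_dense _ t (t + Num.min e e') t0.
  by rewrite ltrDl lt_min e0.
apply: (@le_trans _ _ (pos_rat k)%:E).
  by apply: first_time_le; apply: he; rewrite tk (lt_le_trans ke)// lerD2l ge_min lexx.
by rewrite -EFinD lee_fin (le_trans (ltW ke))// lerD2l ge_min lexx orbT.
Qed.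

(** Otherwise |A| would stay below n shortly after this time, by
right-continuity. *)
Lemma exceed_at n w : cadlag_path (A ^~ w) -> (exceed n w < +oo)%E ->
  n%:R <= `|A (fine (exceed n w)) w|.
Proof.
move=> [rc _] S_oo.
have S0 : (0 <= exceed n w)%E by have [] := stopping_exceed n.
have SE : exceed n w = (fine (exceed n w))%:E by rewrite fineK// ge0_fin_numE.
set r := fine _ in SE *; have r0 : 0 <= r by rewrite -lee_fin -SE.
rewrite leNgt; apply/negP => An.
have h : \forall u \near r^'+, `|A u w| < n%:R.
  have c : `|A u w| @[u --> r^'+] --> `|A r w| by apply: cvg_norm; exact: rc.
  exact: cvgr_lt c _ An.
have [e e0 he] := at_right_ex h.
have [|k ke nA] := @first_time_lt _ _ _ pos_rat
    (fun k => [set w | n%:R < `|A (pos_rat k) w|]) w (r + e).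
  by rewrite -/(exceed n) SE lte_fin ltrDl.
have : (exceed n w <= (pos_rat k)%:E)%E.
  exact: (@first_time_le _ _ _ pos_rat (fun k => [set w | n%:R < `|A (pos_rat k) w|]) _ k).
rewrite SE lee_fin le_eqVlt => /orP[/eqP rE|rk]; first by move: nA; rewrite /= -rE ltNge ltW.
by have := he (pos_rat k); rewrite rk ke => /(_ isT); rewrite ltNge ltW.
Qed.

Lemma exceed_cvg w : fv_path (A ^~ w) -> exceed n w @[n --> \oo] --> +oo%E.
Proof.
move=> fv; apply/cvgeyPge => c.
have [K Kc] := fv_bounded fv (normr_ge0 c).
exists (Num.truncn K).+1 => // n /= Kn; rewrite leNgt; apply/negP => /first_time_lt[k kc] /=.
rewrite ltNge => /negP; apply; apply: le_trans (Kc _ (pos_rat_ge0 k) _) _.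
  by rewrite (le_trans (ltW kc))// ler_norm.
by apply: ltW; apply: lt_le_trans (truncnS_gt K) _; rewrite ler_nat.
Qed.

Let Z n w : R := tmin n%:R (exceed n) w - 1.

Let mZ n : measurable_fun setT (Z n).
Proof.
apply: measurable_funB => //; apply: measurableT_comp => //.
apply: measurable_mine => //; exact: (stopping_measurable hF (stopping_exceed n)).
Qed.

(** The graph of exceed n.+1 lies in the predictable set {|A| >= n + 1}, so that
this time can be announced; as this set lies after exceed n, the announcing
time can be taken not much smaller than exceed n. *)
Let foretell_exceed n : exists T, [/\ stopping_time F T,
    {ae P, forall w, (exceed n.+1 w < +oo)%E -> (T w < exceed n.+1 w)%E} &
    (P [set w | (T w < (Z n w - 1)%:E)%E] <= (1 / (2 ^ n.+1)%:R)%:E)%E].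
Proof.
(* the value -1 keeps the graph out of E where S is infinite *)
pose S := exceed n.+1; pose s w : R := if (S w < +oo)%E then fine (S w) else -1.
pose E := (`[0, +oo[%classic `*` setT) `&` [set z : R * Omega | n.+1%:R <= `|A z.1 z.2|].
have S0 w : (0 <= S w)%E by have [] := stopping_exceed n.+1.
have mS := stopping_measurable hF (stopping_exceed n.+1).
have ms : measurable_fun setT s.
  apply: measurable_fun_ifT => //.
  - by apply: measurable_fun_lte => //; exact: measurable_cst.
  - by apply: measurableT_comp.
have sE w : (S w < +oo)%E -> (s w)%:E = S w.
  by move=> h; rewrite /s h fineK// ge0_fin_numE.
have s0 : {ae P, forall w, s w != 0}.
  move: A0 fA; apply: filterS2 => w A0w fw; apply/eqP => sw.
  have Soo : (S w < +oo)%E.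
    by move: sw; rewrite /s; case: ifP => // _ /eqP; rewrite oppr_eq0 oner_eq0.
  have := exceed_at fw.1 Soo; rewrite -/S (_ : fine (S w) = 0) ?A0w ?normr0.
    by rewrite leNgt ltr0Sn.
  by apply: EFin_inj; rewrite fineK ?ge0_fin_numE// -sE// sw.
have pE : <<s `[0, +oo[%classic `*` setT, predictable_sets F>> E.
  apply: (pA (B := [set x | n.+1%:R <= `|x|])).
  rewrite -[mkset _]setTI; apply: measurable_fun_le => //; exact: normr_measurable.
have EZ : {ae P, forall w u, E (u, w) -> Z n w < u}.
  apply: filterS fA => w fw u [[/= + _] nA]; rewrite in_itv/= andbT => u0.
  have /(exceed_le fw.1 u0) Su : n%:R < `|A u w|.
    by apply: lt_le_trans nA; rewrite ltr_nat.
  have e0 : (0 <= exceed n w)%E by have [] := stopping_exceed n.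
  have : tmin n%:R (exceed n) w <= u by rewrite -lee_fin (le_trans (tmin_leT _ e0)).
  by rewrite /Z => h; lra.
have e0 : (0 : R) < 1 / (2 ^ n.+1)%:R by rewrite divr_gt0// ltr0n expn_gt0.
have [T [sT TS PT]] := foretell hF ms s0 pE (mZ n) EZ e0.
exists T; split=> //; move: TS fA; apply: filterS2 => w + fw Soo.
rewrite -/S -sE//; apply; split=> /=.
  by split=> //=; rewrite in_itv/= andbT -lee_fin sE.
by have := exceed_at fw.1 Soo; rewrite /s Soo.
Qed.

(** At the time exceed n itself |A| may be arbitrarily large because of a jump;
up to the time announcing exceed n.+1 it is at most n + 1. By Borel-Cantelli the
announcing times tend to infinity; their infima over the indices k >= n are
nondecreasing in n. *)
Lemma predictable_locally_bounded : exists T : nat -> Omega -> \bar R,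
  localizing_sequence P F T /\
  forall n, {ae P, forall w u, 0 <= u -> (u%:E <= T n w)%E -> `|A u w| <= n.+1%:R}.
Proof.
have /choice[T_ TP] := foretell_exceed.
(* the infimum over the indices that are at least n *)
pose T n w := ereal_inf (range (fun k => T_ (n + k)%N w)).
have TT n k w : (n <= k)%N -> (T n w <= T_ k w)%E.
  by move=> nk; apply: ereal_inf_lbound; exists (k - n)%N => //; rewrite subnKC.
exists T; split.
  split.
  - by move=> n; apply: (stopping_inf hF) => k; have [] := TP (n + k)%N.
  - apply: aeW => w; apply/nondecreasing_seqP => n.
    apply: ereal_inf_le_tmp => _ [k _ <-]; exists k.+1 => //.
    by rewrite addSnnS.
  - pose G n := [set w | (T_ n w < (Z n w - 1)%:E)%E].
    have mG n : measurable (G n).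
      apply: (stopping_lt_measurable hF); first by have [] := TP n.
      exact: measurable_funB.
    have BC : P (lim_sup_set G) = 0%E.
      apply: lim_sup_set_cvg0 => //.
      apply: (@le_lt_trans _ _ 1%:E); last exact: ltry.
      apply: le_trans (epsilon_trick0 predT ler01).
      by apply: lee_nneseries => i //= _; have [] := TP i.
    have nBC : {ae P, forall w, ~ lim_sup_set G w}.
      exists (lim_sup_set G); split=> //; last by move=> w /= /contrapT.
      apply: bigcapT_measurable => n; apply: bigcup_measurable => k _; exact: mG.
    move: nBC fA; apply: filterS2 => w + fw.
    move=> /existsNP[N /not_implyP[_ nG]].
    apply/cvgeyPge => c.
    have /cvgeyPge/(_ (c + 2))[N' _ hN'] := exceed_cvg fw.
    exists (maxn N (maxn N' (Num.truncn (c + 2)).+1)) => // n /=.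
    rewrite !geq_max => /and3P[Nn N'n cn].
    apply: le_ereal_inf_tmp => _ [k _ <-].
    have nk := leq_addr k n.
    have : ~ G (n + k)%N w by move=> Gw; apply: nG; exists (n + k)%N => //=; exact: leq_trans nk.
    move=> /negP; rewrite -leNgt; apply: le_trans; rewrite lee_fin /Z.
    have e0 : (0 <= exceed (n + k) w)%E by have [] := stopping_exceed (n + k).
    suff : c + 2 <= tmin (n + k)%:R (exceed (n + k)) w by move=> h; lra.
    rewrite le_tmin//; apply/andP; split; last first.
      by apply: hN'; exact: leq_trans N'n nk.
    apply: ltW; apply: lt_le_trans (truncnS_gt (c + 2)) _.
    by rewrite ler_nat (leq_trans cn).
move=> n; have [_ h _] := TP n; move: h fA; apply: filterS2 => w TS fw u u0 uT.
rewrite leNgt; apply/negP => /(exceed_le fw.1 u0) Su.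
have := TS (le_lt_trans Su (ltry _)); rewrite ltNge (le_trans Su)//.
by rewrite (le_trans uT)// TT.
Qed.

End locally_bounded.

(** * Localizing the variation *)

Section grid_variation.
Context {R : realType}.
Variables (a : R -> R) (c n s r : R) (m : nat).
Hypotheses (s0 : 0 <= s) (sr : s <= r) (n0 : 0 <= n).
Hypothesis ac : forall u, 0 <= u -> u <= r -> `|a u| <= c.
Let x (i : nat) : R := i%:R / m.+1%:R.
Hypothesis va : forall k, x k < r -> \sum_(i < k) `|a (x i.+1) - a (x i)| <= n.

Let xx i : x i <= x i.+1.
Proof. by rewrite /x ler_pM2r ?invr_gt0// ler_nat. Qed.

Let inside K : \sum_(i < K) (x i.+1 < r)%R%:R * `|a (x i.+1) - a (x i)| <= n.
Proof.
elim: K => [|K IH]; first by rewrite big_ord0.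
have [h|h] := ltP (x K.+1) r; last by rewrite big_ord_recr/= ltNge h/= mul0r addr0.
apply: le_trans (va h); apply: ler_sum => i _.
by case: (_ < _); rewrite ?mul1r// mul0r.
Qed.

(** At most one cell contains a given boundary point. *)
Let boundary (b : nat -> bool) K :
  \sum_(i < K) ((b i)%:R - (b i.+1)%:R : R) <= 1.
Proof.
have -> : \sum_(i < K) ((b i)%:R - (b i.+1)%:R : R) = (b 0%N)%:R - (b K)%:R.
  elim: K => [|K IH]; first by rewrite big_ord0 subrr.
  by rewrite big_ord_recr/= IH; ring.
by case: (b 0%N); case: (b K); rewrite ?subr0 ?subrr ?sub0r//= lerN10.
Qed.

(** Clamping to [s, r] alters only the cell that contains s and the one that
contains r; each of these increments is at most 2 * c. *)
Lemma grid_variation K :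
  \sum_(i < K) `|a (grid s r m i.+1) - a (grid s r m i)| <= n + 4 * c.
Proof.
have c0 : 0 <= c by apply: le_trans (ac (le_refl 0) (le_trans s0 sr)).
apply: (@le_trans _ _ (\sum_(i < K) ((x i.+1 < r)%R%:R * `|a (x i.+1) - a (x i)| +
    (2 * c * ((x i <= s)%R%:R - (x i.+1 <= s)%R%:R) +
     2 * c * ((x i < r)%R%:R - (x i.+1 < r)%R%:R))))); last first.
  rewrite big_split lerD ?inside//= big_split/= -!mulr_sumr.
  have b1 := boundary (fun i => x i <= s) K.
  have b2 := boundary (fun i => x i < r) K.
  have -> : 4 * c = 2 * c * 1 + 2 * c * 1 by ring.
  by rewrite lerD// ler_wpM2l// mulr_ge0.
apply: ler_sum => i _.
have ga j : 0 <= grid s r m j by rewrite (le_trans s0)// grid_ge.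
have gr j : grid s r m j <= r by exact: grid_le.
have := ler_normB (a (grid s r m i.+1)) (a (grid s r m i)).
have g1 := ac (ga i.+1) (gr i.+1); have g0 := ac (ga i) (gr i).
move=> /le_trans /(_ (lerD g1 g0)).
rewrite /grid -!/(x _); have x01 := xx i; move: (x i) (x i.+1) x01 => x0 x1 x01.
have v0 := normr_ge0 (a x1 - a x0).
have [x1s|sx1] := leP x1 s.
  have x0s := le_trans x01 x1s.
  rewrite !max_r// subrr normr0 x0s => _.
  have [x1r|rx1] := ltP x1 r; first by rewrite (le_lt_trans x01 x1r)/=; lra.
  by case: (x0 < r) => /=; lra.
have [x0r|rx0] := ltP x0 r; last first.
  have rx1 := le_trans rx0 x01.
  rewrite !min_r ?le_max ?rx0 ?rx1// subrr normr0 ltNge rx1 => _.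
  by case: (x0 <= s) => /=; lra.
have [x1r|rx1] := ltP x1 r; last by case: (x0 <= s) => /=; lra.
have [x0s|sx0] := leP x0 s; first by move=> h /=; lra.
rewrite (min_l (ltW x0r))/= => _; lra.
Qed.

End grid_variation.

Section bounded_variation_times.
Context {R : realType} {d : measure_display} {Omega : measurableType d}.
Variable P : probability Omega R.
Variable F : R -> set (set Omega).
Hypothesis hF : usual_conditions P F.
Variable A : R -> Omega -> R.
Hypothesis aA : adapted F A.
Hypothesis fA : finite_variation P A.

Let x (m i : nat) : R := i%:R / m.+1%:R.

Let x0 m i : 0 <= x m i. Proof. by rewrite divr_ge0. Qed.

Let le_x m i j : (i <= j)%N -> x m i <= x m j.
Proof. by move=> ij; rewrite /x ler_pM2r ?invr_gt0// ler_nat. Qed.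

Let sum_var m k w : R := \sum_(i < k) `|A (x m i.+1) w - A (x m i) w|.

Let end_time (j : nat) : R := if unpickle j is Some (m, k) then x m k else 0.

Let large (n j : nat) : set Omega :=
  if unpickle j is Some (m, k) then [set w | n%:R < sum_var m k w] else set0.

(** The pairs (m, k) are countably many, so that the first end k/(m+1) of a sum
exceeding n is a stopping time. *)
Lemma variation_times : exists T : nat -> Omega -> \bar R,
  localizing_sequence P F T /\
  forall n w m k, ((x m k)%:E < T n w)%E -> sum_var m k w <= n%:R.
Proof.
pose T n := first_time end_time (large n).
exists T; split; last first.
  move=> n w m k; rewrite ltNge => /negP xT; rewrite leNgt; apply/negP => nv; apply: xT.
  have -> : x m k = end_time (pickle (m, k)) by rewrite /end_time pickleK.
  by apply: first_time_le; rewrite /large pickleK.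
split.
- move=> n; apply: (stopping_first_time hF) => j.
    by rewrite /end_time; case: unpickle => [[m k]|].
  rewrite /end_time /large; case: unpickle => [[m k]|]; last exact: (sG0 (F_sigma hF (lexx 0))).
  apply: mwrt_gt; rewrite /sum_var.
  apply: (@mwrt_sum _ _ _ _ (F_sigma hF (x0 m k)) k
    (fun i w => `|A (x m i.+1) w - A (x m i) w|)) => i ik.
  apply: mwrt_comp; first exact: normr_measurable.
  apply: (mwrtB (F_sigma hF (x0 m k))).
    exact: (mwrt_mono hF (x0 m i.+1) (le_x m ik) (aA (x0 m i.+1))).
  exact: (mwrt_mono hF (x0 m i) (le_x m (ltnW ik)) (aA (x0 m i))).
- apply: aeW => w; apply/nondecreasing_seqP => n.
  rewrite leNgt; apply/negP => h.
  have Tf : exists r, (T n.+1 w < r%:E <= T n w)%E.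
    have : (0 <= T n.+1 w)%E.
      apply: le_ereal_inf_tmp => _ [j _ <-]; rewrite /time_on.
      case: ifP => _; last by rewrite leey.
      by rewrite lee_fin /end_time; case: unpickle => [[m k]|].
    move: h; case: (T n.+1 w) => [r| |]//; case: (T n w) => [r'| |]// h _.
      by exists r'; rewrite h lexx.
    by exists (r + 1); rewrite lte_fin ltrDl ltr01 leey.
  have [r /andP[/first_time_lt[j jr lj] rT]] := Tf.
  suff : (T n w <= (end_time j)%:E)%E.
    by move=> /(le_trans rT); rewrite lee_fin leNgt jr.
  apply: first_time_le; move: lj; rewrite /large; case: unpickle => [[m k]|]//=.
  by apply: lt_trans; rewrite ltr_nat.
- apply: filterS fA => w fw; apply/cvgeyPge => c.
  have [K hK] := fv_variation fw (normr_ge0 c).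
  exists (Num.truncn K).+1 => // n /= Kn; rewrite leNgt; apply/negP => /first_time_lt[j].
  rewrite /end_time /large; case: unpickle => [[m k]|]//= xc nv.
  have := hK k (x m) (x0 m) (fun i _ => le_x m (leqnSn i)) (le_trans (ltW xc) (ler_norm c)).
  rewrite leNgt => /negP; apply; apply: le_lt_trans nv.
  by apply: ltW; apply: lt_le_trans (truncnS_gt K) _; rewrite ler_nat.
Qed.

End bounded_variation_times.

(** * Smooth convex approximations of the positive part, cadlag paths, stopping *)

Section smoothing.
Context {R : realType}.
Implicit Types (e x y z : R).

Lemma lipschitz1_continuous (h : R -> R) :
  (forall y z, `|h y - h z| <= `|y - z|) -> continuous h.
Proof. by move=> hl y; apply: (cvg_lipschitz1 hl); exact: cvg_id. Qed.

Lemma max0_lipschitz y z : `|Num.max y 0 - Num.max z 0| <= `|y - z|.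
Proof.
have h := min_lipschitz1 0 (- y) (- z).
rewrite -[X in X - _]opprK -[X in _ - X]opprK !oppr_max oppr0 -opprD normrN.
by apply: le_trans h _; rewrite -opprD normrN.
Qed.

(** With p the positive part of x, p^2 / (p + e) is convex, of class C^1 with a
slope that vanishes for x <= 0, and within e of p. *)
Definition smooth_pos e x : R := let p := Num.max x 0 in p ^+ 2 / (p + e).

Definition slope_pos e x : R := 1 - (e / (Num.max x 0 + e)) ^+ 2.

Let pe e x : 0 < e -> 0 < Num.max x 0 + e.
Proof. by move=> e0; rewrite ltr_wpDl// le_max lexx orbT. Qed.

Let ratio e x : 0 < e -> 0 <= e / (Num.max x 0 + e) <= 1.
Proof.
move=> e0; have h := pe x e0; rewrite ler_pdivrMr// mul1r lerDr le_max lexx orbT.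
by rewrite divr_ge0// ltW.
Qed.

Lemma slope_pos_ge0 e x : 0 < e -> 0 <= slope_pos e x.
Proof. by move=> e0; have /andP[h0 h1] := ratio x e0; rewrite subr_ge0 expr_le1. Qed.

Lemma slope_pos_le1 e x : 0 < e -> `|slope_pos e x| <= 1.
Proof.
move=> e0; rewrite ger0_norm ?slope_pos_ge0// /slope_pos gerBl.
exact: sqr_ge0.
Qed.

Lemma slope_pos_0 e x : 0 < e -> x <= 0 -> slope_pos e x = 0.
Proof. by move=> e0 x0; rewrite /slope_pos max_r// add0r divff ?gt_eqF// expr1n subrr. Qed.

Lemma slope_pos_continuous e : 0 < e -> continuous (slope_pos e).
Proof.
move=> e0 x; rewrite /slope_pos.
have c : e / (Num.max y 0 + e) @[y --> x] --> e / (Num.max x 0 + e).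
  apply: cvgM; first exact: cvg_cst.
  apply: cvgV; first by rewrite gt_eqF// pe.
  apply: cvgD; last exact: cvg_cst.
  exact: (lipschitz1_continuous max0_lipschitz).
by apply: cvgB; [exact: cvg_cst|exact: (cvgM c c)].
Qed.

Lemma smooth_pos_convex e y z : 0 < e ->
  slope_pos e y * (z - y) <= smooth_pos e z - smooth_pos e y.
Proof.
move=> e0; pose p := Num.max y 0; pose q := Num.max z 0.
have p0 : 0 <= p by rewrite le_max lexx orbT.
have q0 : 0 <= q by rewrite le_max lexx orbT.
apply: (@le_trans _ _ (slope_pos e y * (q - p))).
  have [y0|y0] := leP y 0; first by rewrite slope_pos_0// !mul0r.
  rewrite ler_wpM2l ?slope_pos_ge0// /p (max_l (ltW y0)) lerD2r.
  by rewrite le_max lexx.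
have pe0 : p + e != 0 by rewrite gt_eqF// ltr_wpDl.
have qe0 : q + e != 0 by rewrite gt_eqF// ltr_wpDl.
rewrite -subr_ge0 /slope_pos /smooth_pos -/p -/q.
(* the gap in the subgradient inequality is a square over a positive number *)
have -> : q ^+ 2 / (q + e) - p ^+ 2 / (p + e) - (1 - (e / (p + e)) ^+ 2) * (q - p) =
  (e * (q - p) / (p + e)) ^+ 2 / (q + e) by field; rewrite pe0 qe0.
by rewrite divr_ge0 ?sqr_ge0// addr_ge0// ltW.
Qed.

Lemma smooth_pos_approx e x : 0 < e ->
  smooth_pos e x <= Num.max x 0 <= smooth_pos e x + e.
Proof.
move=> e0; rewrite /smooth_pos; have := pe x e0.
have : 0 <= Num.max x 0 by rewrite le_max lexx orbT.
move: (Num.max x 0) => p p0 pe0; apply/andP; split.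
  by rewrite ler_pdivrMr// expr2 ler_wpM2l// lerDl ltW.
by rewrite -lerBlDr ler_pdivlMr// expr2; nra.
Qed.

End smoothing.

Section path_tools.
Context {R : realType}.
Implicit Types (x y : R -> R).

Lemma cadlag_path_ext x y : (forall t, 0 <= t -> x t = y t) ->
  cadlag_path y -> cadlag_path x.
Proof.
move=> xy [rc ll]; split=> t t0.
  rewrite xy//; apply: cvg_trans (rc t t0); apply: near_eq_cvg; near=> u.
  by rewrite xy// (le_trans t0)//; near: u; exact: nbhs_right_ge.
apply/cvg_ex; have /cvg_ex[l yl] := ll t t0; exists l.
apply: cvg_trans yl; apply: near_eq_cvg; near=> u.
by rewrite xy//; near: u; exact: nbhs_left_ge.
Unshelve. all: by end_near. Qed.

Lemma cadlag_pathD x y : cadlag_path x -> cadlag_path y ->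
  cadlag_path (fun t => x t + y t).
Proof.
move=> [rx lx] [ry ly]; split=> t t0; first by apply: cvgD; [exact: rx|exact: ry].
by apply: is_cvgD; [exact: lx|exact: ly].
Qed.

Lemma cadlag_path_comp (h : R -> R) x : continuous h -> cadlag_path x ->
  cadlag_path (fun t => h (x t)).
Proof.
move=> ch [rx lx]; split=> t t0; first by apply: continuous_cvg; [exact: ch|exact: rx].
by apply/cvg_ex; exists (h (lim (x s @[s --> t^'-]))); apply: continuous_cvg; [exact: ch|exact: lx].
Qed.

End path_tools.

Section stopped_processes.
Context {R : realType} {d : measure_display} {Omega : measurableType d}.
Variable P : probability Omega R.
Variable F : R -> set (set Omega).
Hypothesis hF : usual_conditions P F.
Implicit Types (T : Omega -> \bar R).

Lemma tmin_l t T w : (t%:E <= T w)%E -> tmin t T w = t.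
Proof. by move=> tT; rewrite /tmin min_l. Qed.

Lemma tmin_r t T w : (T w <= t%:E)%E -> tmin t T w = fine (T w).
Proof. by move=> tT; rewrite /tmin min_r. Qed.

Lemma stopped_right_continuous (x : R -> R) T w t : (0 <= T w)%E -> 0 <= t ->
  (forall u, 0 <= u -> x v @[v --> u^'+] --> x u) ->
  x (tmin v T w) @[v --> t^'+] --> x (tmin t T w).
Proof.
move=> T0 t0 rx; have [tT|Tt] := ltP t%:E (T w).
  have near_T : \forall v \near t^'+, (v%:E <= T w)%E.
    move: tT; case: (T w) => [r| |]// tr; last by apply: nearW => v; rewrite leey.
    by near=> v; rewrite lee_fin; near: v; exact: nbhs_right_le.
  rewrite tmin_l ?ltW//; apply: cvg_trans (rx t t0); apply: near_eq_cvg.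
  by apply: filterS near_T => v vT; rewrite tmin_l.
rewrite (tmin_r Tt).
apply: (@cvg_trans _ ((fun=> x (fine (T w))) @ t^'+)); last exact: cvg_cst.
apply: near_eq_cvg; near=> v; rewrite tmin_r// (le_trans Tt)// lee_fin.
by near: v; exact: nbhs_right_ge.
Unshelve. all: by end_near. Qed.

Lemma localizing_min (T1 T2 : nat -> Omega -> \bar R) :
  localizing_sequence P F T1 -> localizing_sequence P F T2 ->
  localizing_sequence P F (fun n w => Order.min (T1 n w) (T2 n w)).
Proof.
move=> [s1 n1 c1] [s2 n2 c2]; split.
- by move=> n; exact: (stopping_min hF).
- move: n1 n2; apply: filterS2 => w h1 h2 i j ij.
  by rewrite le_min !ge_min h1// h2// orbT.
- move: c1 c2; apply: filterS2 => w /cvgeyPge h1 /cvgeyPge h2.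
  apply/cvgeyPge => c; apply: filterS2 (h1 c) (h2 c) => n g1 g2.
  by rewrite le_min g1.
Qed.

End stopped_processes.

(** * Local submartingales *)

Section local_submartingale.
Context {R : realType} {d : measure_display} {Omega : measurableType d}.
Variable P : probability Omega R.
Variable F : R -> set (set Omega).
Hypothesis hF : usual_conditions P F.
Variables (X M A C V : R -> Omega -> R).
Hypothesis hX : class_Sigma_g P F X M A.
Hypothesis hA : CV_decomposition P F X A C V.
(** phi will be the positive or the negative part; f e are convex functions of
slope g e that approach it from below as e tends to 0. *)
Variables (phi : R -> R) (f g : R -> R -> R).
Hypothesis phi_lip : forall y z, `|phi y - phi z| <= `|y - z|.
Hypothesis phi0 : phi 0 = 0.
Hypothesis fg : forall e, 0 < e -> forall y z, g e y * (z - y) <= f e z - f e y.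
Hypothesis g1 : forall e, 0 < e -> forall y, `|g e y| <= 1.
Hypothesis cg : forall e, 0 < e -> continuous (g e).
Hypothesis g0 : forall e, 0 < e -> g e 0 = 0.
Hypothesis sg : forall e, 0 < e -> (forall y, 0 <= g e y) \/ (forall y, g e y <= 0).
Hypothesis f_phi : forall e, 0 < e -> forall y, f e y <= phi y <= f e y + e.
Hypothesis jumpC : {ae P, forall w e u, 0 < e -> 0 < u ->
  0 <= g e (left_lim (X ^~ w) u) * jump (C ^~ w) u}.

Let aM : adapted F M. Proof. by case: hX => _ [[aM _ _] _] _ _ _. Qed.
Let aA : adapted F A. Proof. by case: hX => _ _ [aA _ _] _ _. Qed.
Let XMA : {ae P, forall w t, 0 <= t -> X t w = M t w + A t w}.
Proof. by case: hX. Qed.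
Let cM : cadlag P M. Proof. by case: hX => _ [[_ cM _] _] _ _ _. Qed.
Let fA : finite_variation P A. Proof. by case: hX => _ _ [_ _ fA] _ _. Qed.

Let aX : adapted F X.
Proof.
move=> t t0; apply: (mwrt_ae_eq (F_sigma hF t0) _ (mwrtD (F_sigma hF t0) (aM t0) (aA t0))).
  by move=> N; exact: (F_null hF t0).
by apply: filterS XMA => w; exact.
Qed.

Let cX : cadlag P X.
Proof.
move: XMA cM fA; apply: filterS3 => w xe cm fw.
by apply: (cadlag_path_ext xe); exact: cadlag_pathD cm fw.1.
Qed.

Let rc (Y : R -> Omega -> R) : cadlag P Y ->
  {ae P, forall w, forall u, 0 <= u -> Y v w @[v --> u^'+] --> Y u w}.
Proof. by apply: filterS => w []. Qed.

Let rcA : {ae P, forall w, forall u, 0 <= u -> A v w @[v --> u^'+] --> A u w}.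
Proof. by apply: filterS fA => w [[]]. Qed.

Let phi_cont : continuous phi. Proof. exact: lipschitz1_continuous. Qed.

Let phi_measurable : measurable_fun setT phi.
Proof. exact: continuous_measurable_fun. Qed.

Let f_measurable e : 0 < e -> measurable_fun setT (f e).
Proof.
move=> e0; apply: continuous_measurable_fun; apply: lipschitz1_continuous => y z.
exact: (subgradient_lipschitz y z (fg e0) (g1 e0)).
Qed.

Let phi_norm y : `|phi y| <= `|y|.
Proof. by have := phi_lip y 0; rewrite phi0 !subr0. Qed.

Section one_time.
Variables (T : Omega -> \bar R) (N : R -> Omega -> R) (c : R).
Hypothesis sT : stopping_time F T.
Hypothesis mN : martingale P F N.
Hypothesis rcN : \forall w \ae P, forall u, 0 <= u -> N v w @[v --> u^'+] --> N u w.
Hypothesis XE : \forall w \ae P,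
  forall u, 0 <= u -> (u%:E <= T w)%E -> X u w = N u w + A u w.
Hypothesis A_bounded : \forall w \ae P,
  forall u, 0 <= u -> (u%:E <= T w)%E -> `|A u w| <= c.
Hypothesis A_variation : \forall w \ae P, forall s r m K, 0 <= s -> s <= r ->
  (r%:E <= T w)%E ->
  \sum_(i < K) `|A (grid s r m i.+1) w - A (grid s r m i) w| <= c.

Let T0 w : (0 <= T w)%E. Proof. by case: sT. Qed.

Let drift_bounded e s t : 0 < e -> 0 <= s -> s <= t ->
  \forall w \ae P, (s%:E < T w)%E -> forall m, `|drift_sum A X T (g e) s t m w| <= c.
Proof.
move=> e0 s0 st; apply: filterS A_variation => w h sT' m.
apply: (le_trans (ler_norm_sum _ _ _)).
apply: le_trans (h s (tmin t T w) m (gsize t m) s0 _ (tmin_leT _ (T0 w))).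
  by apply: ler_sum => i _; rewrite normrM ler_piMl// g1.
by rewrite le_tmin// st ltW.
Qed.

Let drift_liminf e s t : 0 < e -> 0 <= s -> s <= t ->
  \forall w \ae P, (s%:E < T w)%E ->
  Num.min (drift_sum A X T (g e) s t m w) 0 @[m --> \oo] --> (0 : R).
Proof.
move=> e0 s0 st; case: hA => AE [_ fC] [_ fV] C0 V0.
apply: filterS2 (filterI AE (filterI fC fV)) (filterI (filterI C0 V0) (filterI cX jumpC)).
move=> w [Aw [fc fv]] [[c0 v0] [cx jc]] sTw.
have sr : s <= tmin t T w by rewrite le_tmin// st ltW.
have -> : (fun m => Num.min (drift_sum A X T (g e) s t m w) 0) =
  (fun m => Num.min (\sum_(i < gsize t m) g e (X (grid s (tmin t T w) m i) w) *
    ((C (grid s (tmin t T w) m i.+1) w + V (grid s (tmin t T w) m i.+1) w) -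
     (C (grid s (tmin t T w) m i) w + V (grid s (tmin t T w) m i) w))) 0).
  apply/funext => m; congr Num.min; apply: eq_bigr => i _.
  by rewrite !Aw// (le_trans s0)// grid_ge.
have tK m : tmin t T w <= (gsize t m)%:R / m.+1%:R.
  exact: le_trans (tmin_le _ (T0 w)) (gsize_end _ _).
exact: (riemann_liminf_ge0 cx fc fv s0 sr tK c0 v0 (cg e0) (g0 e0) (g1 e0) (sg e0)
  (fun u => jc e u e0)).
Qed.

Let after s : set Omega := [set w | (s%:E < T w)%E].

Let integ_X s t B : 0 <= s -> s <= t -> F s B -> B `<=` after s ->
  integ P (fun w => \1_B w * X (tmin t T w) w).
Proof.
move=> s0 st; exact: (integ_X_tau hF mN rcN aA rcA sT XE s0 st A_bounded).
Qed.

Let mX t : 0 <= t -> measurable_wrt (F t) (fun w => X (tmin t T w) w).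
Proof. by move=> t0; apply: (adapted_stopped hF aX sT t0); exact: rc cX. Qed.

Let integ_h (h : R -> R) e s t B : measurable_fun setT h ->
  (forall y, `|h y| <= `|y| + e) -> 0 <= s -> s <= t -> F s B -> B `<=` after s ->
  integ P (fun w => \1_B w * h (X (tmin t T w) w)).
Proof.
move=> mh he s0 st FB BT; have t0 := le_trans s0 st; have mB := F_meas hF s0 FB.
have i1 := integ_indic mB (integ_cst P e).
apply: (integ_le_ae _ (integD (integ_norm (integ_X s0 st FB BT)) i1)).
  apply: measurable_funM; first exact: measurable_indic.
  apply: measurableT_comp => //; exact: (mwrt_measurable (F_meas hF t0) (mX t0)).
apply: aeW => w; rewrite indicE; case: (w \in B); last by rewrite !mul0r normr0 addr0.
by rewrite !mul1r.
Qed.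

(** The inequality holds for f e by tanaka_le, and phi is within e of f e. *)
Let phi_le s t B : 0 <= s -> s <= t -> F s B -> B `<=` after s ->
  Rintegral P setT (fun w => \1_B w * phi (X s w)) <=
  Rintegral P setT (fun w => \1_B w * phi (X (tmin t T w) w)).
Proof.
move=> s0 st FB BT; have mB := F_meas hF s0 FB.
have at_s (h : R -> R) w : \1_B w * h (X (tmin s T w) w) = \1_B w * h (X s w).
  rewrite indicE; have [|_] := boolP (w \in B); last by rewrite !mul0r.
  by rewrite inE => /BT /ltW sTw; rewrite tmin_l.
have phi_e e : 0 < e -> forall y, `|phi y| <= `|y| + e.
  by move=> e0 y; rewrite (le_trans (phi_norm y))// lerDl ltW.
have f_e e : 0 < e -> forall y, `|f e y| <= `|y| + e.
  move=> e0 y; have /andP[h1 h2] := f_phi e0 y; have := phi_norm y.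
  by rewrite !ler_norml => /andP[h3 h4]; apply/andP; split; lra.
apply/ler_addgt0Pr => e e0.
have ip t' : s <= t' -> integ P (fun w => \1_B w * phi (X (tmin t' T w) w)).
  by move=> st'; exact: (integ_h phi_measurable (phi_e _ e0) s0 st').
have if_ t' : s <= t' -> integ P (fun w => \1_B w * f e (X (tmin t' T w) w)).
  by move=> st'; exact: (integ_h (f_measurable e0) (f_e _ e0) s0 st').
have ips : integ P (fun w => \1_B w * phi (X s w)).
  by have := ip s (lexx s); under eq_fun do rewrite at_s.
have ifs : integ P (fun w => \1_B w * f e (X s w)).
  by have := if_ s (lexx s); under eq_fun do rewrite at_s.
have tl := tanaka_le hF mN rcN aA rcA aX sT XE (fg e0) (g1 e0)
  (continuous_measurable_fun (cg e0)) s0 st A_bounded (drift_bounded e0 s0 st)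
  (drift_liminf e0 s0 st) FB BT.
apply: (@le_trans _ _ (Rintegral P setT (fun w => \1_B w * f e (X s w) + e))).
  apply: E_le_ae => //; first exact: integD ifs (integ_cst P e).
  apply: aeW => w; rewrite indicE; have /andP[_ h] := f_phi e0 (X s w).
  by case: (w \in B); rewrite ?mul1r// !mul0r add0r ltW.
rewrite (E_D ifs (integ_cst P e)) E_cst lerD2r (le_trans tl)//.
apply: E_le_ae => //; [exact: if_|exact: ip|].
apply: aeW => w; rewrite indicE; have /andP[h _] := f_phi e0 (X (tmin t T w) w).
by case: (w \in B); rewrite ?mul1r// !mul0r.
Qed.

Let Y t w := phi (X t w).

Let FT s : 0 <= s -> F s (after s).
Proof. exact: (stopping_lt hF sT). Qed.

Let stoppedE t w : stopped T Y t w = \1_(after 0) w * phi (X (tmin t T w) w).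
Proof.
rewrite /stopped /tmin indicE; case: ifPn => h; first by rewrite mem_set// mul1r.
by rewrite memNset ?mul0r//; exact/negP.
Qed.

(** On {T <= s} the stopped process does not move after s, so that only the part
of an event of F_s that lies in {s < T} has to be tested, which phi_le does. *)
Lemma stopped_submartingale : submartingale P F (stopped T Y).
Proof.
have l0 : (0 : R) <= 0 by [].
have ms : adapted F (stopped T Y).
  move=> t t0.
  have h : measurable_wrt (F t) (fun w => \1_(after 0) w * phi (X (tmin t T w) w)).
    apply: (mwrtM (F_sigma hF t0)); last exact: (mwrt_comp phi_measurable (mX t0)).
    apply: (mwrt_indic (F_sigma hF t0)); exact: (F_mono hF l0 t0 (FT l0)).
  by rewrite (_ : stopped T Y t = fun w => \1_(after 0) w * phi (X (tmin t T w) w)) //;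
    apply/funext => w; exact: stoppedE.
have is_ : integrable_process P (stopped T Y).
  move=> t t0.
  have h : integ P (fun w => \1_(after 0) w * phi (X (tmin t T w) w)).
    apply: (@integ_h phi 0 0) => //; [|exact: FT].
    by move=> y; rewrite addr0.
  by rewrite (_ : stopped T Y t = fun w => \1_(after 0) w * phi (X (tmin t T w) w)) //;
    apply/funext => w; exact: stoppedE.
split=> // s t s0 st; have t0 := le_trans s0 st.
apply: (le_cond_exp (F_sigma hF s0) (F_meas hF s0) (ms s s0) (is_ s s0) (is_ t t0)) => B FB.
have mB := F_meas hF s0 FB; rewrite -(E_indic P (stopped T Y s) mB) -(E_indic P (stopped T Y t) mB).
(* the stopped process still moves on B1, and is constant on B0 *)
pose B1 := B `&` after s; pose B0 := B `\` after s.
have FB1 : F s B1 by apply: (sGI (F_sigma hF s0)) => //; exact: FT.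
have FB0 : F s B0 by apply: (sGD (F_sigma hF s0)) => //; exact: FT.
have B1s : B1 `<=` after s by exact: subIsetr.
have split_B (r : R) w : s <= r -> \1_B w * stopped T Y r w =
    \1_B1 w * phi (X (tmin r T w) w) + \1_B0 w * stopped T Y s w.
  move=> sr; rewrite !indicE; have [|nB] := boolP (w \in B); last first.
    have nB' : ~ B w by move/negP: nB => nB Bw; apply: nB; rewrite inE.
    by rewrite !memNset ?mul0r ?addr0// => -[].
  rewrite inE => Bw; have [sT'|Ts] := ltP s%:E (T w).
    rewrite (mem_set (_ : B1 w))// (memNset (_ : ~ B0 w)); last by move=> -[].
    rewrite !mul1r mul0r addr0 stoppedE indicE mem_set ?mul1r//.
    by rewrite /after/= (le_lt_trans _ sT')// lee_fin.
  rewrite (memNset (_ : ~ B1 w)); last by move=> -[_]; rewrite /after/= ltNge Ts.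
  rewrite (mem_set (_ : B0 w)); last by split=> //; rewrite /after/= ltNge Ts.
  by rewrite !mul1r mul0r add0r !stoppedE !tmin_r// (le_trans Ts).
have i1 r : s <= r -> integ P (fun w => \1_B1 w * phi (X (tmin r T w) w)).
  move=> sr; apply: (@integ_h phi 0 s) => //.
  by move=> y; rewrite addr0.
have i0 : integ P (fun w => \1_B0 w * stopped T Y s w).
  by apply: integ_indic; [exact: (F_meas hF s0)|exact: is_].
under eq_Rintegral do rewrite split_B//.
under [leRHS]eq_Rintegral do rewrite split_B//.
rewrite !E_D ?i1// lerD2r.
rewrite (_ : (fun w => \1_B1 w * phi (X (tmin s T w) w)) =
  (fun w => \1_B1 w * phi (X s w))); first exact: phi_le.
apply/funext => w; rewrite indicE; have [|_] := boolP (w \in B1); last by rewrite !mul0r.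
by rewrite inE => /B1s /ltW sT'; rewrite tmin_l.
Qed.

End one_time.

(** Up to the minimum of three times, M is a martingale, A is bounded, and the
variation of A along grids is bounded. *)
Lemma local_submartingale_comp : local_submartingale P F (fun t w => phi (X t w)).
Proof.
case: hX => _ [[_ _ [T1 l1 mN]] M0] [_ pA _] A0 _.
have [T2 [l2 A2]] := predictable_locally_bounded hF aA pA fA A0.
have [T3 [l3 A3]] := variation_times hF aA fA.
pose T n w := Order.min (T1 n w) (Order.min (T2 n w) (T3 n w)).
have lT : localizing_sequence P F T.
  exact: (localizing_min hF l1 (localizing_min hF l2 l3)).
split.
- by move=> t t0; exact: (mwrt_comp phi_measurable (aX t0)).
- by apply: filterS cX => w; exact: cadlag_path_comp.
exists T => // n.
have sT : stopping_time F (T n) by case: lT.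
have T10 w : (0 <= T1 n w)%E by case: l1 => /(_ n) [].
have TT1 w u : (u%:E <= T n w)%E -> (u%:E <= T1 n w)%E by rewrite /T le_min => /andP[].
have TT2 w u : (u%:E <= T n w)%E -> (u%:E <= T2 n w)%E.
  by rewrite /T !le_min => /and3P[].
have TT3 w u : (u%:E <= T n w)%E -> (u%:E <= T3 n w)%E.
  by rewrite /T !le_min => /and3P[].
have n4 : n.+1%:R <= n%:R + 4 * n.+1%:R :> R.
  by rewrite -natrM -natrD ler_nat -[leqLHS]mul1n (leq_trans _ (leq_addl _ _))// leq_mul2r orbT.
apply: (@stopped_submartingale (T n) (stopped (T1 n) M) (n%:R + 4 * n.+1%:R)) => //.
- apply: filterS cM => w [rM _] u u0; rewrite /stopped.
  case: (0 < T1 n w)%E; last exact: cvg_cst.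
  exact: (stopped_right_continuous (T10 w) u0 rM).
- move: XMA M0; apply: filterS2 => w xe m0 u u0 /TT1 uT; rewrite xe//; congr (_ + _).
  rewrite /stopped; case: ifPn => [_|]; first by rewrite (min_l uT).
  rewrite -leNgt => /(le_trans uT); rewrite lee_fin => u0'.
  by rewrite (_ : u = 0) ?m0//; apply/eqP; rewrite eq_le u0 u0'.
- by apply: filterS (A2 n) => w h u u0 /TT2 /(h u u0) /le_trans; apply.
- apply: filterS (A2 n) => w h s r m K s0 sr rT.
  apply: (@grid_variation R (A ^~ w) n.+1%:R n%:R s r m) => // [u u0 ur|k kr].
    by apply: h => //; apply: le_trans (TT2 _ _ rT); rewrite lee_fin.
  by apply: A3; apply: lt_le_trans (TT3 _ _ rT); rewrite lte_fin.
Qed.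

End local_submartingale.

Section main.
Context {R : realType} {d : measure_display} {Omega : measurableType d}.
Variable P : probability Omega R.
Variable F : R -> set (set Omega).
Hypothesis hF : usual_conditions P F.
Variables (X M A C V : R -> Omega -> R).
Hypothesis hX : class_Sigma_g P F X M A.
Hypothesis hA : CV_decomposition P F X A C V.

Lemma pos_part_submartingale :
  {ae P, forall w t, 0 < t -> 0 <= jump (C ^~ w) t} ->
  local_submartingale P F (pos_part X).
Proof.
move=> jC; apply: (local_submartingale_comp hF hX hA max0_lipschitz (maxxx 0)
  (f := smooth_pos) (g := slope_pos)).
- by move=> e e0 y z; exact: smooth_pos_convex.
- by move=> e e0 y; exact: slope_pos_le1.
- exact: slope_pos_continuous.
- by move=> e e0; exact: slope_pos_0.
- by move=> e e0; left => y; exact: slope_pos_ge0.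
- by move=> e e0 y; exact: smooth_pos_approx.
- by apply: filterS jC => w h e u e0 u0; rewrite mulr_ge0 ?h// slope_pos_ge0.
Qed.

(** The slope of the negative part is nonpositive, so that the terms
g (left_lim X) * jump C are nonnegative when the jumps of C are nonpositive. *)
Lemma neg_part_submartingale :
  {ae P, forall w t, 0 < t -> jump (C ^~ w) t <= 0} ->
  local_submartingale P F (neg_part X).
Proof.
move=> jC; apply: (local_submartingale_comp hF hX hA (phi := fun y => Num.max (- y) 0)
  (f := fun e y => smooth_pos e (- y)) (g := fun e y => - slope_pos e (- y))).
- by move=> y z; rewrite -[leRHS]normrN opprD; exact: max0_lipschitz.
- by rewrite oppr0 maxxx.
- move=> e e0 y z; apply: le_trans (smooth_pos_convex _ _ e0).
  by rewrite mulNr -mulrN opprB opprK addrC.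
- by move=> e e0 y; rewrite normrN; exact: slope_pos_le1.
- move=> e e0 y; apply: cvgN; apply: (@cvg_comp _ _ _ (@GRing.opp R) (slope_pos e)).
    exact: cvgN cvg_id.
  exact: slope_pos_continuous.
- by move=> e e0; rewrite slope_pos_0 ?oppr0.
- by move=> e e0; right => y; rewrite oppr_le0; exact: slope_pos_ge0.
- by move=> e e0 y; exact: smooth_pos_approx.
- apply: filterS jC => w h e u e0 u0; rewrite mulNr oppr_ge0 mulr_ge0_le0 ?h//.
  exact: slope_pos_ge0.
Qed.

Lemma nondecreasing_jump (x : R -> R) t : cadlag_path x ->
  (forall s t, 0 <= s -> s <= t -> x s <= x t) -> 0 < t -> 0 <= jump x t.
Proof.
move=> [_ ll] xm t0; rewrite subr_ge0 /left_lim t0; apply: limr_le; first exact: ll.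
near=> s; apply: xm; [near: s; exact: nbhs_left_ge|near: s; exact: nbhs_left_le].
Unshelve. all: by end_near. Qed.

Lemma nonincreasing_jump (x : R -> R) t : cadlag_path x ->
  (forall s t, 0 <= s -> s <= t -> x t <= x s) -> 0 < t -> jump x t <= 0.
Proof.
move=> [_ ll] xm t0; rewrite subr_le0 /left_lim t0; apply: limr_ge; first exact: ll.
near=> s; apply: xm; [near: s; exact: nbhs_left_ge|near: s; exact: nbhs_left_le].
Unshelve. all: by end_near. Qed.

End main.

Theorem lemma3 (R : realType) (d : measure_display) (Omega : measurableType d)
  (P : probability Omega R) (F : R -> set (set Omega))
  (X M A C V : R -> Omega -> R)
  (hF : usual_conditions P F)
  (hX : class_Sigma_g P F X M A)
  (hA : CV_decomposition P F X A C V) :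
  [/\ nondecreasing_process P C -> local_submartingale P F (pos_part X),
      nonincreasing_process P C -> local_submartingale P F (neg_part X),
      no_negative_jump P C ->
      {ae P, forall w t, 0 <= t ->
         stieltjes_int (\1_[set s | X s w != 0])
           (continuous_part (C ^~ w)) t = 0} ->
      local_submartingale P F (pos_part X) &
      no_positive_jump P C ->
      {ae P, forall w t, 0 <= t ->
         stieltjes_int (\1_[set s | X s w != 0])
           (continuous_part (C ^~ w)) t = 0} ->
      local_submartingale P F (neg_part X)].
Proof.
have fC : finite_variation P C by case: hA => _ [].
split.
- move=> mC; apply: (pos_part_submartingale hF hX hA).
  by move: fC mC; apply: filterS2 => w [cC _] mC t; exact: nondecreasing_jump.
- move=> mC; apply: (neg_part_submartingale hF hX hA).
  by move: fC mC; apply: filterS2 => w [cC _] mC t; exact: nonincreasing_jump.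
- move=> jC _; apply: (pos_part_submartingale hF hX hA).
  by apply: filterS jC => w jC t /ltW; exact: jC.
- move=> jC _; apply: (neg_part_submartingale hF hX hA).
  by apply: filterS jC => w jC t /ltW; exact: jC.
Qed.
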